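(* Let $z>y\ge1$ be integers and $0\le\alpha<1$ be such that the $(\alpha,z,y)$-Johnson Coverage$^*$ problem is NP-hard. Then for every constant $\varepsilon>0$, given as input a point-set $\mathcal{P}\subset\mathbb{R}^d$ of size $n$ (with $d=O(\log n)$) and a parameter $k$, it is NP-hard to distinguish between the following two cases: - Completeness: there exist $\mathcal{C}'=\{c_1,\dots,c_k\}\subseteq\mathbb{R}^d$ and $\sigma:\mathcal{P}\to\mathcal{C}'$ such that $\sum_{a\in\mathcal{P}}\|a-\sigma(a)\|_2\le n$. - Soundness: for every $\mathcal{C}'=\{c_1,\dots,c_k\}\subseteq\mathbb{R}^d$ and every $\sigma:\mathcal{P}\to\mathcal{C}'$, $\sum_{a\in\mathcal{P}}\|a-\sigma(a)\|_2\ge\left(\alpha+\sqrt{\frac{z-y+0.5}{z-y}}\,(1-\alpha)-\varepsilon\right)n$.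
   Context: $(\alpha,z,y)$-Johnson Coverage problem ($z>y\ge1$): given a universe $U=[n]=\{1,\dots,n\}$, a collection $E\subseteq\binom{[n]}{z}$ of $z$-element subsets, and a parameter $k$, distinguish between: (Completeness) there are $S_1,\dots,S_k\in\binom{[n]}{y}$ such that every $T\in E$ contains some $S_i$; (Soundness) for all $S_1,\dots,S_k\in\binom{[n]}{y}$, the number of $T\in E$ containing at least one $S_i$ is at most $\alpha|E|$. The $(\alpha,z,y)$-Johnson Coverage$^*$ problem is its special case restricted to instances satisfying $|E|=\omega(k\cdot|U|^{z-y-1})$. *)

(* Defs.v *)
From HB Require Import structures.
From mathcomp Require Import all_boot all_order all_algebra.
From mathcomp Require Import all_classical all_reals all_analysis.

Set Implicit Arguments.
Unset Strict Implicit.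
Unset Printing Implicit Defensive.

Import Order.TTheory GRing.Theory Num.Theory.
Import numFieldNormedType.Exports.

Local Open Scope classical_set_scope.
Local Open Scope ring_scope.

Definition bits := seq bool.

(** * Deterministic multitape Turing machines over {0, 1, blank} *)

(* [None] is the blank. *)
Definition sym := option bool.

Inductive dir := MoveL | Stay | MoveR.

(* Two-way infinite tape: [tleft] lists the cells left of the head, nearest
   first, and [tright] those to its right; unlisted cells are blank. *)
Record tape := Tape { tleft : seq sym; thead : sym; tright : seq sym }.

Definition tape_of (x : bits) : tape :=
  Tape [::] (ohead x) [seq Some b | b <- behead x].

Definition tape_move (m : dir) (t : tape) : tape :=
  match m with
  | MoveL => Tape (behead (tleft t)) (head None (tleft t))
                  (thead t :: tright t)
  | Stay => t
  | MoveR => Tape (thead t :: tleft t) (head None (tright t))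
                  (behead (tright t))
  end.

Definition tape_act (a : sym * dir) (t : tape) : tape :=
  tape_move a.2 (Tape (tleft t) a.1 (tright t)).

(* There are [mtapes.+1] tapes; a transition to [None] means halting. *)
Record machine := Machine {
  mtapes : nat;
  mstate : finType;
  mstart : mstate;
  mtrans : mstate -> mtapes.+1.-tuple sym ->
           option (mstate * mtapes.+1.-tuple (sym * dir))
}.

Definition config (M : machine) : Type :=
  (mstate M * (mtapes M).+1.-tuple tape)%type.

Definition init (M : machine) (x : bits) : config M :=
  (mstart M, [tuple tape_of (if i == ord0 then x else [::])
             | i < (mtapes M).+1]).

Definition step (M : machine) (c : config M) : option (config M) :=
  if mtrans c.1 [tuple thead (tnth c.2 i) | i < (mtapes M).+1]
    is Some (q, acts)
  then Some (q, [tuple tape_act (tnth acts i) (tnth c.2 i)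
                | i < (mtapes M).+1])
  else None.

(* The configuration after [t] steps, or the halting one if reached earlier. *)
Definition run (M : machine) (t : nat) (c : config M) : config M :=
  iter t (fun c' => odflt c' (step c')) c.

Fixpoint read_bits (s : seq sym) : bits :=
  if s is Some b :: s' then b :: read_bits s' else [::].

(* The output is the maximal blank-free word starting at the head of tape 0. *)
Definition output (M : machine) (c : config M) : bits :=
  let t := tnth c.2 ord0 in read_bits (thead t :: tright t).

(** * Polynomial time, NP, and NP-hardness of promise problems *)

Definition poly_bound (c n : nat) : nat := (c * n ^ c + c)%N.

Definition polytime (f : bits -> bits) : Prop :=
  exists (M : machine) (c : nat), forall x : bits,
    let cf := run (poly_bound c (size x)) (init M x) in
    step cf = None /\ output cf = f x.

(* Self-delimiting (hence injective) encoding of a list of words: each bit is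
   preceded by 1 and each word is closed by 0. *)
Definition encode (xs : seq bits) : bits :=
  flatten [seq rcons (flatten [seq [:: true; b] | b <- x]) false | x <- xs].

Definition in_NP (L : set bits) : Prop :=
  exists (V : bits -> bits) (c : nat), polytime V /\
    forall x : bits, L x <->
      exists w : bits, (size w <= poly_bound c (size x))%N /\
                       V (encode [:: x; w]) = [:: true].

Record promise_problem := PromiseProblem {
  yes_instance : set bits;
  no_instance : set bits
}.

(* Hardness under polynomial-time many-one reductions. *)
Definition NP_hard (Pi : promise_problem) : Prop :=
  forall L : set bits, in_NP L ->
  exists f : bits -> bits, polytime f /\
    forall x : bits, (L x -> yes_instance Pi (f x)) /\
                     (~ L x -> no_instance Pi (f x)).

(** * Johnson Coverage *)

(* Binary digits, least significant first. *)
Definition nat_bits (n : nat) : bits :=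
  [seq odd (n %/ 2 ^ i) | i <- iota 0 (up_log 2 n.+1)].

Section JohnsonCoverage.
Variable R : realType.

(* The universe is written in unary and each set as its 0/1 incidence vector. *)
Definition jc_code (n k : nat) (E : seq {set 'I_n}) : bits :=
  encode [:: nat_bits k, nseq n true
        & [seq [seq i \in T | i <- enum 'I_n] | T : {set 'I_n} <- E]].

(* [E] lists a set family without repetition, so |E| is [size E]. If [E] were
   empty, the instance would satisfy both completeness and soundness. *)
Definition jc_valid (z n k : nat) (E : seq {set 'I_n}) : Prop :=
  [/\ uniq E, all (fun T : {set 'I_n} => #|T| == z) E,
      (0 < size E)%N & (0 < k)%N].

Definition jc_completeness (y n k : nat) (E : seq {set 'I_n}) : Prop :=
  exists S : 'I_k -> {set 'I_n}, (forall i, #|S i| = y) /\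
    forall T, T \in E -> exists i, S i \subset T.

Definition jc_soundness (alpha : R) (y n k : nat) (E : seq {set 'I_n}) : Prop :=
  forall S : 'I_k -> {set 'I_n}, (forall i, #|S i| = y) ->
    (count (fun T : {set 'I_n} => [exists i, S i \subset T]) E)%:R
      <= alpha * (size E)%:R.

(* The restriction |E| = omega(k * |U|^(z-y-1)), with rate function [g]. *)
Definition jc_dense (g : nat -> R) (z y n k : nat) (E : seq {set 'I_n}) : Prop :=
  g n * (k * n ^ (z - y - 1))%:R <= (size E)%:R.

Definition johnson_coverage_star (g : nat -> R) (alpha : R) (z y : nat) :
    promise_problem :=
  PromiseProblem
    [set x | exists (n k : nat) (E : seq {set 'I_n}),
       [/\ x = jc_code k E, jc_valid z k E, jc_dense g z y k E
         & jc_completeness y k E]]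
    [set x | exists (n k : nat) (E : seq {set 'I_n}),
       [/\ x = jc_code k E, jc_valid z k E, jc_dense g z y k E
         & jc_soundness alpha y k E]].

(* An asymptotic constraint on instances is a property of a family of
   instances: some rate function tending to infinity bounds the whole family. *)
Definition johnson_coverage_star_NP_hard (alpha : R) (z y : nat) : Prop :=
  exists g : nat -> R, g n @[n --> \oo] --> +oo%R /\
    NP_hard (johnson_coverage_star g alpha z y).

End JohnsonCoverage.

(** * Continuous Euclidean k-median *)

Section KMedian.
Variable R : realType.

Definition rat_code (q : rat) : bits :=
  encode [:: [:: numq q < 0]; nat_bits `|numq q|%N; nat_bits `|denq q|%N].

Definition km_code (d k : nat) (P : seq 'rV[rat]_d) : bits :=
  encode [:: nat_bits k, nat_bits d
        & [seq encode [seq rat_code (a 0 j) | j <- enum 'I_d] | a : 'rV[rat]_d <- P]].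

(* [P] lists a point-set without repetition; input points are rational in order
   to be finitely encodable, while centers range over all of R^d. *)
Definition km_valid (C : R) (d k : nat) (P : seq 'rV[rat]_d) : Prop :=
  [/\ uniq P, (0 < size P)%N, (0 < k)%N & d%:R <= C * ln (size P)%:R].

Definition l2norm (d : nat) (v : 'rV[R]_d) : R :=
  Num.sqrt (\sum_(j < d) v 0 j ^+ 2).

Definition km_cost (d k : nat) (P : seq 'rV[rat]_d)
    (c : 'I_k -> 'rV[R]_d) (sigma : 'rV[rat]_d -> 'I_k) : R :=
  \sum_(a <- P) l2norm (map_mx ratr a - c (sigma a)).

(* Dimension at most [C * ln n]; cost at most [n] against at least [beta * n]. *)
Definition gap_kmedian (C beta : R) : promise_problem :=
  PromiseProblem
    [set x | exists (d k : nat) (P : seq 'rV[rat]_d),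
       [/\ x = km_code k P, km_valid C k P
         & exists (c : 'I_k -> 'rV[R]_d) (sigma : 'rV[rat]_d -> 'I_k),
             km_cost P c sigma <= (size P)%:R]]
    [set x | exists (d k : nat) (P : seq 'rV[rat]_d),
       [/\ x = km_code k P, km_valid C k P
         & forall (c : 'I_k -> 'rV[R]_d) (sigma : 'rV[rat]_d -> 'I_k),
             beta * (size P)%:R <= km_cost P c sigma]].

End KMedian.

(* Main.v *)
(** The set [T] of a Johnson coverage instance becomes the point
    [kappa * \sum_(i in T) w i], where the [w i] are unit vectors in dimension
    O(log |E|) with pairwise inner products at most a small constant [1/H].
    They are sign vectors of a binary code chosen greedily among all words of
    length d = O(log |E|); by the Chernoff bound few words are correlated with a
    given one, so the greedy code is polynomially large, and it is computed by
    listing all 2^d words.  Nearly orthonormal vectors suffice: no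
    Johnson-Lindenstrauss map is needed, because the lower bound below only
    involves constantly many coordinates.

    Completeness uses the centers [kappa * \sum_(i in S) w i].  For soundness,
    given any center [c], only boundedly many inner products [dot (w i) c] are
    large.  Apart from O(n^(z-y-1)) sets per center, a negligible number by
    density, a set has at most [y] of these large coordinates, which puts it at
    squared distance about [z - y] at least, and about [z - y + 1/2] unless it
    contains one specific [y]-set determined by [c].

    Polynomial time is obtained by compiling a small language of stack programs
    to multitape machines, and by closing the class of functions that such
    programs compute under composition, pairing, case distinction and folds with
    polynomially bounded results. *)
Require Import Defs.
From mathcomp Require Import all_boot all_order all_algebra.
From mathcomp Require Import all_classical all_reals all_analysis.
From mathcomp Require Import zify ring lra.

Set Implicit Arguments.
Unset Strict Implicit.
Unset Printing Implicit Defensive.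

Import Order.TTheory GRing.Theory Num.Theory.
(* [thead] is also a function of tuples. *)
Import Defs.

(** * Combining Turing machines *)

(** Input points are rational and must be written in lowest terms without computing a gcd, whereas
    the cost threshold demands a scale with [kappa ^+ 2 * (z - y + z ^ 2 / H) = 1], irrational in
    general. Sign vectors reconcile the two: [kappa] absorbs the square root that normalizes them,
    and a coordinate of a point is [(2 m - z) / (r * 2 ^ J)] for a count [m]. This works if the
    dimension is [D] times the power [4 ^ J] and [D * (H * (z - y) + z ^ 2) = H * r ^ 2]; if
    moreover [z!] divides [r], every nonzero coordinate is plus or minus the inverse of an integer.
    The dimension has to be logarithmic in the number of sets, not in the size of the universe,
    which density does not bound when [z = y + 1]. Hence codewords are given only to the elements
    that occur in some set. Over small universes, where density says nothing, [k] is unbounded on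
    yes-instances but bounded on no-instances; so it is the latter that are recognized one by
    one. *)

Definition content (t : tape) : bits := read_bits (thead t :: tright t).

Lemma ohead_content t : ohead (content t) = thead t.
Proof. by case: t => l [b|] r. Qed.

(** Cells beyond the first blank may hold leftovers, and moving onto them would uncover them; hence
    a pop stays put on a blank. *)
Lemma content_move_right t :
  content (tape_act (thead t, if thead t is Some _ then MoveR else Stay) t)
  = behead (content t).
Proof. by case: t => l [b|] [|s r]. Qed.

Lemma tape_act_stay t : tape_act (thead t, Stay) t = t.
Proof. by case: t. Qed.

Section Reachability.
Variable M : machine.
Implicit Types c : config M.

Definition reach c c' t := exists2 t0, (t0 <= t)%N & run t0 c = c'.

Lemma reach_refl c : reach c c 0.
Proof. by exists 0. Qed.

Lemma reach_trans c1 c2 c3 t t' :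
  reach c1 c2 t -> reach c2 c3 t' -> reach c1 c3 (t + t').
Proof.
move=> [a la <-] [b lb <-]; exists (b + a)%N; first by lia.
by rewrite /run iterD.
Qed.

Lemma reach_mono c c' t t' : reach c c' t -> (t <= t')%N -> reach c c' t'.
Proof. by move=> [a la <-] le; exists a => //; lia. Qed.

Lemma reach_step c c' : step c = Some c' -> reach c c' 1.
Proof. by move=> h; exists 1%N => //=; rewrite h. Qed.

Lemma run_halted c t : step c = None -> run t c = c.
Proof. by move=> h; elim: t => //= t ->; rewrite h. Qed.

Lemma runS t c : run t.+1 c = run t (odflt c (step c)).
Proof. by rewrite /run iterSr. Qed.

Lemma reach_halted c c' t : reach c c' t -> step c' = None -> run t c = c'.
Proof.
move=> [a la ra] h; rewrite -(subnK la) /run iterD -/(run a c) ra.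
exact: run_halted.
Qed.
End Reachability.

Lemma reach_simulate (M M' : machine) (F : config M -> config M') (c c' : config M) t :
  (forall d d', step d = Some d' -> step (F d) = Some (F d')) ->
  run t c = c' -> reach (F c) (F c') t.
Proof.
move=> sim; elim: t c => [|t IH] c; first by move=> <-; exact: reach_refl.
rewrite runS => h; case e: (step c) h => [d|] /= h.
  by rewrite -add1n; apply: reach_trans (IH _ h); apply: reach_step; exact: sim.
by move: h; rewrite run_halted // => <-; exists 0.
Qed.

(* The number of tapes is a parameter here, so that machines can be combined. *)
Record tm (N : nat) := TM {
  tm_state : finType;
  tm_start : tm_state;
  tm_trans : tm_state -> N.+1.-tuple sym ->
             option (tm_state * N.+1.-tuple (sym * dir)) }.

Definition tm_machine N (M : tm N) : machine := Machine (tm_start M) (@tm_trans N M).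

Definition no_act N (h : N.+1.-tuple sym) : N.+1.-tuple (sym * dir) :=
  [tuple (tnth h i, Stay) | i < N.+1].

Definition heads N (ts : N.+1.-tuple tape) : N.+1.-tuple sym :=
  [tuple thead (tnth ts i) | i < N.+1].

Definition apply_acts N (acts : N.+1.-tuple (sym * dir)) (ts : N.+1.-tuple tape) :=
  [tuple tape_act (tnth acts i) (tnth ts i) | i < N.+1].

Lemma stepE (M : machine) (c : config M) : step c =
  if mtrans c.1 (heads c.2) is Some (q, acts) then Some (q, apply_acts acts c.2)
  else None.
Proof. by []. Qed.

Lemma apply_no_act N (ts : N.+1.-tuple tape) : apply_acts (no_act (heads ts)) ts = ts.
Proof. by apply: eq_from_tnth => i; rewrite !tnth_mktuple tape_act_stay. Qed.

Definition halts N (M : tm N) (ts ts' : N.+1.-tuple tape) (t : nat) :=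
  exists q, reach ((tm_start M, ts) : config (tm_machine M)) (q, ts') t /\
            @step (tm_machine M) (q, ts') = None.

Lemma halts_mono N (M : tm N) ts ts' t t' :
  halts M ts ts' t -> (t <= t')%N -> halts M ts ts' t'.
Proof. by move=> [q [r h]] le; exists q; split=> //; exact: reach_mono le. Qed.

Section Combinators.
Variable N : nat.
Implicit Types (M : tm N) (ts : N.+1.-tuple tape) (i : 'I_N.+1).

Definition tm_act i (a : sym -> sym * dir) : tm N :=
  @TM N bool false (fun q h => if q then None
    else Some (true, [tuple if j == i then a (tnth h i) else (tnth h j, Stay) | j < N.+1])).

Lemma halts_act i a ts :
  halts (tm_act i a) ts
    [tuple if j == i then tape_act (a (thead (tnth ts i))) (tnth ts i)
           else tnth ts j | j < N.+1] 1.
Proof.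
exists true; split=> //; apply: reach_step; rewrite stepE /=; congr (Some (_, _)).
apply: eq_from_tnth => j; rewrite !tnth_mktuple.
by case: eqP => [->|] //; rewrite tape_act_stay.
Qed.

Definition tm_skip : tm N := @TM N unit tt (fun _ _ => None).

Lemma halts_skip ts : halts tm_skip ts ts 0.
Proof. by exists tt; split=> //; exact: reach_refl. Qed.

(** Where [M1] would halt, an idle step leads to the start of [M2]; this is the extra unit of time
    in [halts_seq]. *)
Definition tm_seq M1 M2 : tm N :=
  @TM N (tm_state M1 + tm_state M2)%type (inl (tm_start M1)) (fun q h =>
    match q with
    | inl q1 => if tm_trans q1 h is Some (q', a) then Some (inl q', a)
                else Some (inr (tm_start M2), no_act h)
    | inr q2 => if tm_trans q2 h is Some (q', a) then Some (inr q', a) else None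
    end).

Lemma halts_seq M1 M2 ts ts1 ts2 t1 t2 :
  halts M1 ts ts1 t1 -> halts M2 ts1 ts2 t2 ->
  halts (tm_seq M1 M2) ts ts2 (t1 + t2).+1.
Proof.
move=> [q1 [[u1 l1 r1] h1]] [q2 [[u2 l2 r2] h2]].
pose F1 (c : config (tm_machine M1)) : config (tm_machine (tm_seq M1 M2)) := (inl c.1, c.2).
pose F2 (c : config (tm_machine M2)) : config (tm_machine (tm_seq M1 M2)) := (inr c.1, c.2).
have A1 : reach (F1 (tm_start M1, ts)) (F1 (q1, ts1)) u1.
  apply: reach_simulate r1 => -[q s] d'; rewrite !stepE /=.
  by case: (tm_trans q _) => [[q' a]|] //= [<-].
have A2 : reach (F2 (tm_start M2, ts1)) (F2 (q2, ts2)) u2.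
  apply: reach_simulate r2 => -[q s] d'; rewrite !stepE /=.
  by case: (tm_trans q _) => [[q' a]|] //= [<-].
have A3 : reach (F1 (q1, ts1)) (F2 (tm_start M2, ts1)) 1.
  apply: reach_step; move: h1; rewrite !stepE /=.
  by case: (tm_trans q1 _) => [[]|] //= _; rewrite apply_no_act.
exists (inr q2); split.
  by apply: (reach_mono (reach_trans A1 (reach_trans A3 A2))); lia.
by move: h2; rewrite !stepE /=; case: (tm_trans q2 _) => [[]|].
Qed.

Definition tm_if i (P : sym -> bool) M1 M2 : tm N :=
  @TM N (option (tm_state M1 + tm_state M2)%type) None (fun q h =>
    match q with
    | None => Some (Some (if P (tnth h i) then inl (tm_start M1) else inr (tm_start M2)),
                    no_act h)
    | Some (inl q1) => if tm_trans q1 h is Some (q', a) then Some (Some (inl q'), a) else None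
    | Some (inr q2) => if tm_trans q2 h is Some (q', a) then Some (Some (inr q'), a) else None
    end).

Lemma halts_if i P M1 M2 ts ts' t :
  halts (if P (thead (tnth ts i)) then M1 else M2) ts ts' t ->
  halts (tm_if i P M1 M2) ts ts' t.+1.
Proof.
case e: (P _) => -[q [[u l r] h]].
  pose F (c : config (tm_machine M1)) : config (tm_machine (tm_if i P M1 M2)) :=
    (Some (inl c.1), c.2).
  have A : reach (F (tm_start M1, ts)) (F (q, ts')) u.
    apply: reach_simulate r => -[p s] d'; rewrite !stepE /=.
    by case: (tm_trans p _) => [[q' a]|] //= [<-].
  exists (Some (inl q)); split; last first.
    by move: h; rewrite !stepE /=; case: (tm_trans q _) => [[]|].
  apply: (@reach_mono _ _ _ (1 + u)); last by lia.
  apply: reach_trans A; apply: reach_step.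
  by rewrite stepE /= apply_no_act tnth_mktuple e.
pose F (c : config (tm_machine M2)) : config (tm_machine (tm_if i P M1 M2)) :=
  (Some (inr c.1), c.2).
have A : reach (F (tm_start M2, ts)) (F (q, ts')) u.
  apply: reach_simulate r => -[p s] d'; rewrite !stepE /=.
  by case: (tm_trans p _) => [[q' a]|] //= [<-].
exists (Some (inr q)); split; last first.
  by move: h; rewrite !stepE /=; case: (tm_trans q _) => [[]|].
apply: (@reach_mono _ _ _ (1 + u)); last by lia.
apply: reach_trans A; apply: reach_step.
by rewrite stepE /= apply_no_act tnth_mktuple e.
Qed.

(** The additional state [None] performs the test. Entering the body and returning to the test each
    cost one idle step. *)
Definition tm_while i (P : sym -> bool) M : tm N :=
  @TM N (option (tm_state M)) None (fun q h =>
    match q with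
    | None => if P (tnth h i) then Some (Some (tm_start M), no_act h) else None
    | Some q1 => if tm_trans q1 h is Some (q', a) then Some (Some q', a)
                 else Some (None, no_act h)
    end).

Lemma halts_while_stop i (P : sym -> bool) M ts :
  P (thead (tnth ts i)) = false -> halts (tm_while i P M) ts ts 0.
Proof.
move=> e; exists None; split; first exact: reach_refl.
by rewrite stepE /= tnth_mktuple e.
Qed.

Lemma halts_while_iter i (P : sym -> bool) M ts ts1 ts2 t1 t2 :
  P (thead (tnth ts i)) -> halts M ts ts1 t1 -> halts (tm_while i P M) ts1 ts2 t2 ->
  halts (tm_while i P M) ts ts2 (t1 + t2).+2.
Proof.
move=> e [q1 [[u l r] h]] [q2 [r2 h2]].
pose F (c : config (tm_machine M)) : config (tm_machine (tm_while i P M)) := (Some c.1, c.2).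
have A1 : reach (F (tm_start M, ts)) (F (q1, ts1)) u.
  apply: reach_simulate r => -[q s] d'; rewrite !stepE /=.
  by case: (tm_trans q _) => [[q' a]|] //= [<-].
have A3 : reach (F (q1, ts1)) (None, ts1) 1.
  apply: reach_step; move: h; rewrite !stepE /=.
  by case: (tm_trans q1 _) => [[]|] //= _; rewrite apply_no_act.
have A0 : reach ((None, ts) : config (tm_machine (tm_while i P M))) (F (tm_start M, ts)) 1.
  by apply: reach_step; rewrite stepE /= tnth_mktuple e apply_no_act.
exists q2; split=> //.
by apply: (reach_mono (reach_trans A0 (reach_trans A1 (reach_trans A3 r2)))); lia.
Qed.
End Combinators.

(* Each register holds a stack of bits, kept on its own tape to the right of the head. *)
Inductive cmd :=
| Skip
| Push of nat & bool
| Pop of nat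
| Seq of cmd & cmd
| If of nat & (sym -> bool) & cmd & cmd
| While of nat & (sym -> bool) & cmd.

Definition env := nat -> bits.

Definition upd (r : env) (i : nat) (v : bits) : env := fun j => if j == i then v else r j.

(* The last argument is an upper bound on the number of machine steps. *)
Inductive exec : cmd -> env -> env -> nat -> Prop :=
| ESkip r : exec Skip r r 0
| EPush i b r : exec (Push i b) r (upd r i (b :: r i)) 3
| EPop i r : exec (Pop i) r (upd r i (behead (r i))) 1
| ESeq c1 c2 r r1 r2 t1 t2 : exec c1 r r1 t1 -> exec c2 r1 r2 t2 ->
    exec (Seq c1 c2) r r2 (t1 + t2).+1
| EIf i (P : sym -> bool) c1 c2 r r' t : exec (if P (ohead (r i)) then c1 else c2) r r' t ->
    exec (If i P c1 c2) r r' t.+1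
| EStop i (P : sym -> bool) c r : P (ohead (r i)) = false -> exec (While i P c) r r 0
| EIter i (P : sym -> bool) c r r1 r2 t1 t2 : P (ohead (r i)) -> exec c r r1 t1 ->
    exec (While i P c) r1 r2 t2 -> exec (While i P c) r r2 (t1 + t2).+2
| EWeak c r r' t t' : exec c r r' t -> (t <= t')%N -> exec c r r' t'.

Fixpoint max_reg (c : cmd) : nat :=
  match c with
  | Skip => 0
  | Push i _ => i
  | Pop i => i
  | Seq c1 c2 => maxn (max_reg c1) (max_reg c2)
  | If i _ c1 c2 => maxn i (maxn (max_reg c1) (max_reg c2))
  | While i _ c => maxn i (max_reg c)
  end.

Section Compile.
Variable N : nat.

Fixpoint compile (c : cmd) : tm N :=
  match c with
  | Skip => tm_skip N
  | Push i b => tm_seq (tm_act (inord i) (fun s => (s, MoveL)))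
                       (tm_act (inord i) (fun _ => (Some b, Stay)))
  | Pop i => tm_act (inord i) (fun s => (s, if s is Some _ then MoveR else Stay))
  | Seq c1 c2 => tm_seq (compile c1) (compile c2)
  | If i P c1 c2 => tm_if (inord i) P (compile c1) (compile c2)
  | While i P c => tm_while (inord i) P (compile c)
  end.

Definition represents (ts : N.+1.-tuple tape) (r : env) :=
  forall i : 'I_N.+1, content (tnth ts i) = r i.

Lemma represents_head ts r i : represents ts r -> (i <= N)%N ->
  thead (tnth ts (inord i)) = ohead (r i).
Proof. by move=> rp le; rewrite -ohead_content rp inordK. Qed.

(** The bound on [max_reg] keeps [inord] faithful, as an index out of range would denote tape 0. A
    push moves left onto a cell of unknown content and overwrites it, so what lies left of the head
    never matters. *)
Lemma compileP c r r' t : exec c r r' t -> (max_reg c <= N)%N ->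
  forall ts, represents ts r -> exists2 ts', halts (compile c) ts ts' t & represents ts' r'.
Proof.
elim=> {c r r' t}.
- by move=> r _ ts rp; exists ts => //; exact: halts_skip.
- move=> i b r /= le ts rp.
  eexists; first by apply: (@halts_seq _ _ _ _ _ _ 1 1); exact: halts_act.
  move=> j; rewrite !tnth_mktuple eqxx /upd.
  have -> : (j == inord i) = (j == i :> nat) by rewrite -val_eqE /= inordK.
  case: (j =P i :> nat) => // e; have := rp (inord i); rewrite inordK // => <-.
  by case: (tnth ts _) => [[|a l] h s].
- move=> i r /= le ts rp.
  eexists; first exact: halts_act.
  move=> j; rewrite !tnth_mktuple /upd.
  have -> : (j == inord i) = (j == i :> nat) by rewrite -val_eqE /= inordK.
  case: (j =P i :> nat) => // e; rewrite content_move_right.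
  by have := rp (inord i); rewrite inordK // => <-.
- move=> c1 c2 r r1 r2 t1 t2 _ IH1 _ IH2 /=; rewrite geq_max => /andP[l1 l2] ts rp.
  have [ts1 h1 rp1] := IH1 l1 _ rp; have [ts2 h2 rp2] := IH2 l2 _ rp1.
  by exists ts2 => //; exact: halts_seq h1 h2.
- move=> i P c1 c2 r r' t _ IH /=; rewrite !geq_max => /and3P[l0 l1 l2] ts rp.
  have [|ts' h rp'] := IH _ _ rp; first by case: ifP.
  exists ts' => //; apply: halts_if; rewrite (represents_head rp l0).
  by case: ifP h.
- move=> i P c r e /=; rewrite geq_max => /andP[l0 l1] ts rp.
  by exists ts => //; apply: halts_while_stop; rewrite (represents_head rp l0).
- move=> i P c r r1 r2 t1 t2 e _ IH1 _ IH2 /= l; move: (l); rewrite geq_max => /andP[l0 l1] ts rp.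
  have [ts1 h1 rp1] := IH1 l1 _ rp; have [ts2 h2 rp2] := IH2 l _ rp1.
  by exists ts2 => //; apply: halts_while_iter h1 h2; rewrite (represents_head rp l0).
- move=> c r r' t t' _ IH le l ts rp; have [ts' h rp'] := IH l _ rp.
  by exists ts' => //; exact: halts_mono h le.
Qed.
End Compile.

(** A program adds at most one bit to a register per machine step; so a time bound is also a bound
    on the output, which is what makes compositions polynomial. *)
Lemma exec_size c r r' t : exec c r r' t -> forall i, (size (r' i) <= size (r i) + t)%N.
Proof.
elim=> {c r r' t} //.
- by move=> r i; lia.
- by move=> i b r j; rewrite /upd; case: eqP => [->|_] /=; lia.
- by move=> i r j; rewrite /upd; case: eqP => [->|_]; rewrite ?size_behead; lia.
- by move=> c1 c2 r r1 r2 t1 t2 _ IH1 _ IH2 i; have := IH1 i; have := IH2 i; lia.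
- by move=> i P c1 c2 r r' t _ IH j; have := IH j; lia.
- by move=> i P c r _ j; lia.
- by move=> i P c r r1 r2 t1 t2 _ _ IH1 _ IH2 j; have := IH1 j; have := IH2 j; lia.
- by move=> c r r' t t' _ IH le j; have := IH j; lia.
Qed.

Section Lift.
Variables (M : machine) (N : nat).
Hypothesis leN : (mtapes M <= N)%N.

Let emb : 'I_(mtapes M).+1 -> 'I_N.+1 := widen_ord (leN : ((mtapes M).+1 <= N.+1)%N).

(** A machine obtained from a hypothesis has its own number of tapes, while the program to be run
    after it may need more. The added tapes stay idle, so they are still blank when that program
    starts. *)
Definition tm_lift : tm N := @TM N (mstate M) (mstart M) (fun q h =>
  if mtrans q [tuple tnth h (emb i) | i < (mtapes M).+1] is Some (q', a)
  then Some (q', [tuple if (i < (mtapes M).+1)%N then tnth a (inord i)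
                        else (tnth h i, Stay) | i < N.+1])
  else None).

Definition restrict_tapes (ts : N.+1.-tuple tape) : (mtapes M).+1.-tuple tape :=
  [tuple tnth ts (emb i) | i < (mtapes M).+1].

Lemma heads_restrict ts : heads (restrict_tapes ts) =
  [tuple tnth (heads ts) (emb i) | i < (mtapes M).+1].
Proof. by apply: eq_from_tnth => i; rewrite !tnth_mktuple. Qed.

Lemma run_lift t q (ts : N.+1.-tuple tape) :
  exists2 c' : config (tm_machine tm_lift), run t ((q, ts) : config (tm_machine tm_lift)) = c'
  & [/\ run t ((q, restrict_tapes ts) : config M) = (c'.1, restrict_tapes c'.2),
     (step ((c'.1, restrict_tapes c'.2) : config M) = None -> step c' = None)
   & forall i : 'I_N.+1, (mtapes M < i)%N -> tnth c'.2 i = tnth ts i].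
Proof.
have key p (us : N.+1.-tuple tape) :
    if step ((p, us) : config (tm_machine tm_lift)) is Some c' then
      step ((p, restrict_tapes us) : config M) = Some (c'.1, restrict_tapes c'.2) /\
      forall i : 'I_N.+1, (mtapes M < i)%N -> tnth c'.2 i = tnth us i
    else step ((p, restrict_tapes us) : config M) = None.
  rewrite !stepE /= heads_restrict; case: (@mtrans M p _) => [[p' a]|] //=; split.
    congr (Some (_, _)); apply: eq_from_tnth => i; rewrite !tnth_mktuple /= ltn_ord.
    by congr (tape_act (tnth a _) _); apply: val_inj; rewrite /= inordK.
  by move=> i lt; rewrite !tnth_mktuple ifN ?tape_act_stay // -leqNgt.
elim: t q ts => [|t IH] q ts.
  exists (q, ts) => //; split=> // h; have := key q ts.
  by case: (step _) => // c' [e _]; move: h; rewrite e.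
have := key q ts; rewrite !runS; case e: (step _) => [[q' ts']|].
  move=> [/= -> ht] /=; have [c' -> [h1 h2 h3]] := IH q' ts'; exists c' => //; split=> //.
  by move=> i lt; rewrite h3 // ht.
move=> h; rewrite h /=; exists (q, ts); first by rewrite run_halted.
by rewrite run_halted //; split.
Qed.
End Lift.

Lemma content_tape_of x : content (tape_of x) = x.
Proof.
case: x => // b s; rewrite /content /=; suff -> : read_bits [seq Some b | b <- s] = s by [].
by elim: s => //= a s ->.
Qed.

(** * Polynomial-time functions on encoded data *)

Definition encw (x : bits) : bits := rcons (flatten [seq [:: true; b] | b <- x]) false.

Lemma encw_cons b x : encw (b :: x) = [:: true, b & encw x].
Proof. by []. Qed.

Lemma size_encw x : size (encw x) = (size x).*2.+1.
Proof. by elim: x => // b x IH; rewrite encw_cons /= IH. Qed.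

Lemma encode_cons x xs : encode (x :: xs) = encw x ++ encode xs.
Proof. by []. Qed.

Lemma exec_eq c r r1 r' t t' :
  exec c r r1 t -> r1 =1 r' -> (t <= t')%N -> exec c r r' t'.
Proof. by move=> h /funext <- le; exact: EWeak h le. Qed.

Ltac env_tac := let k := fresh "k" in
  try (match goal with |- _ =1 _ => move=> k end); rewrite /upd ?eqxx;
  repeat (case: eqP => ?); subst; rewrite ?eqxx ?cats0 ?cat0s ?revK //; try lia; try congruence.

(** * Stack programs that move, copy, encode and decode words *)

Section Macros.
Implicit Types (i j t : nat) (r : env).

Definition each i (body : bool -> cmd) : cmd :=
  While i isSome (If i (pred1 (Some true)) (Seq (Pop i) (body true)) (Seq (Pop i) (body false))).

(* [G p s] is the environment when [s] is still to be read from register [i]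
   and the bits of [p], in reverse order, have been processed. *)
Lemma exec_each i body K (G : bits -> bits -> env) :
  (forall p s, G p s i = s) ->
  (forall p b s, exec (body b) (upd (G p (b :: s)) i s) (G (b :: p) s) K) ->
  forall s p, exec (each i body) (G p s) (G (catrev s p) [::]) ((K + 5) * size s).
Proof.
move=> Gi hb; elim=> [|b s IH] p /=.
  by rewrite muln0; apply: EStop; rewrite Gi.
apply: EWeak.
  apply: EIter; [by rewrite Gi| |exact: (IH (b :: p))].
  apply: EIf; rewrite Gi /=.
  have pop : exec (Pop i) (G p (b :: s)) (upd (G p (b :: s)) i s) 1.
    by apply: exec_eq; [exact: EPop|move=> k; rewrite Gi|].
  case: b pop {IH} (hb p b s) => pop hb'; exact: ESeq pop hb'.
by lia.
Qed.

Definition rmove i j := each i (Push j).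

Lemma exec_rmove i j r : i <> j ->
  exec (rmove i j) r (upd (upd r i [::]) j (rev (r i) ++ r j)) (8 * size (r i)).
Proof.
move=> ne.
pose G p s := upd (upd r i s) j (p ++ r j).
have := @exec_each i (Push j) 3 G _ _ (r i) [::]; rewrite catrevE cats0 => h.
have e : r = G [::] (r i) by apply: funext; rewrite /G; env_tac.
rewrite {1}e; apply: h => [p s|p b s]; first by rewrite /G; env_tac.
apply: exec_eq; [exact: EPush| |done]; rewrite /G; env_tac.
Qed.

Definition clear i := each i (fun _ => Skip).

Lemma exec_clear i r v : r i = v -> exec (clear i) r (upd r i [::]) (5 * size v).
Proof.
move=> <-.
pose G (p : bits) s := upd r i s.
have := @exec_each i (fun _ => Skip) 0 G _ _ (r i) [::] => h.
have e : r = G [::] (r i) by apply: funext; rewrite /G; env_tac.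
rewrite {1}e; apply: h => [p s|p b s]; first by rewrite /G /upd eqxx.
by apply: exec_eq; [exact: ESkip| |done]; rewrite /G; env_tac.
Qed.

Definition move i j t := Seq (rmove i t) (rmove t j).

Lemma exec_move i j t r v : i <> j -> i <> t -> j <> t -> r t = [::] -> r j = [::] -> r i = v ->
  exec (move i j t) r (upd (upd r i [::]) j v) (16 * size v + 1).
Proof.
move=> + + + + + <-; move=> n1 n2 n3 rt rj; apply: exec_eq.
- by apply: ESeq; [apply: exec_rmove|apply: exec_rmove; lia].
- env_tac; rewrite rt cats0 revK rj cats0 //.
- by rewrite /upd eqxx rt cats0 size_rev; lia.
Qed.

Definition copy i j t := Seq (rmove i t) (each t (fun b => Seq (Push i b) (Push j b))).

Lemma exec_copy i j t r v : i <> j -> i <> t -> j <> t -> r t = [::] -> r j = [::] -> r i = v ->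
  exec (copy i j t) r (upd r j v) (20 * size v + 1).
Proof.
move=> + + + + + <-; move=> n1 n2 n3 rt rj; apply: exec_eq.
- apply: ESeq; first exact: exec_rmove.
  pose G p s := upd (upd (upd r i p) j p) t s.
  have e : upd (upd r i [::]) t (rev (r i) ++ r t) = G [::] (rev (r i)).
    by apply: funext; rewrite /G rt cats0; env_tac.
  rewrite e; apply: (@exec_each t _ 7 G).
    by move=> p s; rewrite /G /upd eqxx.
  move=> p b s; apply: exec_eq; [apply: ESeq; exact: EPush| |done].
  by rewrite /G; env_tac.
- by rewrite catrevE revK cats0; env_tac.
- by rewrite size_rev; lia.
Qed.

Definition encode_onto i j t :=
  Seq (Push j false) (Seq (rmove i t) (each t (fun b => Seq (Push j b) (Push j true)))).

Lemma exec_encode_onto i j t r v w : i <> j -> i <> t -> j <> t -> r t = [::] ->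
  r i = v -> r j = w ->
  exec (encode_onto i j t) r (upd (upd r i [::]) j (encw v ++ w)) (20 * size v + 5).
Proof.
move=> + + + + <- <-; move=> n1 n2 n3 rt; apply: exec_eq.
- apply: ESeq; first exact: EPush.
  apply: ESeq; first exact: exec_rmove.
  pose G p s := upd (upd (upd r i [::]) j (encw p ++ r j)) t s.
  set r1 := upd _ _ _; have e : r1 = G [::] (rev (r i)).
    by apply: funext; rewrite /r1 /G; env_tac; rewrite rt cats0.
  rewrite e; apply: (@exec_each t _ 7 G).
    by move=> p s; rewrite /G /upd eqxx.
  move=> p b s; apply: exec_eq; [apply: ESeq; exact: EPush| |done].
  by rewrite /G; env_tac.
- by rewrite catrevE revK cats0; env_tac.
- by rewrite size_rev {1}/upd; case: eqP => // _; lia.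
Qed.

Definition unpack i t :=
  Seq (rmove i t) (each t (fun b => Seq (Push i false) (Seq (Push i b) (Push i true)))).

Lemma exec_unpack i t r v : i <> t -> r t = [::] -> r i = v ->
  exec (unpack i t) r (upd r i (flatten [seq encw [:: b] | b <- v])) (24 * size v + 1).
Proof.
move=> + + <-; move=> n2 rt; apply: exec_eq.
- apply: ESeq; first exact: exec_rmove.
  pose G p s := upd (upd r i (flatten [seq encw [:: b] | b <- p])) t s.
  set r1 := upd _ _ _; have e : r1 = G [::] (rev (r i)).
    by apply: funext; rewrite /r1 /G; env_tac; rewrite rt cats0.
  rewrite e; apply: (@exec_each t _ 11 G).
    by move=> p s; rewrite /G /upd eqxx.
  move=> p b s; apply: exec_eq; [by apply: ESeq; [exact: EPush|apply: ESeq; exact: EPush]| |done].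
  by rewrite /G; env_tac.
- by rewrite catrevE revK cats0; env_tac.
- by rewrite size_rev; lia.
Qed.

Definition decode_loop i t := While i (pred1 (Some true))
  (Seq (Pop i) (If i (pred1 (Some true)) (Seq (Pop i) (Push t true)) (Seq (Pop i) (Push t false)))).
Definition decode_to i j t := Seq (decode_loop i t) (Seq (Pop i) (rmove t j)).

Lemma exec_decode_loop i t x y p r : i <> t ->
  exec (decode_loop i t) (upd (upd r i (encw x ++ y)) t p)
       (upd (upd r i (false :: y)) t (catrev x p)) (10 * size x).
Proof.
move=> ne; elim: x p => [|b x IH] p.
  by rewrite muln0; apply: EStop; rewrite /upd; case: eqP => // _; rewrite eqxx.
have ri s q : upd (upd r i s) t q i = s by rewrite /upd eqxx; case: eqP.
apply: (@EWeak _ _ _ ((1 + 6).+1 + 10 * size x).+2); last by rewrite /=; lia.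
apply: EIter; [by rewrite ri| |exact: (IH (b :: p))].
  pose r1 := upd (upd r i (b :: encw x ++ y)) t p.
  pose r2 := upd (upd r i (encw x ++ y)) t p.
  have p1 : exec (Pop i) (upd (upd r i (encw (b :: x) ++ y)) t p) r1 1.
    by apply: exec_eq; [exact: EPop| |done]; rewrite /r1; env_tac.
  have p2 : exec (Pop i) r1 r2 1.
    by apply: exec_eq; [exact: EPop| |done]; rewrite /r1 /r2; env_tac.
  apply: ESeq p1 _; apply: EIf; rewrite {1}/r1 ri /=.
  have p3 : exec (Push t b) r2 (upd (upd r i (encw x ++ y)) t (b :: p)) 3.
    by apply: exec_eq; [exact: EPush| |done]; rewrite /r2; env_tac.
  by case: b {IH} @r1 p2 p3 => r1 p2 p3; exact: ESeq p2 p3.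
Qed.

Lemma exec_decode_to i j t x y r : i <> j -> i <> t -> j <> t ->
  r t = [::] -> r j = [::] -> r i = encw x ++ y ->
  exec (decode_to i j t) r (upd (upd r i y) j x) (20 * size x + 5).
Proof.
move=> n1 n2 n3 rt rj ri; apply: exec_eq.
- apply: ESeq.
    have e : r = upd (upd r i (encw x ++ y)) t [::] by apply: funext; env_tac.
    rewrite {1}e; exact: exec_decode_loop.
  apply: ESeq; first exact: EPop.
  by apply: exec_rmove; lia.
- by rewrite catrevE cats0; env_tac; rewrite ?rj ?cats0 ?revK //.
- by rewrite !catrevE !cats0 /upd ?eqxx; repeat (case: eqP => ?); subst; try lia; rewrite /= ?size_rev; lia.
Qed.

(** Decoding an empty register is harmless, in agreement with [behead [::] = [::]]. *)
Lemma exec_decode_nil i j t r : i <> j -> i <> t -> j <> t ->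
  r t = [::] -> r i = [::] -> exec (decode_to i j t) r r 5.
Proof.
move=> n1 n2 n3 rt ri; apply: exec_eq.
- apply: ESeq; first by apply: EStop; rewrite ri.
  apply: ESeq; first exact: EPop.
  by apply: exec_rmove; lia.
- by rewrite ri /=; env_tac; rewrite rt.
- by rewrite /upd; case: eqP => ?; rewrite ?rt ?ri.
Qed.
End Macros.

(** The base [n + 2] is at least 2 even at 0, so that a single exponent absorbs constants, sums and
    products. *)
Definition polyb (T : nat -> nat) := exists c, forall n, (T n <= (n + 2) ^ c)%N.

Lemma exp_geW m c c' : (2 <= m)%N -> (c <= c')%N -> (m ^ c <= m ^ c')%N.
Proof. by move=> m2 le; rewrite leq_exp2l. Qed.

Lemma polyb_const k : polyb (fun=> k).
Proof.
exists k => n; apply: (leq_trans (ltnW (ltn_expl k (_ : 1 < 2)%N))) => //.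
by case: k => // k; rewrite leq_exp2r; lia.
Qed.

Lemma polyb_id : polyb id.
Proof. by exists 1%N => n; rewrite expn1; lia. Qed.

Lemma polyb_mul S T : polyb S -> polyb T -> polyb (fun n => S n * T n)%N.
Proof. by move=> [a ha] [b hb]; exists (a + b)%N => n; rewrite expnD leq_mul. Qed.

Lemma polyb_add S T : polyb S -> polyb T -> polyb (fun n => S n + T n)%N.
Proof.
move=> [a ha] [b hb]; exists (a + b).+1 => n.
apply: leq_trans (leq_add (ha n) (hb n)) _.
rewrite expnS expnD.
have p1 : (0 < (n + 2) ^ a)%N by rewrite expn_gt0; lia.
have p2 : (0 < (n + 2) ^ b)%N by rewrite expn_gt0; lia.
by nia.
Qed.

Lemma polyb_exp S k : polyb S -> polyb (fun n => S n ^ k)%N.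
Proof.
move=> hS; elim: k => [|k IH]; first exact: polyb_const.
have [c hc] := polyb_mul hS IH; exists c => n; rewrite expnS; exact: hc.
Qed.

Ltac polyb_tac := repeat first [apply: polyb_add | apply: polyb_mul | apply: polyb_exp
  | exact: polyb_id | exact: polyb_const].

Definition clean (b : nat) (r : env) := forall i, (b <= i)%N -> r i = [::].

(* The program reads its argument from register 0 and leaves the value there;
   it may use the registers from [b] on, which are empty before and after. *)
Definition pf (A B : Type) (cA : A -> bits) (cB : B -> bits) (f : A -> B) : Prop :=
  exists (p : nat -> cmd) (c : nat), forall b, (0 < b)%N -> forall a r,
    r 0 = cA a -> clean b r ->
    exec (p b) r (upd r 0 (cB (f a))) ((size (cA a) + 2) ^ c).

Lemma pf_intro A B cA cB (f : A -> B) (p : nat -> cmd) (T : nat -> nat) :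
  polyb T ->
  (forall b, (0 < b)%N -> forall a r, r 0 = cA a -> clean b r ->
    exec (p b) r (upd r 0 (cB (f a))) (T (size (cA a)))) ->
  pf cA cB f.
Proof.
move=> [c hc] h; exists p, c => b b0 a r r0 cl.
exact: EWeak (h b b0 a r r0 cl) (hc _).
Qed.

(** The size of the value is read off the running time on otherwise empty registers; the exponent is
    raised by one to pay for the input length in [exec_size]. *)
Lemma pf_elim A B cA cB (f : A -> B) : pf cA cB f ->
  exists (p : nat -> cmd) (c : nat), (forall b, (0 < b)%N -> forall a r,
    r 0 = cA a -> clean b r ->
    exec (p b) r (upd r 0 (cB (f a))) ((size (cA a) + 2) ^ c)) /\
    forall a, (size (cB (f a)) <= (size (cA a) + 2) ^ c)%N.
Proof.
move=> [p [c h]]; exists p, c.+1; split=> [b b0 a r r0 cl|a].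
  by apply: EWeak (h b b0 a r r0 cl) _; apply: exp_geW; lia.
have := h 1%N isT a (upd (fun=> [::]) 0 (cA a)); rewrite /upd /= => h1.
have /(h1 erefl) : clean 1 (fun j => if j == 0 then cA a else [::]) by case.
move=> /exec_size /(_ 0) /= le; apply: leq_trans le _; rewrite expnS.
have : (0 < (size (cA a) + 2) ^ c)%N by rewrite expn_gt0; lia.
by nia.
Qed.

Lemma pf_size A B cA cB (f : A -> B) : pf cA cB f ->
  exists c, forall a, (size (cB (f a)) <= (size (cA a) + 2) ^ c)%N.
Proof. by move=> /pf_elim [p [c [_ h]]]; exists c. Qed.

Ltac cl_tac := let i := fresh "i" in let le := fresh "le" in
  move=> i le; rewrite /upd; repeat (case: eqP => [?|_]; [first [exfalso; lia | reflexivity]|]);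
  match goal with H : clean _ _ |- _ => apply: H; lia end.

Ltac cl1 := match goal with |- [::] = _ => symmetry | _ => idtac end; match goal with H : clean _ _ |- _ => apply: H; lia end.

Ltac look := rewrite /upd ?eqxx; repeat (case: eqP => [?|?]; try (exfalso; lia));
  first [reflexivity | eassumption | cl1 | idtac].

Ltac side L := apply: L; first [lia | cl_tac | look].

Lemma pf_ext A B cA cB (f g : A -> B) : f =1 g -> pf cA cB f -> pf cA cB g.
Proof. by move=> /funext ->. Qed.

Lemma pf_code A A' B B' (cA : A -> bits) (cA' : A' -> bits) (cB : B -> bits) (cB' : B' -> bits)
    (f : A -> B) (g : A' -> B') (h : A' -> A) :
  (forall a, cA' a = cA (h a)) -> (forall a, cB' (g a) = cB (f (h a))) ->
  pf cA cB f -> pf cA' cB' g.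
Proof.
move=> hA hB [p [c pc]]; exists p, c => b b0 a r r0 cl; rewrite hB hA.
by apply: pc => //; rewrite r0 hA.
Qed.

Lemma pf_id A (cA : A -> bits) : pf cA cA id.
Proof.
exists (fun=> Skip), 0 => b b0 a r r0 cl.
by apply: exec_eq; [exact: ESkip| |done]; env_tac.
Qed.

Lemma pf_comp A B C cA cB cC (f : A -> B) (g : B -> C) :
  pf cA cB f -> pf cB cC g -> pf cA cC (fun a => g (f a)).
Proof.
move=> /pf_elim [p [c [pc sc]]] [q [d qd]].
apply: (@pf_intro _ _ _ _ _ (fun b => Seq (p b) (q b))
  (fun n => (n + 2) ^ c + ((n + 2) ^ c + 2) ^ d + 1)%N); first by polyb_tac.
move=> b b0 a r r0 cl; apply: exec_eq.
- apply: ESeq; first by side pc.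
  by side qd.
- by env_tac.
- suff : ((size (cB (f a)) + 2) ^ d <= ((size (cA a) + 2) ^ c + 2) ^ d)%N by lia.
  by case: {qd} d => // d; rewrite leq_exp2r // leq_add2r.
Qed.

Definition cpair A B (cA : A -> bits) (cB : B -> bits) (x : A * B) : bits := encw (cA x.1) ++ cB x.2.
Definition clist A (cA : A -> bits) (l : seq A) : bits := encode [seq cA x | x <- l].
Definition craw (x : bits) : bits := x.
Definition cbool (b : bool) : bits := [:: b].
Definition cunit (u : unit) : bits := [::].
(** Unary, and written so that the code of [n] is also the code of a list of [n] units: arithmetic
    becomes list processing. *)
Definition cnat (n : nat) : bits := nseq n false.

Lemma leq_exp_add2 m n d : (m <= n)%N -> ((m + 2) ^ d <= (n + 2) ^ d)%N.
Proof. by case: d => // d le; rewrite leq_exp2r // leq_add2r. Qed.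

Lemma pf_pair C A B (cC : C -> bits) (cA : A -> bits) (cB : B -> bits) f g :
  pf cC cA f -> pf cC cB g -> pf cC (cpair cA cB) (fun x => (f x, g x)).
Proof.
move=> /pf_elim [p [c [pc sc]]] /pf_elim [q [d [qd sd]]].
pose prog b := Seq (copy 0 b b.+1) (Seq (p b.+1) (Seq (move 0 b.+1 b.+2)
  (Seq (move b 0 b.+2) (Seq (q b.+2) (encode_onto b.+1 0 b.+2))))).
apply: (@pf_intro _ _ _ _ _ prog
  (fun n => 50 * n + 50 * (n + 2) ^ c + (n + 2) ^ d + 50)%N); first by polyb_tac.
move=> b b0 a r r0 cl.
apply: exec_eq.
- apply: ESeq; first by side (exec_copy (i:=0) (j:=b) (t:=b.+1)).
  apply: ESeq; first by side pc.
  apply: ESeq; first by side exec_move.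
  apply: ESeq; first by side exec_move.
  apply: ESeq; first by side qd.
  by side exec_encode_onto.
- by env_tac; cl1.
- by rewrite ?r0; have := sc a; have := sd a; lia.
Qed.

Fixpoint pushes (v : bits) : cmd := if v is b :: v' then Seq (pushes v') (Push 0 b) else Skip.

Lemma exec_pushes v r w : r 0 = w -> exec (pushes v) r (upd r 0 (v ++ w)) (4 * size v).
Proof.
move=> e; elim: v => [|b v IH] /=.
  by apply: exec_eq; [exact: ESkip|env_tac|].
apply: exec_eq; first by apply: ESeq; [exact: IH|exact: EPush].
- by env_tac.
- by lia.
Qed.

Lemma pf_const A B (cA : A -> bits) (cB : B -> bits) (v : B) : pf cA cB (fun=> v).
Proof.
apply: (@pf_intro _ _ _ _ _ (fun b => Seq (clear 0) (pushes (cB v)))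
  (fun n => 5 * n + 4 * size (cB v) + 1)%N); first by polyb_tac.
move=> b b0 a r r0 cl; apply: exec_eq.
- by apply: ESeq; [side exec_clear|side exec_pushes].
- by env_tac.
- by rewrite ?r0; lia.
Qed.

Definition first_prog b := Seq (decode_to 0 b b.+1) (Seq (clear 0) (move b 0 b.+1)).

Lemma exec_first b x y r : (0 < b)%N -> clean b r -> r 0 = encw x ++ y ->
  exec (first_prog b) r (upd r 0 x) (50 * size (encw x ++ y) + 50).
Proof.
move=> b0 cl e; apply: exec_eq.
- apply: ESeq; first by side exec_decode_to.
  apply: ESeq; first by side exec_clear.
  by side exec_move.
- by env_tac; cl1.
- by rewrite size_cat size_encw; lia.
Qed.

Lemma pf_fst A B (cA : A -> bits) (cB : B -> bits) : pf (cpair cA cB) cA fst.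
Proof.
apply: (@pf_intro _ _ _ _ _ first_prog (fun n => 50 * n + 50)%N); first by polyb_tac.
by move=> b b0 a r r0 cl; exact: exec_first.
Qed.

Definition rest_prog b := Seq (decode_to 0 b b.+1) (clear b).

Lemma exec_rest b x y r : (0 < b)%N -> clean b r -> r 0 = encw x ++ y ->
  exec (rest_prog b) r (upd r 0 y) (50 * size (encw x ++ y) + 50).
Proof.
move=> b0 cl e; apply: exec_eq.
- apply: ESeq; first by side exec_decode_to.
  by side exec_clear.
- by env_tac; cl1.
- by rewrite size_cat size_encw; lia.
Qed.

Lemma pf_snd A B (cA : A -> bits) (cB : B -> bits) : pf (cpair cA cB) cB snd.
Proof.
apply: (@pf_intro _ _ _ _ _ rest_prog (fun n => 50 * n + 50)%N); first by polyb_tac.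
by move=> b b0 a r r0 cl; exact: exec_rest.
Qed.

Lemma pf_behead A (cA : A -> bits) : pf (clist cA) (clist cA) behead.
Proof.
apply: (@pf_intro _ _ _ _ _ rest_prog (fun n => 50 * n + 50)%N); first by polyb_tac.
move=> b b0 [|a l] r r0 cl; last exact: exec_rest.
apply: exec_eq.
- apply: ESeq; first by side exec_decode_nil.
  by side exec_clear.
- by env_tac; first [cl1 | rewrite r0].
- by have -> : r b = [::] by cl1.
Qed.

Lemma ohead_clist A (cA : A -> bits) l : isSome (ohead (clist cA l)) = (0 < size l)%N.
Proof. by case: l => // a l; rewrite /clist /= encode_cons; case: (cA a). Qed.

Lemma pf_head A (cA : A -> bits) (x0 : A) : pf (clist cA) cA (head x0).
Proof.
apply: (@pf_intro _ _ _ _ _ (fun b => If 0 isSome (first_prog b) (pushes (cA x0)))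
  (fun n => 50 * n + 50 + 4 * size (cA x0) + 5)%N); first by polyb_tac.
move=> b b0 l r r0 cl; apply: (@EWeak _ _ _
  (50 * size (clist cA l) + 50 + 4 * size (cA x0)).+1); last by lia.
apply: EIf; rewrite r0 ohead_clist; case: l r0 => [|a l] r0 /=.
  have r0' : r 0 = [::] := r0.
  by apply: exec_eq; [exact: exec_pushes r0'|env_tac|lia].
by apply: EWeak (@exec_first b (cA a) (clist cA l) r b0 cl r0) _; rewrite /clist /= encode_cons; lia.
Qed.

Lemma pf_nilp A (cA : A -> bits) : pf (clist cA) cbool (@nilp A).
Proof.
apply: (@pf_intro _ _ _ _ _ (fun b => If 0 isSome (Seq (clear 0) (Push 0 false)) (Push 0 true))
  (fun n => 5 * n + 10)%N); first by polyb_tac.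
move=> b b0 l r r0 cl; apply: (@EWeak _ _ _ (5 * size (clist cA l) + 5).+1); last by lia.
apply: EIf; rewrite r0 ohead_clist; case: l r0 => [|a l] r0 /=.
  by apply: exec_eq; [exact: EPush|env_tac; rewrite r0|].
apply: exec_eq; [by apply: ESeq; [side exec_clear|exact: EPush]|env_tac|].
by rewrite r0; lia.
Qed.

Lemma pf_if C A (cC : C -> bits) (cA : A -> bits) (t : C -> bool) f g :
  pf cC cbool t -> pf cC cA f -> pf cC cA g -> pf cC cA (fun x => if t x then f x else g x).
Proof.
move=> [pt [ct ht]] [p [c hp]] [q [d hq]].
pose prog b := Seq (copy 0 b b.+1) (Seq (pt b.+1) (If 0 (pred1 (Some true))
  (Seq (clear 0) (Seq (move b 0 b.+1) (p b))) (Seq (clear 0) (Seq (move b 0 b.+1) (q b))))).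
apply: (@pf_intro _ _ _ _ _ prog
  (fun n => (n + 2) ^ ct + 50 * n + (n + 2) ^ c + (n + 2) ^ d + 50)%N); first by polyb_tac.
move=> b b0 a r r0 cl; apply: exec_eq.
- apply: ESeq; first by side (exec_copy (i:=0) (j:=b) (t:=b.+1)).
  apply: ESeq; first by side ht.
  apply: (EIf (r' := upd r 0 (cA (if t a then f a else g a)))
    (t := (5 + (16 * size (cC a) + 1 + ((size (cC a) + 2) ^ c + (size (cC a) + 2) ^ d)).+1).+1)).
  set r1 := upd (upd _ _ _) _ _; have -> : ohead (r1 0) = Some (t a) by [].
  rewrite /r1 {r1}; case: (t a).
    apply: exec_eq.
    + apply: ESeq; first by side exec_clear.
      apply: ESeq; first by side exec_move.
      by side hp.
    + by env_tac; cl1.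
    + by rewrite ?r0 /=; lia.
  apply: exec_eq.
  + apply: ESeq; first by side exec_clear.
    apply: ESeq; first by side exec_move.
    by side hq.
  + by env_tac; cl1.
  + by rewrite ?r0 /=; lia.
- by env_tac.
- by rewrite r0; lia.
Qed.

Lemma pf_unpack : pf craw (clist cbool) id.
Proof.
apply: (@pf_intro _ _ _ _ _ (fun b => unpack 0 b) (fun n => 24 * n + 1)%N); first by polyb_tac.
move=> b b0 a r r0 cl; apply: exec_eq; first by side exec_unpack.
- by env_tac; rewrite r0 /clist /cbool /encode -map_comp.
- by rewrite r0.
Qed.

Lemma pf_raw_cons : pf (cpair cbool craw) craw (fun x => x.1 :: x.2).
Proof.
pose prog (b : nat) := Seq (Pop 0) (If 0 (pred1 (Some true))
  (Seq (Pop 0) (Seq (Pop 0) (Push 0 true))) (Seq (Pop 0) (Seq (Pop 0) (Push 0 false)))).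
apply: (@pf_intro _ _ _ _ _ prog (fun n => 20)%N); first by polyb_tac.
move=> b b0 [x y] r r0 cl; rewrite /cpair /= in r0 *.
apply: exec_eq.
- apply: ESeq; first exact: EPop.
  apply: (EIf (r' := upd r 0 (x :: y)) (t := 10)).
  set r1 := upd _ _ _; have e : r1 0 = [:: x, false & y] by rewrite /r1 /upd /= r0.
  by rewrite e /r1 {r1 e}; case: x r0 => r0; (apply: exec_eq;
    [apply: ESeq; [exact: EPop|apply: ESeq; [exact: EPop|exact: EPush]]
    |by env_tac; rewrite r0|by []]).
- by env_tac.
- by [].
Qed.

Lemma size_clist_cons A (cA : A -> bits) a l :
  size (clist cA (a :: l)) = ((size (cA a)).*2.+1 + size (clist cA l))%N.
Proof. by rewrite /clist /= encode_cons size_cat size_encw. Qed.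

Lemma size_clist A (cA : A -> bits) l : (size l <= size (clist cA l))%N.
Proof. by elim: l => // a l IH; rewrite size_clist_cons /=; lia. Qed.

Definition fold_env (r : env) b x y z : env := upd (upd (upd r b x) b.+1 y) 0 z.

(** Iterating a polynomial-time step can make the accumulator exponentially long, hence the bound
    required for every intermediate one. Register [b] keeps the context, [b.+1] the unread part of
    the list, and 0 the accumulator. *)
Lemma pf_foldl C A B (cC : C -> bits) (cA : A -> bits) (cB : B -> bits)
    (F : C -> A -> B -> B) (l : C -> seq A) (x0 : C -> B) k :
  pf cC (clist cA) l -> pf cC cB x0 ->
  pf (cpair cC (cpair cA cB)) cB (fun x => F x.1 x.2.1 x.2.2) ->
  (forall c i, (size (cB (foldl (fun x a => F c a x) (x0 c) (take i (l c)))) <=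
                (size (cC c) + 2) ^ k)%N) ->
  pf cC cB (fun c => foldl (fun x a => F c a x) (x0 c) (l c)).
Proof.
move=> /pf_elim [pl [cl [hl sl]]] /pf_elim [px [cx [hx sx]]] [pF [cF hF]] bnd.
pose body b := Seq (decode_to b.+1 b.+2 b.+3) (Seq (encode_onto b.+2 0 b.+3)
  (Seq (copy b b.+2 b.+3) (Seq (encode_onto b.+2 0 b.+3) (pF b.+2)))).
pose prog b := Seq (copy 0 b b.+1) (Seq (pl b.+1) (Seq (move 0 b.+1 b.+2)
  (Seq (copy b 0 b.+2) (Seq (px b.+2) (Seq (While b.+1 isSome (body b)) (clear b)))))).
(* Bound for one round: the argument of [pF] encodes the context, the item and the accumulator, the
   first two at doubled length. *)
pose W n := (100 * n + 100 * (n + 2) ^ cl + (2 * n + 2 * (n + 2) ^ cl + (n + 2) ^ k + 10 + 2) ^ cF + 100)%N.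
apply: (@pf_intro _ _ _ _ _ prog
  (fun n => 100 * n + 100 * (n + 2) ^ cl + (n + 2) ^ cx + W n * (n + 2) ^ cl + 100)%N).
  by rewrite /W; polyb_tac.
move=> b b0 c r r0 clr.
set n := size (cC c).
have loop s acc : (forall i, (size (cB (foldl (fun x a => F c a x) acc (take i s))) <= (n + 2) ^ k)%N) ->
    (size (clist cA s) <= (n + 2) ^ cl)%N ->
    exec (While b.+1 isSome (body b)) (fold_env r b (cC c) (clist cA s) (cB acc)) (fold_env r b (cC c) [::] (cB (foldl (fun x a => F c a x) acc s)))
      (W n * size s).
  elim: s acc => [|a s IH] acc hb hs.
    by rewrite muln0; apply: EStop; rewrite /fold_env /upd; case: eqP => [|_]; [lia|rewrite eqxx].
  have hs' := hs; rewrite size_clist_cons in hs'.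
  have := hb 0; rewrite take0 /= => h0.
  apply: (@EWeak _ _ _ ((W n - 2) + W n * size s).+2); last by rewrite /= mulnS /W; lia.
  apply: EIter; last first.
    - by apply: (IH (F c a acc)); [move=> i; exact: (hb i.+1)|lia].
  - apply: exec_eq.
    + apply: ESeq.
        apply: (@exec_decode_to _ _ _ (cA a) (clist cA s)); first [lia|by rewrite /fold_env; look|idtac].
      apply: ESeq; first by rewrite /fold_env; side exec_encode_onto.
      apply: ESeq; first by rewrite /fold_env; side (exec_copy (i:=b) (j:=b.+2) (t:=b.+3)).
      apply: ESeq; first by rewrite /fold_env; side exec_encode_onto.
      by apply: (hF b.+2 _ (c, (a, acc))) => //; rewrite /fold_env; first [cl_tac|look].
    + by rewrite /fold_env; env_tac; cl1.
    + have : (((size (cpair cC (cpair cA cB) (c, (a, acc)))) + 2) ^ cF <=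
        (2 * n + 2 * (n + 2) ^ cl + (n + 2) ^ k + 10 + 2) ^ cF)%N.
        by apply: leq_exp_add2; rewrite /cpair /= !size_cat !size_encw -/n; lia.
      by rewrite /W; lia.
  - by rewrite /fold_env /upd; case: eqP => [|_]; [lia|rewrite eqxx ohead_clist].
apply: exec_eq.
- apply: ESeq; first by side (exec_copy (i:=0) (j:=b) (t:=b.+1)).
  apply: ESeq; first by side hl.
  apply: ESeq; first by side exec_move.
  apply: ESeq; first by side (exec_copy (i:=b) (j:=0) (t:=b.+2)).
  apply: ESeq; first by side hx.
  apply: ESeq; last by side exec_clear.
  set r1 := upd _ _ _.
  have -> : r1 = fold_env r b (cC c) (clist cA (l c)) (cB (x0 c)) by apply: funext; rewrite /r1 /fold_env; env_tac; cl1.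
  by apply: loop => // i; exact: bnd.
- by rewrite /fold_env; env_tac; cl1.
- have := sl c; have := sx c; rewrite -/n => h1 h2.
  have h3 : (W n * size (l c) <= W n * (n + 2) ^ cl)%N.
    by rewrite leq_mul2l; apply/orP; right; exact: leq_trans (size_clist _ _) _.
  have -> v : size (fold_env r b (cC c) [::] v b) = n.
    by rewrite /fold_env /upd; case: eqP => [|_]; [lia|case: eqP => [|_]; [lia|rewrite eqxx]].
  by rewrite r0 -/n; move: h3; clearbody W; lia.
Qed.

(** * From stack programs to polynomial-time machines *)

Lemma polyb_comp S T : polyb S -> polyb T -> polyb (fun n => S (T n)).
Proof.
move=> [c hc] hT; have [d hd] : polyb (fun n => (T n + 2) ^ c)%N by polyb_tac.
by exists d => n; exact: leq_trans (hc _) (hd n).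
Qed.

Lemma polyb_poly_bound c : polyb (poly_bound c).
Proof. by rewrite /poly_bound; polyb_tac. Qed.

Lemma polyb_bound T : polyb T -> exists c, forall n, (T n <= poly_bound c n)%N.
Proof.
move=> [c hc]; exists (3 ^ c + c)%N => n; apply: leq_trans (hc n) _; rewrite /poly_bound.
case: n => [|n].
  by apply: leq_trans (_ : 3 ^ c <= _)%N; [case: c {hc} => // c; rewrite leq_exp2r|lia].
apply: leq_trans (_ : (3 ^ c * n.+1 ^ c <= _)%N).
  by rewrite -expnMn; case: c {hc} => // c; rewrite leq_exp2r //; lia.
rewrite -[X in (X <= _)%N]addn0 leq_add // leq_mul //; first by lia.
by case: n => [|n]; [rewrite !exp1n|apply: exp_geW; lia].
Qed.

(** Cells left of the head are left out, because outputs are read from the head rightwards; even so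
    a step adds at most one. *)
Definition tape_size (t : tape) : nat := (size (tright t)).+1.

Lemma tape_size_act a t : (tape_size (tape_act a t) <= (tape_size t).+1)%N.
Proof. by rewrite /tape_size; case: a => s []; case: t => [[|x l] h [|y r]] /=; lia. Qed.

Lemma size_run (M : machine) t (c : config M) i :
  (tape_size (tnth (run t c).2 i) <= tape_size (tnth c.2 i) + t)%N.
Proof.
elim: t c => [|t IH] c; first by rewrite addn0.
rewrite runS; apply: leq_trans (IH _) _; rewrite addnS -addSn leq_add2r stepE.
case: (mtrans _ _) => [[q a]|] //=; first by rewrite tnth_mktuple tape_size_act.
Qed.

Lemma size_output (M : machine) t (c : config M) :
  (size (output (run t c)) <= tape_size (tnth c.2 ord0) + t)%N.
Proof.
apply: leq_trans (size_run _ _ _); rewrite /output /tape_size.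
suff h s : (size (read_bits s) <= size s)%N by exact: h.
by elim: s => // -[b|] s IH.
Qed.

Section PolytimeComp.
Variables (f : bits -> bits) (A : Type) (cA : A -> bits) (h : A -> bits) (arg : bits -> A).
Hypothesis fP : forall x, f x = cA (arg x).

(** [arg] need not be computable: the program for [h] starts from the word [f x] found on tape 0,
    which is the code of [arg x]. *)
Lemma polytime_comp : polytime f -> pf cA craw h -> polytime (fun x => h (arg x)).
Proof.
move=> [M [c hM]] [p [d hp]].
(* [M] may leave anything on its own tapes; the work registers from [b] on lie beyond them and are
   still blank. *)
pose b := (mtapes M).+1; pose N := maxn (mtapes M) (max_reg (p b)).
have leN : (mtapes M <= N)%N by exact: leq_maxl.
pose T n := (poly_bound c n + (n + poly_bound c n + 3) ^ d + 1)%N.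
have [e he] : exists e, forall n, (T n <= poly_bound e n)%N.
  by apply: polyb_bound; rewrite /T; polyb_tac; exact: polyb_poly_bound.
pose Mf := tm_lift leN; pose Mg := compile N (p b).
exists (tm_machine (tm_seq Mf Mg)), e => x.
have [hf of_] := hM x; set tf := poly_bound c (size x) in hf of_.
pose ts0 : N.+1.-tuple tape := [tuple tape_of (if i == ord0 then x else [::]) | i < N.+1].
have [cf runf [hr hs hrest]] := @run_lift M N leN tf (mstart M) ts0.
have init_r : restrict_tapes leN ts0 = (init M x).2.
  by apply: eq_from_tnth => i; rewrite !tnth_mktuple.
rewrite init_r in hr.
have hr' : run tf (init M x) = (cf.1, restrict_tapes leN cf.2) := hr.
have halt1 : halts Mf ts0 cf.2 tf.
  exists cf.1; split; last by rewrite -surjective_pairing; apply: hs; rewrite -hr'.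
  by exists tf => //; rewrite runf -surjective_pairing.
pose r : env := fun i => if i == 0 then f x else
  if (i <= N)%N then content (tnth cf.2 (inord i)) else [::].
have rep : represents cf.2 r.
  move=> i; rewrite /r; case: (i =P 0 :> nat) => i0; last by rewrite -ltnS ltn_ord inord_val.
  have -> : i = widen_ord (leN : ((mtapes M).+1 <= N.+1)%N) ord0 by exact: val_inj.
  by rewrite -of_ hr' /output /content tnth_mktuple.
have r_clean : clean b r.
  move=> i le; rewrite /r; case: eqP => [i0|_]; first by rewrite i0 in le.
  case: ifP => // leiN; rewrite hrest; last by rewrite inordK.
  rewrite tnth_mktuple ifN ?content_tape_of //.
  by apply/eqP => /(congr1 val) /=; rewrite inordK // => i0; rewrite i0 in le.
have ex := hp b isT (arg x) r (fP x) r_clean.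
have [ts' halt2 rep'] := compileP ex (leq_maxr _ _) rep.
have [q [rq hq]] := halts_seq halt1 halt2.
have sz : (size (cA (arg x)) + 2 <= size x + tf + 3)%N.
  rewrite -fP -of_; apply: leq_trans (_ : (size x).+1 + tf + 2 <= _)%N; last by lia.
  rewrite leq_add2r; apply: leq_trans (size_output tf (init M x)) _; rewrite leq_add2r.
  by rewrite tnth_mktuple /tape_size /tape_of; case: (x) => //= ? ?; rewrite size_map.
have reach2 : reach ((tm_start (tm_seq Mf Mg), ts0) : config (tm_machine (tm_seq Mf Mg)))
    (q, ts') (poly_bound e (size x)).
  apply: reach_mono rq _; apply: leq_trans (he _); rewrite /T -/tf.
  have : ((size (cA (arg x)) + 2) ^ d <= (size x + tf + 3) ^ d)%N.
    by case: (d) => // d'; rewrite leq_exp2r.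
  by lia.
have e0 : run (poly_bound e (size x)) (init (tm_machine (tm_seq Mf Mg)) x) = (q, ts').
  exact: reach_halted reach2 hq.
rewrite e0; split=> //.
by have := rep' ord0; rewrite /upd eqxx.
Qed.
End PolytimeComp.

(** * Closure under list operations and unary arithmetic *)

Lemma pf_app C A B (cC : C -> bits) (cA : A -> bits) (cB : B -> bits) (g : A -> B) f :
  pf cA cB g -> pf cC cA f -> pf cC cB (fun c => g (f c)).
Proof. by move=> hg hf; exact: pf_comp hf hg. Qed.

Lemma pf_recode C A B (cC : C -> bits) (cA : A -> bits) (cB : B -> bits) f g :
  (forall c, cB (g c) = cA (f c)) -> pf cC cA f -> pf cC cB g.
Proof. by move=> e; exact: (@pf_code _ _ _ _ cC cC cA cB f g id). Qed.

Lemma pf_fst' C A B (cC : C -> bits) (cA : A -> bits) (cB : B -> bits) f :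
  pf cC (cpair cA cB) f -> pf cC cA (fun c => (f c).1).
Proof. exact: pf_app (pf_fst _ _). Qed.

Lemma pf_snd' C A B (cC : C -> bits) (cA : A -> bits) (cB : B -> bits) f :
  pf cC (cpair cA cB) f -> pf cC cB (fun c => (f c).2).
Proof. exact: pf_app (pf_snd _ _). Qed.

Lemma pf_cons C A (cC : C -> bits) (cA : A -> bits) f l :
  pf cC cA f -> pf cC (clist cA) l -> pf cC (clist cA) (fun c => f c :: l c).
Proof. by move=> hf hl; apply: pf_recode (pf_pair hf hl). Qed.

Lemma pf_foldl_poly C A B (cC : C -> bits) (cA : A -> bits) (cB : B -> bits)
    (F : C -> A -> B -> B) (l : C -> seq A) (x0 : C -> B) T :
  polyb T ->
  (forall c i, (size (cB (foldl (fun x a => F c a x) (x0 c) (take i (l c)))) <= T (size (cC c)))%N) ->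
  pf cC (clist cA) l -> pf cC cB x0 ->
  pf (cpair cC (cpair cA cB)) cB (fun x => F x.1 x.2.1 x.2.2) ->
  pf cC cB (fun c => foldl (fun x a => F c a x) (x0 c) (l c)).
Proof.
move=> [k hk] b hl hx hF; apply: (@pf_foldl _ _ _ _ _ _ _ _ _ k hl hx hF) => c i.
exact: leq_trans (b c i) (hk _).
Qed.

(** The usual way to meet the size bound of a fold: each step adds an amount that depends on the
    context and the item only, so growth is linear in the length of the list. The invariant [I]
    records what this estimate has to know about the accumulator. *)
Lemma pf_foldl_add C A B (cC : C -> bits) (cA : A -> bits) (cB : B -> bits)
    (F : C -> A -> B -> B) (l : C -> seq A) (x0 : C -> B) (I : C -> B -> Prop) T :
  polyb T -> {homo T : m n / (m <= n)%N} ->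
  (forall c, I c (x0 c)) -> (forall c a x, I c x -> I c (F c a x)) ->
  (forall c a x, I c x ->
    (size (cB (F c a x)) <= size (cB x) + T (size (cC c) + size (cA a)))%N) ->
  pf cC (clist cA) l -> pf cC cB x0 ->
  pf (cpair cC (cpair cA cB)) cB (fun x => F x.1 x.2.1 x.2.2) ->
  pf cC cB (fun c => foldl (fun x a => F c a x) (x0 c) (l c)).
Proof.
move=> hT mT I0 I1 b hl hx hF; have [cl sl] := pf_size hl; have [cx sx] := pf_size hx.
apply: (@pf_foldl_poly _ _ _ _ _ _ _ _ _
  (fun n => (n + 2) ^ cx + (n + 2) ^ cl * T (n + (n + 2) ^ cl))%N _ _ hl hx hF).
  by polyb_tac; apply: polyb_comp => //; polyb_tac.
move=> c i; have := sl c; have := sx c; set n := size (cC c) => h1 h2.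
set X := ((n + 2) ^ cl)%N in h2 *.
have key s x : I c x -> (size (clist cA s) <= X)%N ->
    (size (cB (foldl (fun x a => F c a x) x s)) <= size (cB x) + size s * T (n + X))%N.
  elim: s x => [|a s IH] x hI hs /=; first by rewrite addn0.
  rewrite size_clist_cons in hs.
  apply: leq_trans (IH _ _ _) _; [exact: I1|by lia|].
  have := b c a x hI; have : (T (size (cC c) + size (cA a)) <= T (n + X))%N by apply: mT; lia.
  by rewrite mulSn; lia.
have sz s j : (size (clist cA (take j s)) <= size (clist cA s))%N.
  by elim: s j => [|a s IH] [|j] //; rewrite take_cons !size_clist_cons; have := IH j; lia.
have h3 : (size (clist cA (take i (l c))) <= X)%N by exact: leq_trans (sz _ _) h2.
apply: leq_trans (key _ _ (I0 c) h3) _; apply: leq_add => //.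
by rewrite leq_mul2r (leq_trans (size_clist cA _) h3) orbT.
Qed.

Lemma foldl_cons A (l acc : seq A) : foldl (fun x a => a :: x) acc l = catrev l acc.
Proof. by elim: l acc => //= a l IH acc. Qed.

Lemma pf_rev C A (cC : C -> bits) (cA : A -> bits) l :
  pf cC (clist cA) l -> pf cC (clist cA) (fun c => rev (l c)).
Proof.
move=> hl; apply: (@pf_ext _ _ _ _ (fun c => foldl (fun x a => a :: x) [::] (l c))).
  by move=> c; rewrite foldl_cons.
apply: (@pf_foldl_add _ _ _ cC cA (clist cA) (fun _ a x => a :: x) l _ (fun _ _ => True) (fun n => 2 * n + 1)%N) => //.
- by polyb_tac.
- by move=> m n; lia.
- by move=> c a x _; rewrite size_clist_cons; lia.
- exact: pf_const.
- by apply: pf_cons; [apply: pf_fst'; apply: pf_snd; exact: pf_id|apply: pf_snd'; apply: pf_snd].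
Qed.

Ltac pf_proj := solve [repeat first [exact: pf_id | apply: pf_fst' | apply: pf_snd']].

Lemma pf_map C A B (cC : C -> bits) (cA : A -> bits) (cB : B -> bits) (F : C -> A -> B) l :
  pf (cpair cC cA) cB (fun x => F x.1 x.2) -> pf cC (clist cA) l ->
  pf cC (clist cB) (fun c => [seq F c a | a <- l c]).
Proof.
move=> hF hl.
apply: (@pf_ext _ _ _ _ (fun c => rev (foldl (fun x a => F c a :: x) [::] (l c)))).
  move=> c; suff e s acc : foldl (fun x a => F c a :: x) acc s = catrev [seq F c a | a <- s] acc.
    by rewrite e catrevE cats0 revK.
  by elim: s acc => //= a s IH acc.
apply: pf_rev; have [k hk] := pf_size hF.
apply: (@pf_foldl_add _ _ _ cC cA (clist cB) (fun c a x => F c a :: x) l _ (fun _ _ => True)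
  (fun n => 2 * (2 * n + 3) ^ k + 1)%N) => //.
- by polyb_tac.
- move=> m n le; rewrite leq_add2r leq_mul2l /=; case: (k) => // k'; rewrite leq_exp2r //; lia.
- move=> c a x _; rewrite size_clist_cons.
  have := hk (c, a); rewrite /cpair /= size_cat size_encw => h.
  have : (((size (cC c)).*2.+1 + size (cA a) + 2) ^ k <= (2 * (size (cC c) + size (cA a)) + 3) ^ k)%N.
    by case: (k) => // k'; rewrite leq_exp2r //; lia.
  by lia.
- exact: pf_const.
- apply: pf_cons; last by pf_proj.
  by apply: (@pf_app _ _ _ _ (cpair cC cA) _ (fun x => F x.1 x.2) (fun c => (c.1, c.2.1))) => //; apply: pf_pair; pf_proj.
Qed.

Lemma pf_nat_list C (cC : C -> bits) n :
  pf cC cnat n -> pf cC (clist cunit) (fun c => nseq (n c) tt).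
Proof.
apply: pf_recode => c; rewrite /clist /cnat map_nseq /encode map_nseq.
by elim: (n c) => //= m ->.
Qed.

Lemma pf_size_list C A (cC : C -> bits) (cA : A -> bits) l :
  pf cC (clist cA) l -> pf cC cnat (fun c => size (l c)).
Proof.
move=> hl; apply: (@pf_recode _ _ _ _ (clist cunit) _ (fun c => [seq tt | _ <- l c])).
  by move=> c; rewrite /clist /cnat /encode; elim: (l c) => //= a s ->.
by apply: (@pf_map _ _ _ _ cA cunit (fun _ _ => tt)) => //; exact: pf_const.
Qed.

Lemma pf_succ C (cC : C -> bits) n : pf cC cnat n -> pf cC cnat (fun c => (n c).+1).
Proof.
move=> hn; have h := pf_cons (pf_const cC cunit tt) (pf_nat_list hn).
apply: pf_recode h => c; rewrite /clist /cnat map_cons map_nseq /encode /= map_nseq.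
by congr (_ :: _); elim: (n c) => //= m ->.
Qed.

Lemma pf_pred C (cC : C -> bits) n : pf cC cnat n -> pf cC cnat (fun c => (n c).-1).
Proof.
move=> hn; have := pf_size_list (pf_app (pf_behead cunit) (pf_nat_list hn)).
by apply: pf_ext => c; rewrite size_behead size_nseq.
Qed.

Lemma pf_eq0 C (cC : C -> bits) n : pf cC cnat n -> pf cC cbool (fun c => n c == 0).
Proof.
move=> hn; have := pf_app (pf_nilp cunit) (pf_nat_list hn).
by apply: pf_ext => c; rewrite /nilp size_nseq.
Qed.

Lemma size_cnat n : size (cnat n) = n.
Proof. exact: size_nseq. Qed.

Lemma foldl_nseq A B (F : B -> B) (a : A) n x : foldl (fun x _ => F x) x (nseq n a) = iter n F x.
Proof. by elim: n x => //= n IH x; rewrite IH -iterSr. Qed.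

Lemma pf_iter_poly C B (cC : C -> bits) (cB : B -> bits) (F : C -> B -> B) n (x0 : C -> B) T :
  polyb T ->
  (forall c i, (i <= n c)%N -> (size (cB (iter i (F c) (x0 c))) <= T (size (cC c)))%N) ->
  pf cC cnat n -> pf cC cB x0 -> pf (cpair cC cB) cB (fun x => F x.1 x.2) ->
  pf cC cB (fun c => iter (n c) (F c) (x0 c)).
Proof.
move=> hT b hn hx hF.
apply: (@pf_ext _ _ _ _ (fun c => foldl (fun x _ => F c x) (x0 c) (nseq (n c) tt))).
  by move=> c; rewrite foldl_nseq.
apply: (@pf_foldl_poly _ _ _ _ _ _ (fun c _ x => F c x) _ _ T hT _ (pf_nat_list hn) hx).
  move=> c i; case: (leqP i (n c)) => le; first by rewrite take_nseq // foldl_nseq; exact: b.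
  have -> : take i (nseq (n c) tt) = nseq (n c) tt by rewrite take_oversize // size_nseq ltnW.
  by rewrite foldl_nseq; exact: b.
apply: (@pf_app _ _ _ _ (cpair cC cB) _ (fun x => F x.1 x.2) (fun c => (c.1, c.2.2))) => //.
by apply: pf_pair; pf_proj.
Qed.

Lemma pf_iter_add C B (cC : C -> bits) (cB : B -> bits) (F : C -> B -> B) n (x0 : C -> B) k :
  (forall c x, (size (cB (F c x)) <= size (cB x) + k)%N) ->
  pf cC cnat n -> pf cC cB x0 -> pf (cpair cC cB) cB (fun x => F x.1 x.2) ->
  pf cC cB (fun c => iter (n c) (F c) (x0 c)).
Proof.
move=> b hn hx; have [a ha] := pf_size hn; have [d hd] := pf_size hx.
apply: (@pf_iter_poly _ _ _ _ _ _ _ (fun m => (m + 2) ^ d + (m + 2) ^ a * k)%N) => //.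
  by polyb_tac.
move=> c i le; apply: leq_trans (_ : size (cB (x0 c)) + i * k <= _)%N.
  elim: i {le} => [|i IH] /=; first by lia.
  by apply: leq_trans (b _ _) _; rewrite mulSn; lia.
apply: leq_add => //; rewrite leq_mul2r; apply/orP; right.
by apply: leq_trans le _; have := ha c; rewrite size_cnat.
Qed.

Lemma pf_addn C (cC : C -> bits) m n :
  pf cC cnat m -> pf cC cnat n -> pf cC cnat (fun c => (m c + n c)%N).
Proof.
move=> hm hn; apply: (@pf_ext _ _ _ _ (fun c => iter (m c) S (n c))).
  by move=> c; elim: (m c) => //= k ->.
apply: (@pf_iter_add _ _ _ _ (fun _ => S) _ _ 1) => //; last by apply: pf_succ; pf_proj.
by move=> c x; rewrite !size_cnat addn1.
Qed.

Lemma pf_mulcn C (cC : C -> bits) k n : pf cC cnat n -> pf cC cnat (fun c => (k * n c)%N).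
Proof.
move=> hn; elim: k => [|k IH]; first exact: pf_const.
by have := pf_addn hn IH; apply: pf_ext => c; rewrite mulSn.
Qed.

Lemma pf_subn C (cC : C -> bits) m n :
  pf cC cnat m -> pf cC cnat n -> pf cC cnat (fun c => (m c - n c)%N).
Proof.
move=> hm hn; apply: (@pf_ext _ _ _ _ (fun c => iter (n c) predn (m c))).
  by move=> c; elim: (n c) => [|k IH] /=; [|rewrite IH]; lia.
apply: (@pf_iter_add _ _ _ _ (fun _ => predn) _ _ 0) => //; last by apply: pf_pred; pf_proj.
by move=> c x; rewrite !size_cnat; lia.
Qed.

Lemma pf_leq C (cC : C -> bits) m n :
  pf cC cnat m -> pf cC cnat n -> pf cC cbool (fun c => (m c <= n c)%N).
Proof. by move=> hm hn; exact: pf_eq0 (pf_subn hm hn). Qed.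

Lemma pf_negb C (cC : C -> bits) t : pf cC cbool t -> pf cC cbool (fun c => ~~ t c).
Proof. by move=> ht; exact: (pf_if ht (pf_const _ _ false) (pf_const _ _ true)). Qed.

Lemma pf_andb C (cC : C -> bits) s t :
  pf cC cbool s -> pf cC cbool t -> pf cC cbool (fun c => s c && t c).
Proof. by move=> hs ht; exact: (pf_if hs ht (pf_const _ _ false)). Qed.

Lemma pf_orb C (cC : C -> bits) s t :
  pf cC cbool s -> pf cC cbool t -> pf cC cbool (fun c => s c || t c).
Proof. by move=> hs ht; exact: (pf_if hs (pf_const _ _ true) ht). Qed.

Lemma pf_addb C (cC : C -> bits) s t :
  pf cC cbool s -> pf cC cbool t -> pf cC cbool (fun c => s c (+) t c).
Proof. by move=> hs ht; apply: pf_ext (pf_if hs (pf_negb ht) ht) => c; case: (s c). Qed.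

(** Nested conditionals, finitely many thanks to the cap [K]; each [F k] only has to be
    polynomial-time on its own. *)
Lemma pf_case_nat C B (cC : C -> bits) (cB : B -> bits) (F : nat -> C -> B) n K :
  (forall k, pf cC cB (F k)) -> pf cC cnat n -> pf cC cB (fun c => F (minn (n c) K) c).
Proof.
elim: K F n => [|K IH] F n hF hn.
  by apply: pf_ext (hF 0) => c; rewrite minn0.
have h := pf_if (pf_eq0 hn) (hF 0) (IH (fun k => F k.+1) _ (fun k => hF k.+1) (pf_pred hn)).
by apply: pf_ext h => c /=; case: (n c) => [|m] //=; rewrite minnSS.
Qed.

Lemma pf_head' C A (cC : C -> bits) (cA : A -> bits) x0 l :
  pf cC (clist cA) l -> pf cC cA (fun c => head x0 (l c)).
Proof. exact: pf_app (pf_head _ _). Qed.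

Lemma pf_behead' C A (cC : C -> bits) (cA : A -> bits) l :
  pf cC (clist cA) l -> pf cC (clist cA) (fun c => behead (l c)).
Proof. exact: pf_app (pf_behead _). Qed.

Lemma pf_filter C A (cC : C -> bits) (cA : A -> bits) (P : C -> A -> bool) l :
  pf (cpair cC cA) cbool (fun x => P x.1 x.2) -> pf cC (clist cA) l ->
  pf cC (clist cA) (fun c => [seq a <- l c | P c a]).
Proof.
move=> hP hl.
apply: (@pf_ext _ _ _ _ (fun c => rev (foldl (fun x a => if P c a then a :: x else x) [::] (l c)))).
  move=> c; suff e s acc : foldl (fun x a => if P c a then a :: x else x) acc s
      = catrev [seq a <- s | P c a] acc by rewrite e catrevE cats0 revK.
  by elim: s acc => //= a s IH acc; rewrite IH; case: ifP.
apply: pf_rev.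
apply: (@pf_foldl_add _ _ _ cC cA (clist cA) (fun c a x => if P c a then a :: x else x) l _
  (fun _ _ => True) (fun n => 2 * n + 1)%N) => //.
- by polyb_tac.
- by move=> m n; lia.
- by move=> c a x _; case: ifP => _; rewrite ?size_clist_cons; lia.
- exact: pf_const.
- apply: pf_if; [|by apply: pf_cons; pf_proj|by pf_proj].
  by apply: (@pf_app _ _ _ _ (cpair cC cA) _ (fun x => P x.1 x.2) (fun c => (c.1, c.2.1))) => //; apply: pf_pair; pf_proj.
Qed.

Lemma pf_all C A (cC : C -> bits) (cA : A -> bits) (P : C -> A -> bool) l :
  pf (cpair cC cA) cbool (fun x => P x.1 x.2) -> pf cC (clist cA) l ->
  pf cC cbool (fun c => all (P c) (l c)).
Proof.
move=> hP hl.
have h : pf cC (clist cA) (fun c => [seq a <- l c | ~~ P c a]).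
  by apply: (@pf_filter _ _ _ _ (fun c a => ~~ P c a)) => //; exact: pf_negb.
apply: pf_ext (pf_app (pf_nilp cA) h) => c.
by rewrite /nilp size_filter; elim: (l c) => //= a s <-; case: (P c a).
Qed.

Lemma pf_cat C A (cC : C -> bits) (cA : A -> bits) l1 l2 :
  pf cC (clist cA) l1 -> pf cC (clist cA) l2 -> pf cC (clist cA) (fun c => l1 c ++ l2 c).
Proof.
move=> h1 h2; apply: (@pf_ext _ _ _ _ (fun c => foldl (fun x a => a :: x) (l2 c) (rev (l1 c)))).
  by move=> c; rewrite foldl_cons catrevE revK.
apply: (@pf_foldl_add _ _ _ cC cA (clist cA) (fun _ a x => a :: x) _ _ (fun _ _ => True) (fun n => 2 * n + 1)%N) => //.
- by polyb_tac.
- by move=> m n; lia.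
- by move=> c a x _; rewrite size_clist_cons; lia.
- exact: pf_rev.
- by apply: pf_cons; pf_proj.
Qed.

(* Each item of the first list is paired with the head of the second one, which
   is consumed only if the item satisfies [P]; [predT] gives a zip. *)
Fixpoint consume A B (P : A -> bool) (d : B) (l1 : seq A) (l2 : seq B) : seq (A * B) :=
  if l1 is a :: l1' then (a, head d l2) :: consume P d l1' (if P a then behead l2 else l2)
  else [::].

Lemma size_clist_behead A (cA : A -> bits) l :
  (size (clist cA (behead l)) <= size (clist cA l))%N.
Proof. by case: l => // a l; rewrite size_clist_cons /=; lia. Qed.

Lemma size_cpair A B (cA : A -> bits) (cB : B -> bits) x :
  size (cpair cA cB x) = ((size (cA x.1)).*2.+1 + size (cB x.2))%N.
Proof. by rewrite /cpair size_cat size_encw. Qed.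

Lemma pf_consume C A B (cC : C -> bits) (cA : A -> bits) (cB : B -> bits) P (d : B) l1 l2 :
  pf cA cbool P -> pf cC (clist cA) l1 -> pf cC (clist cB) l2 ->
  pf cC (clist (cpair cA cB)) (fun c => consume P d (l1 c) (l2 c)).
Proof.
move=> hP h1 h2.
pose F (c : C) (a : A) (x : seq B * seq (A * B)) :=
  (if P a then behead x.1 else x.1, (a, head d x.1) :: x.2).
apply: (@pf_ext _ _ _ _ (fun c => rev (foldl (fun x a => F c a x) (l2 c, [::]) (l1 c)).2)).
  move=> c; suff e s t acc : (foldl (fun x a => F c a x) (t, acc) s).2 = catrev (consume P d s t) acc.
    by rewrite e catrevE cats0 revK.
  by elim: s t acc => //= a s IH t acc; rewrite IH.
apply: pf_rev; apply: pf_snd'; have [k hk] := pf_size h2.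
apply: (@pf_foldl_add _ _ _ cC cA (cpair (clist cB) (clist (cpair cA cB))) F l1 _
  (fun c x => size (clist cB x.1) <= (size (cC c) + 2) ^ k)%N
  (fun n => 4 * n + 2 * (n + 2) ^ k + 2 * size (cB d) + 3)%N) => //.
- by polyb_tac.
- move=> m n le; have : ((m + 2) ^ k <= (n + 2) ^ k)%N by case: (k) => // k'; rewrite leq_exp2r //; lia.
  by lia.
- move=> c a x hx; apply: leq_trans hx; rewrite /F /=; case: ifP => // _; exact: size_clist_behead.
- move=> c a [t acc]; rewrite /F ![fst (_, _)]/= ![snd (_, _)]/= => hx.
  rewrite !size_cpair size_clist_cons size_cpair ![fst (_, _)]/= ![snd (_, _)]/=.
  have h : (size (cB (head d t)) <= size (cB d) + (size (cC c) + 2) ^ k)%N.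
    by case: t hx => [|b t] /=; rewrite ?size_clist_cons /=; lia.
  have h' : (size (clist cB (if P a then behead t else t)) <= size (clist cB t))%N.
    by case: ifP => // _; exact: size_clist_behead.
  have : ((size (cC c) + 2) ^ k <= (size (cC c) + size (cA a) + 2) ^ k)%N.
    by case: (k) => // k'; rewrite leq_exp2r //; lia.
  by lia.
- by apply: pf_pair => //; exact: pf_const.
- apply: pf_pair; last by apply: pf_cons; [apply: pf_pair; [pf_proj|apply: pf_head'; pf_proj]|pf_proj].
  apply: pf_if; [|by apply: pf_behead'; pf_proj|by pf_proj].
  by apply: pf_app hP _; pf_proj.
Qed.

(** [G] is arbitrary: its values on words of length at most [m] are hard-wired into a decision
    tree. *)
Lemma pf_table B (cB : B -> bits) (G : bits -> B) m :
  pf (clist cbool) cB (fun l => G (take m l)).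
Proof.
elim: m G => [|m IH] G; first by apply: pf_ext (pf_const _ _ (G [::])) => l; rewrite take0.
have h := pf_if (pf_nilp cbool) (pf_const (clist cbool) cB (G [::]))
  (pf_if (pf_head cbool false) (pf_comp (pf_behead cbool) (IH (fun s => G (true :: s))))
                               (pf_comp (pf_behead cbool) (IH (fun s => G (false :: s))))).
by apply: pf_ext h => -[|[] l].
Qed.

Lemma pf_raw C (cC : C -> bits) w : pf cC (clist cbool) w -> pf cC craw w.
Proof.
move=> hw; apply: (@pf_ext _ _ _ _ (fun c => foldl (fun x a => a :: x) [::] (rev (w c)))).
  by move=> c; rewrite foldl_cons catrevE revK cats0.
apply: (@pf_foldl_add _ _ _ cC cbool craw (fun _ a x => a :: x) _ _ (fun _ _ => True) (fun n => 1)%N) => //.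
- by polyb_tac.
- by move=> c a x _; rewrite /craw /=; lia.
- exact: pf_rev.
- exact: pf_const.
- by apply: pf_app pf_raw_cons _; apply: pf_snd'; exact: pf_id.
Qed.

(** * The reduction as a polynomial-time function *)

Fixpoint incr (s : bits) : bits :=
  match s with
  | [::] => [:: true]
  | true :: s' => false :: incr s'
  | false :: s' => true :: s'
  end.

Lemma nat_bits0 : nat_bits 0 = [::].
Proof. by rewrite /nat_bits up_log1. Qed.

Lemma nat_bits_half n : (0 < n)%N -> nat_bits n = odd n :: nat_bits n./2.
Proof.
move=> n0; rewrite /nat_bits up_log2S // /= expn0 divn1; congr (_ :: _).
rewrite (iotaDl 1 0) -map_comp; apply: eq_map => i /=.
by rewrite add1n expnS divnMA divn2.
Qed.

Lemma nat_bitsS n : nat_bits n.+1 = incr (nat_bits n).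
Proof.
have [m] := ubnP n; elim: m n => // m IH [|n] le.
  by rewrite nat_bits_half // nat_bits0.
rewrite nat_bits_half // [nat_bits n.+1]nat_bits_half //=; case e: (odd n) => /=.
  have -> : n./2.+1 = (uphalf n) by rewrite uphalf_half e.
  by [].
by rewrite uphalf_half e /= add0n; rewrite -IH; [|lia].
Qed.

(** Binary numerals are produced from unary counts by repeated increment, so that no division has to
    be programmed. *)
Lemma nat_bits_iter n : nat_bits n = iter n incr [::].
Proof. by elim: n => [|n IH]; rewrite ?nat_bits0 // nat_bitsS IH. Qed.

(** As the least significant digit comes first, a power of 2 in a denominator is just a prefix of
    zeros. *)
Lemma nat_bits_shift w j : (0 < w)%N -> nat_bits (w * 2 ^ j) = nseq j false ++ nat_bits w.
Proof.
move=> w0; elim: j => [|j IH]; first by rewrite expn0 muln1.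
rewrite nat_bits_half ?muln_gt0 ?w0 ?expn_gt0 //= expnS mulnCA mul2n odd_double doubleK.
by rewrite -IH.
Qed.

Lemma pf_incr C (cC : C -> bits) s :
  pf cC (clist cbool) s -> pf cC (clist cbool) (fun c => incr (s c)).
Proof.
move=> hs; apply: pf_app hs.
pose F (b : bool) (x : bool * bits) := (x.1 && b, x.1 (+) b :: x.2).
pose fin (x : bool * bits) := rev (if x.1 then true :: x.2 else x.2).
apply: (@pf_ext _ _ _ _ (fun s => fin (foldl (fun x b => F b x) (true, [::]) s))).
  suff e t acc c0 : fin (foldl (fun x b => F b x) (c0, acc) t) =
      catrev acc (if c0 then incr t else t) by move=> t; rewrite e.
  elim: t acc c0 => [|b t IH] acc c0 /=.
    by rewrite /fin; case: c0; rewrite /= catrevE ?cats0 // rev_cons cats1.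
  by rewrite IH; case: c0 => /=; case: b.
pose cS := cpair cbool (clist cbool).
have hf : pf (clist cbool) cS (fun s => foldl (fun x b => F b x) (true, [::]) s).
  apply: (@pf_foldl_add _ _ _ _ cbool cS (fun _ => F) _ _ (fun _ _ => True) (fun n => 3)%N) => //.
  - by polyb_tac.
  - by move=> c a [x1 x2] _; rewrite /cS !size_cpair size_clist_cons /=; lia.
  - exact: pf_id.
  - exact: pf_const.
  - apply: pf_pair; first by apply: pf_andb; pf_proj.
    by apply: pf_cons; [apply: pf_addb; pf_proj|pf_proj].
apply: pf_rev; apply: pf_if; first exact: pf_fst' hf.
  by apply: pf_cons; [exact: pf_const|exact: pf_snd' hf].
exact: pf_snd' hf.
Qed.

Lemma size_incr s : (size (incr s) <= (size s).+1)%N.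
Proof. by elim: s => // -[] s IH /=. Qed.

Lemma size_clist_cbool s : size (clist cbool s) = (3 * size s)%N.
Proof. by elim: s => // b s IH; rewrite size_clist_cons IH /=; lia. Qed.

Lemma pf_nat_bits C (cC : C -> bits) n :
  pf cC cnat n -> pf cC (clist cbool) (fun c => nat_bits (n c)).
Proof.
move=> hn; apply: (@pf_ext _ _ _ _ (fun c => iter (n c) incr [::])).
  by move=> c; rewrite nat_bits_iter.
apply: (@pf_iter_add _ _ _ _ (fun _ => incr) _ _ 3) => //.
- by move=> c s; rewrite !size_clist_cbool; have := size_incr s; lia.
- exact: pf_const.
- by apply: pf_incr; pf_proj.
Qed.

Lemma pf_uphalf C (cC : C -> bits) n : pf cC cnat n -> pf cC cnat (fun c => uphalf (n c)).
Proof.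
move=> hn; pose F (x : bool * nat) := (~~ x.1, if x.1 then x.2 else x.2.+1).
apply: (@pf_ext _ _ _ _ (fun c => (iter (n c) F (false, 0)).2)).
  move=> c; suff -> : iter (n c) F (false, 0) = (odd (n c), uphalf (n c)) by [].
  by elim: (n c) => //= m ->; rewrite /F /= uphalf_half; case: (odd m); rewrite ?add1n.
apply: pf_snd'.
apply: (@pf_iter_add _ _ _ (cpair cbool cnat) (fun _ => F) _ _ 1) => //.
- by move=> c [b m]; rewrite !size_cpair /F /= !size_nseq; case: b => /=; lia.
- exact: pf_const.
- apply: pf_pair; first by apply: pf_negb; pf_proj.
  by apply: pf_if; [pf_proj|pf_proj|apply: pf_succ; pf_proj].
Qed.

(** The result is written in unary, hence the hypothesis that its value, and not only its length in
    binary, is polynomial. *)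
Lemma pf_pow4 C (cC : C -> bits) n T : polyb T ->
  (forall c, (4 ^ n c <= T (size (cC c)))%N) ->
  pf cC cnat n -> pf cC cnat (fun c => (4 ^ n c)%N).
Proof.
move=> hT b hn; pose F x := (4 * x)%N.
apply: (@pf_ext _ _ _ _ (fun c => iter (n c) F 1)).
  by move=> c; elim: (n c) => //= m ->; rewrite /F expnS.
apply: (@pf_iter_poly _ _ _ _ (fun _ => F) _ _ T) => //.
- move=> c i le; apply: leq_trans (b c); rewrite size_cnat.
  have -> : iter i F 1 = (4 ^ i)%N by elim: i {le} => //= m ->; rewrite /F expnS.
  by rewrite leq_exp2l.
- exact: pf_const.
- by apply: pf_mulcn; pf_proj.
Qed.

Definition double_words (ws : seq bits) : seq bits :=
  [seq true :: w | w <- ws] ++ [seq false :: w | w <- ws].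
Definition words (d : nat) : seq bits := iter d double_words [:: [::]].

Local Notation cword := (clist cbool).

Lemma size_words d : size (words d) = (2 ^ d)%N.
Proof. by elim: d => //= d IH; rewrite size_cat !size_map IH expnS; lia. Qed.

Lemma mem_words d w : (w \in words d) = (size w == d).
Proof.
have cons_inj b : injective (cons b : bits -> bits) by move=> x y [].
elim: d w => [|d IH] [|b w] //=.
  by rewrite mem_cat; apply/negP => /orP[] /mapP[].
rewrite mem_cat eqSS -IH; case: b.
  rewrite (mem_map (@cons_inj true)); case: (_ \in words d) => //=.
  by apply/negP => /mapP[].
rewrite (mem_map (@cons_inj false)) orbC; case: (_ \in words d) => //=.
by apply/negP => /mapP[].
Qed.

Lemma size_clist_le A (cA : A -> bits) (l : seq A) k :
  all (fun a => size (cA a) <= k)%N l -> (size (clist cA l) <= size l * (2 * k + 1))%N.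
Proof.
elim: l => // a l IH /= /andP[ha /IH hl]; rewrite size_clist_cons mulSn; lia.
Qed.

Lemma pf_words C (cC : C -> bits) n T : polyb T ->
  (forall c, (2 ^ n c <= T (size (cC c)))%N) ->
  pf cC cnat n -> pf cC (clist cword) (fun c => words (n c)).
Proof.
move=> hT b hn.
apply: (@pf_iter_poly _ _ _ _ (fun _ => double_words) _ _
  (fun m => T m * (2 * (3 * T m) + 1))%N) => //.
- by polyb_tac.
- move=> c i le; apply: leq_trans (@size_clist_le _ _ _ (3 * T (size (cC c))) _) _.
    apply/allP => w; rewrite -/(words i) mem_words => /eqP sw; rewrite size_clist_cbool sw.
    by rewrite leq_mul2l /=; apply: leq_trans (b c); apply: leq_trans le (ltnW (ltn_expl _ _)).
  rewrite -/(words i) size_words leq_mul2r; apply/orP; right; apply: leq_trans (b c).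
  by rewrite leq_exp2l.
- exact: pf_const.
- by apply: pf_cat; (apply: (@pf_map _ _ _ _ cword cword (fun _ w => _ :: w)); last by pf_proj);
    apply: pf_cons; [exact: pf_const|pf_proj|exact: pf_const|pf_proj].
Qed.

Section Reduction.
Variables z H D r : nat.

Definition agreements (u v : bits) : nat :=
  foldl (fun x (p : bool * bool) => if p.1 (+) p.2 then x else x.+1) 0 (consume predT false u v).
(** With [a] agreements and [b] disagreements, the sign vectors have inner product [a - b]. The test
    says that its absolute value is at most [size u / H]; it is split into two inequalities without
    subtraction because [nat] has no negative numbers. *)
Definition nearly_orthogonal (u v : bits) : bool :=
  let a := agreements u v in let b := (size u - a)%N in
  (H * a <= size u + H * b)%N && (H * b <= size u + H * a)%N.

Definition greedy_code (ws : seq bits) : seq bits :=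
  foldl (fun K w => if all (nearly_orthogonal w) K then w :: K else K) [::] ws.

Definition rows (l : seq bits) : seq bits := behead (behead l).
(** For [L] the bit length of [m], the number [4 ^ log_size m] lies above [L] and is at most
    [4 * L + 2]. A power of 4 is taken because its square root enters the coordinates. *)
Definition log_size (m : nat) : nat := uphalf (size (nat_bits (size (nat_bits m)))).
Definition exponent (l : seq bits) : nat := log_size (size (rows l)).
Definition dimension (l : seq bits) : nat := (D * 4 ^ exponent l)%N.
Definition codewords (l : seq bits) : seq bits := greedy_code (words (dimension l)).
(** Incidence vector of the union of the family. Only these elements consume a codeword in
    [assigned], so the code need not grow with the universe. *)
Definition used (l : seq bits) : bits :=
  foldl (fun x row => [seq p.1 || p.2 | p <- consume predT false x row])
        [seq false | _ <- head [::] (behead l)] (rows l).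
Definition assigned (l : seq bits) : seq bits :=
  [seq p.2 | p <- consume id [::] (used l) (codewords l)].

(** If [m] of the [z] codewords of a set have [true] at some coordinate, their sign vectors add up
    to [2 m - z] there; so counts are all that is needed. *)
Definition true_counts (d : nat) (vs : seq bits) : seq nat :=
  foldl (fun x v => [seq (p.1 + p.2)%N | p : nat * bool <- consume predT false x v]) (nseq d 0) vs.
Definition selected (l : seq bits) (row : bits) : seq bits :=
  [seq p.2 | p <- [seq p <- consume predT [::] row (assigned l) | p.1]].

(* The code of (2m - z) / (r * 2^j), when r is a multiple of z!. *)
Definition coordinate_code (m j : nat) : bits :=
  encode (if m.*2 == z then [:: [:: false]; [::]; [:: true]]
          else [:: [:: (m.*2 < z)%N]; [:: true];
                   nseq j false ++ nat_bits (r %/ ((m.*2 - z) + (z - m.*2)))]).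

(** A count never exceeds [z] when the row has [z] elements; the cap makes the case distinction
    finite on all inputs. *)
Definition point_code (l : seq bits) (row : bits) : bits :=
  encode [seq coordinate_code (minn m z) (exponent l)
         | m <- true_counts (dimension l) (selected l row)].

Definition reduction (l : seq bits) : bits :=
  encode (head [::] l :: nat_bits (dimension l) :: [seq point_code l row | row <- rows l]).

Lemma pf_agreements C (cC : C -> bits) u v : pf cC cword u -> pf cC cword v ->
  pf cC cnat (fun c => agreements (u c) (v c)).
Proof.
move=> hu hv.
apply: (@pf_foldl_add _ _ _ _ (cpair cbool cbool) cnat
  (fun _ (p : bool * bool) x => if p.1 (+) p.2 then x else x.+1) _ _ (fun _ _ => True) (fun n => 1)%N) => //.
- by polyb_tac.
- by move=> c a x _; rewrite !size_cnat; case: ifP; lia.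
- by apply: pf_consume => //; exact: pf_const.
- exact: pf_const.
- by apply: pf_if; [apply: pf_addb; pf_proj|pf_proj|apply: pf_succ; pf_proj].
Qed.

Lemma pf_nearly_orthogonal C (cC : C -> bits) u v : pf cC cword u -> pf cC cword v ->
  pf cC cbool (fun c => nearly_orthogonal (u c) (v c)).
Proof.
move=> hu hv; have ha := pf_agreements hu hv; have hs := pf_size_list hu.
have hb := pf_subn hs ha.
by apply: pf_andb; apply: pf_leq; try exact: pf_mulcn; apply: pf_addn => //; exact: pf_mulcn.
Qed.

Lemma pf_greedy_code C (cC : C -> bits) ws :
  pf cC (clist cword) ws -> pf cC (clist cword) (fun c => greedy_code (ws c)).
Proof.
move=> hw.
apply: (@pf_foldl_add _ _ _ _ cword (clist cword)
  (fun _ w K => if all (nearly_orthogonal w) K then w :: K else K) _ _ (fun _ _ => True)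
  (fun n => 2 * n + 1)%N) => //.
- by polyb_tac.
- by move=> m n; lia.
- by move=> c a x _; case: ifP => _; rewrite ?size_clist_cons; lia.
- exact: pf_const.
- apply: pf_if; [|by apply: pf_cons; pf_proj|by pf_proj].
  apply: (@pf_all _ _ _ cword (fun c w => nearly_orthogonal c.2.1 w)); last by pf_proj.
  by apply: pf_nearly_orthogonal; pf_proj.
Qed.

Let cl := clist craw.

Lemma pf_rows : pf cl cl rows.
Proof. by apply: pf_behead'; apply: pf_behead. Qed.

Lemma pf_row_words : pf cl (clist cword) rows.
Proof.
apply: (@pf_ext _ _ _ _ (fun l => [seq id w | w <- rows l])); first by move=> l; rewrite map_id.
apply: (@pf_map _ _ _ cl craw cword (fun _ w => id w)) pf_rows.
by apply: pf_app pf_unpack _; pf_proj.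
Qed.

Lemma pf_exponent : pf cl cnat exponent.
Proof.
apply: pf_uphalf; apply: (@pf_size_list _ _ _ cbool); apply: pf_nat_bits.
apply: (@pf_size_list _ _ _ cbool); apply: pf_nat_bits; exact: pf_size_list pf_rows.
Qed.

Lemma size_nat_bits_pow n : (2 ^ size (nat_bits n) <= (2 * n).+1)%N.
Proof.
suff : (2 ^ size (nat_bits n) <= maxn 1 (2 * n))%N by lia.
have [m] := ubnP n; elim: m n => // m IH [|n] le; first by rewrite nat_bits0.
rewrite nat_bits_half //; have := odd_double_half n.+1; set h := n.+1./2; rewrite [size _]/= expnS.
by have := IH h; case: (odd n.+1); lia.
Qed.

Lemma size_nat_bits_gt n : (n < 2 ^ size (nat_bits n))%N.
Proof.
have [m] := ubnP n; elim: m n => // m IH [|n] le; first by rewrite nat_bits0.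
rewrite nat_bits_half //; have := odd_double_half n.+1; set h := n.+1./2; rewrite [size _]/= expnS.
by have := IH h; case: (odd n.+1); lia.
Qed.

Lemma log_size_le m : (4 ^ log_size m <= 4 * size (nat_bits m) + 2)%N.
Proof.
rewrite /log_size; set L := size (nat_bits m); have := size_nat_bits_pow L.
set s := size _ => h; apply: leq_trans (_ : 2 * 2 ^ s <= _)%N; last by lia.
by rewrite -expnS -(expnM 2 2) leq_exp2l // mul2n; have := odd_double_half s; rewrite uphalf_half; lia.
Qed.

Lemma log_size_ge m : (size (nat_bits m) < 4 ^ log_size m)%N.
Proof.
rewrite /log_size; set L := size (nat_bits m); apply: leq_trans (size_nat_bits_gt L) _.
by rewrite -(expnM 2 2) leq_exp2l // mul2n; set s := size _; have := odd_double_half s; rewrite uphalf_half; lia.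
Qed.

Lemma size_rows_le l : (size (rows l) <= size (cl l))%N.
Proof.
apply: leq_trans (size_clist craw _) _; apply: leq_trans (size_clist_behead _ _) _.
exact: size_clist_behead.
Qed.

(** Listing all words is affordable: the dimension is at most [D * (4 * L + 2)] for [L] the bit
    length of the number of rows, and [2 ^ L] is linear in that number. *)
Lemma dimension_bound : exists2 T, polyb T & forall l, (2 ^ dimension l <= T (size (cl l)))%N.
Proof.
exists (fun n => (2 * n + 1) ^ (4 * D) * 2 ^ (2 * D))%N; first by polyb_tac.
move=> l; apply: leq_trans (_ : 2 ^ (size (nat_bits (size (rows l))) * (4 * D) + 2 * D) <= _)%N.
  rewrite leq_exp2l // /dimension; have := log_size_le (size (rows l)).
  by rewrite -/(exponent l); nia.
rewrite expnD expnM leq_mul2r; apply/orP; right.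
case: (4 * D)%N => // k; rewrite leq_exp2r //.
by apply: leq_trans (size_nat_bits_pow _) _; have := size_rows_le l; lia.
Qed.

Lemma pf_dimension : pf cl cnat dimension.
Proof.
apply: pf_mulcn; apply: (@pf_pow4 _ _ _ (fun n => 8 * n + 10)%N _ _ pf_exponent); first by polyb_tac.
move=> l; apply: leq_trans (log_size_le _) _.
have := size_nat_bits_pow (size (rows l)); have := ltn_expl (size (nat_bits (size (rows l)))) (isT : 1 < 2)%N.
by have := size_rows_le l; lia.
Qed.

Lemma pf_codewords : pf cl (clist cword) codewords.
Proof.
have [T hT b] := dimension_bound; apply: pf_greedy_code; exact: pf_words hT b pf_dimension.
Qed.

Lemma size_consume A B (P : A -> bool) (d : B) l1 l2 : size (consume P d l1 l2) = size l1.
Proof. by elim: l1 l2 => //= a l1 IH l2; rewrite IH. Qed.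

Lemma pf_used : pf cl cword used.
Proof.
have hu : pf cl cword (fun l => [seq false | _ <- head [::] (behead l)]).
  apply: (@pf_map _ _ _ _ cbool cbool (fun _ _ => false)); first exact: pf_const.
  by apply: pf_app pf_unpack _; apply: pf_head'; exact: pf_behead.
apply: (@pf_foldl_add _ _ _ _ cword cword
  (fun _ row x => [seq p.1 || p.2 | p <- consume predT false x row]) _ _ (fun _ _ => True)
  (fun n => 0)%N _ _ _ _ _ pf_row_words hu) => //.
- by polyb_tac.
- by move=> c a x _; rewrite !size_clist_cbool size_map size_consume addn0.
- apply: (@pf_map _ _ _ _ (cpair cbool cbool) cbool (fun _ p => p.1 || p.2)).
    by apply: pf_orb; pf_proj.
  by apply: pf_consume; [exact: pf_const|pf_proj|pf_proj].
Qed.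

Lemma pf_assigned : pf cl (clist cword) assigned.
Proof.
apply: (@pf_map _ _ _ _ (cpair cbool cword) cword (fun _ p => p.2)); first by pf_proj.
by apply: pf_consume; [exact: pf_id|exact: pf_used|exact: pf_codewords].
Qed.

Lemma pf_true_counts C (cC : C -> bits) d vs : pf cC cnat d -> pf cC (clist cword) vs ->
  pf cC (clist cnat) (fun c => true_counts (d c) (vs c)).
Proof.
move=> hd hv; have [k hk] := pf_size hd.
apply: (@pf_foldl_add _ _ _ _ cword (clist cnat)
  (fun _ v x => [seq (p.1 + p.2)%N | p : nat * bool <- consume predT false x v]) _ _
  (fun c x => size x <= (size (cC c) + 2) ^ k)%N (fun n => 2 * (n + 2) ^ k)%N _ _ _ _ _ hv) => //.
- by polyb_tac.
- by move=> m n le; rewrite leq_mul2l /=; case: (k) => // k'; rewrite leq_exp2r //; lia.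
- by move=> c; rewrite size_nseq; have := hk c; rewrite size_cnat.
- by move=> c a x h; rewrite size_map size_consume.
- move=> c v x h; apply: leq_trans (_ : size (clist cnat x) + 2 * size x <= _)%N.
    elim: x v {h} => //= m x IH v; rewrite !size_clist_cons !size_cnat.
    by have := IH (behead v); case: (head _ _); lia.
  rewrite leq_add2l leq_mul2l /=; apply: leq_trans h _.
  by case: (k) => // k'; rewrite leq_exp2r //; lia.
- apply: (@pf_recode _ _ _ _ (clist cnat) _ (fun c => [seq 0 | _ <- nseq (d c) tt])).
    by move=> c; congr clist; rewrite map_nseq.
  by apply: (@pf_map _ _ _ _ cunit cnat (fun _ _ => 0)); [exact: pf_const|exact: pf_nat_list].
- apply: (@pf_map _ _ _ _ (cpair cnat cbool) cnat (fun _ (p : nat * bool) => (p.1 + p.2)%N)).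
    apply: pf_addn; first by pf_proj.
    apply: (@pf_ext _ _ _ _ (fun x => if x.2.2 then 1 else 0)); first by move=> x; case: x.2.2.
    by apply: pf_if; [pf_proj|exact: pf_const|exact: pf_const].
  by apply: pf_consume; [exact: pf_const|pf_proj|pf_proj].
Qed.

Lemma pf_encode C (cC : C -> bits) l : pf cC (clist craw) l -> pf cC craw (fun c => encode (l c)).
Proof. by apply: pf_recode => c; rewrite /clist /craw map_id. Qed.

Lemma pf_zeros C (cC : C -> bits) j v : pf cC cnat j -> pf cC craw (fun c => nseq (j c) false ++ v).
Proof.
move=> hj; apply: (@pf_ext _ _ _ _ (fun c => iter (j c) (cons false) v)).
  by move=> c; elim: (j c) => //= k ->.
apply: (@pf_iter_add _ _ _ craw (fun _ => cons false) _ _ 1) => //.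
- by move=> c x; rewrite /craw /= addn1.
- exact: pf_const.
- apply: (@pf_app _ _ _ _ _ _ _ (fun x => (false, x.2)) pf_raw_cons).
  by apply: pf_pair; [exact: pf_const|pf_proj].
Qed.

Lemma pf_coordinate_code C (cC : C -> bits) m j : pf cC cnat m -> pf cC cnat j ->
  pf cC craw (fun c => coordinate_code (minn (m c) z) (j c)).
Proof.
move=> hm hj; apply: (@pf_case_nat _ _ _ _ (fun k c => coordinate_code k (j c))) => // k.
rewrite /coordinate_code; apply: pf_encode; case: eqP => _; first exact: pf_const.
apply: pf_cons; first exact: pf_const.
apply: pf_cons; first exact: pf_const.
by apply: pf_cons; [exact: pf_zeros|exact: pf_const].
Qed.

Lemma pf_reduction : pf cl craw reduction.
Proof.
apply: pf_encode; apply: pf_cons; first exact: pf_head.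
apply: pf_cons; first by apply: pf_raw; exact: pf_nat_bits pf_dimension.
apply: (@pf_map _ _ _ _ cword craw point_code); last exact: pf_row_words.
have p1 B (cB : B -> bits) (g : seq bits -> B) :
  pf cl cB g -> pf (cpair cl cword) cB (fun x => g x.1) by move=> hg; apply: pf_app hg _; pf_proj.
apply: pf_encode.
apply: (@pf_map _ _ _ _ cnat craw (fun x m => coordinate_code (minn m z) (exponent x.1))).
  apply: pf_coordinate_code; first by pf_proj.
  by apply: (pf_app pf_exponent); pf_proj.
apply: pf_true_counts; first exact: p1 pf_dimension.
apply: (@pf_map _ _ _ _ (cpair cbool cword) cword (fun _ p => p.2)); first by pf_proj.
apply: (@pf_filter _ _ _ (cpair cbool cword) (fun _ p => p.1)); first by pf_proj.
by apply: pf_consume; [exact: pf_const|pf_proj|exact: p1 pf_assigned].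
Qed.
End Reduction.

Local Open Scope ring_scope.

(** * The greedy code is large *)

Lemma bernoulli_ineq (F : realDomainType) (x : F) n : -1 <= x -> 1 + n%:R * x <= (1 + x) ^+ n.
Proof.
move=> x1; elim: n => [|n IH]; first by rewrite expr0; lra.
rewrite exprS -natr1; have h0 : 0 <= 1 + x by lra.
have := ler_wpM2l h0 IH; have : 0 <= n%:R * x ^+ 2 by rewrite mulr_ge0 ?ler0n ?sqr_ge0.
by rewrite expr2; lra.
Qed.

Lemma foldl_agree (s : seq (bool * bool)) k :
  foldl (fun x (p : bool * bool) => if p.1 (+) p.2 then x else x.+1) k s =
  (k + foldl (fun x (p : bool * bool) => if p.1 (+) p.2 then x else x.+1) 0 s)%N.
Proof.
elim: s k => [|p s IH] k /=; first by rewrite addn0.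
by rewrite IH [in RHS]IH; case: ifP => _; lia.
Qed.

Lemma agreements_cons a u b v : agreements (a :: u) (b :: v) = ((a == b) + agreements u v)%N.
Proof.
by rewrite /agreements /= foldl_agree; case: a; case: b; rewrite /= ?addn0 ?add0n.
Qed.

Lemma agreements_le u v : (agreements u v <= size u)%N.
Proof.
rewrite /agreements; elim: u v => //= a u IH v; rewrite foldl_agree.
by have := IH (behead v); case: (_ (+) _) => /=; lia.
Qed.

Lemma agreements_refl u : agreements u u = size u.
Proof. by elim: u => // a u IH; rewrite agreements_cons eqxx IH. Qed.

Lemma agreementsC u v : size u = size v -> agreements u v = agreements v u.
Proof.
elim: u v => [|a u IH] [|b v] //= [e]; rewrite !agreements_cons IH //.
by rewrite eq_sym.
Qed.

(** Each position contributes a factor [x] where the letters agree and 1 where they differ. This is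
    the moment generating function of the Chernoff bound. *)
Lemma sum_agreements (F : comNzRingType) (x : F) v d : size v = d ->
  \sum_(w <- words d) x ^+ (agreements w v) = (x + 1) ^+ d.
Proof.
elim: d v => [|d IH] [|b v] //= => [_|[e]]; first by rewrite big_seq1 expr0.
rewrite big_cat !big_map exprS mulrDl mul1r -(IH _ e) -/(words d).
have eb b' : \sum_(w <- words d) x ^+ agreements (b' :: w) (b :: v) =
    x ^+ (b' == b) * \sum_(w <- words d) x ^+ agreements w v.
  by rewrite mulr_sumr; apply: eq_bigr => w _; rewrite agreements_cons exprD.
rewrite !eb; case: b {eb}; rewrite /= !expr0 !expr1 !mul1r //.
by rewrite addrC.
Qed.

Lemma sum_disagreements (F : comNzRingType) (x : F) v d : size v = d ->
  \sum_(w <- words d) x ^+ (d - agreements w v) = (x + 1) ^+ d.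
Proof.
elim: d v => [|d IH] [|b v] //= => [_|[e]]; first by rewrite big_seq1 expr0.
rewrite big_cat !big_map exprS mulrDl mul1r -(IH _ e) -/(words d).
have sub b' w : w \in words d ->
    x ^+ (d.+1 - agreements (b' :: w) (b :: v)) = x ^+ (b' != b) * x ^+ (d - agreements w v).
  rewrite mem_words => /eqP sw; have := agreements_le w v; rewrite sw => le.
  by rewrite agreements_cons -exprD; congr (_ ^+ _); case: (b' == b) => /=; lia.
have eb b' : \sum_(w <- words d) x ^+ (d.+1 - agreements (b' :: w) (b :: v)) =
    x ^+ (b' != b) * \sum_(w <- words d) x ^+ (d - agreements w v).
  by rewrite mulr_sumr; apply: eq_big_seq => w hw; rewrite sub.
rewrite !eb; case: b {sub eb}; rewrite /= !expr0 !expr1 !mul1r //.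
by rewrite addrC.
Qed.

(** Markov's inequality, in counting form. *)
Lemma count_le_sum (F : realFieldType) (T : eqType) (P : pred T) (f : T -> F) (c : F) (s : seq T) :
  (forall x, 0 <= f x) -> (forall x, x \in s -> P x -> c <= f x) ->
  (count P s)%:R * c <= \sum_(x <- s) f x.
Proof.
move=> f0; elim: s => [|x s IH] h; first by rewrite big_nil mul0r.
rewrite big_cons natrD mulrDl; apply: lerD.
  case e: (P x); last by rewrite mul0r.
  by rewrite mul1r h ?mem_head.
by apply: IH => y ys; apply: h; rewrite inE ys orbT.
Qed.

(** * Chernoff bound and size of the greedy code *)

Section Chernoff.
Variables (F : realFieldType) (H : nat).
Hypothesis H2 : (2 <= H)%N.

(* [t] is so close to 1 that [x = t^H] satisfies [(x + 1/x)/2 < t]. *)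
Let t : F := 1 + (2 * H ^ 2)%:R^-1.
Let x : F := t ^+ H.

(** Write [x ^+ 2 + 1 = 2 * x + (x - 1) ^+ 2] and [t = 1 + s] with [s = 1 / (2 * H ^ 2)]. Then
    [x - 1] is at most [4 / 3 * s * H], and its square at most [8 / 9 * s], which is less than
    [2 * x * s]. *)
Lemma chernoff_ratio : x ^+ 2 + 1 < 2 * (x * t).
Proof.
have h0 : (2 : F) <= H%:R by rewrite (ler_nat F 2 H).
set h : F := H%:R in h0.
have e : (2 * H ^ 2)%:R = 2 * h ^+ 2 :> F by rewrite natrM natrX.
have hp : 0 < 2 * h ^+ 2 by rewrite pmulr_rgt0 // exprn_gt0 //; lra.
set s := (2 * h ^+ 2)^-1.
have sp : 0 < s by rewrite invr_gt0.
have sh : s * h * h = 2^-1 by rewrite /s; field; lra.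
have te : t = 1 + s by rewrite /t e.
have shge : 0 <= s * h by apply: mulr_ge0; lra.
have shle : s * h <= 4^-1 by have := ler_wpM2l shge h0; lra.
have t0 : 0 < t by rewrite te; lra.
have x0 : 0 < x by rewrite exprn_gt0.
have sle : s <= 4^-1.
  have h1 : 1 <= h by lra.
  by have := ler_wpM2l (ltW sp) h1; lra.
(* [x * (1 - s) ^+ H = (1 - s ^+ 2) ^+ H <= 1], and Bernoulli's inequality bounds [(1 - s) ^+ H]
   from below. *)
have inv : x * (1 - s * h) <= 1.
  have b : 1 - s * h <= (1 - s) ^+ H.
    by have := @bernoulli_ineq _ (- s) H; rewrite -/h mulrN => b; apply: le_trans (b _); lra.
  apply: le_trans (ler_wpM2l (ltW x0) b) _.
  rewrite /x -exprMn te; apply: exprn_ile1; first by apply: mulr_ge0; lra.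
  by have := mulr_ge0 (ltW sp) (ltW sp); lra.
have xlow : 1 <= x.
  by rewrite /x; apply: exprn_ege1; rewrite te; lra.
have xup : x <= 4 / 3 by have := ler_wpM2l (ltW x0) shle; lra.
have d1 : x - 1 <= 4 / 3 * (s * h).
  by have := ler_wpM2r shge xup; lra.
have d2 : (x - 1) * (x - 1) <= 4 / 3 * (s * h) * (4 / 3 * (s * h)).
  by apply: ler_pM => //; lra.
have d3 : 4 / 3 * (s * h) * (4 / 3 * (s * h)) = 8 / 9 * s.
  have -> : 4 / 3 * (s * h) * (4 / 3 * (s * h)) = 16 / 9 * s * (s * h * h) by field.
  by rewrite sh; field.
have d4 : s <= x * s by rewrite ler_peMl //; lra.
rewrite te; have : (x - 1) * (x - 1) < 2 * (x * s) by lra.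
by lra.
Qed.

(** Exponential moments with weight [(x ^+ 2) ^+ a] for [a] agreements, and likewise for
    disagreements; the two tails give the factor 2. *)
Lemma chernoff_count v d : size v = d ->
  (count (fun w => ~~ nearly_orthogonal H w v) (words d))%:R * (x * t) ^+ d
    <= 2 * (x ^+ 2 + 1) ^+ d.
Proof.
move=> sv.
have t1 : 1 < t by rewrite /t ltrDl invr_gt0 ltr0n; lia.
have t0 : 0 < t by lra.
(* In powers of [t], this compares the exponents [(H + 1) * d] and [2 * H * a]. *)
have pow a : (d + H * (d - a) < H * a)%N -> (a <= d)%N -> (x * t) ^+ d <= (x ^+ 2) ^+ a.
  move=> h le; rewrite /x -exprSr -!exprM ler_eXn2l //; nia.
pose P1 w := (d + H * (d - agreements w v) < H * agreements w v)%N.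
pose P2 w := (d + H * agreements w v < H * (d - agreements w v))%N.
have c1 : (count P1 (words d))%:R * (x * t) ^+ d <= (x ^+ 2 + 1) ^+ d.
  rewrite -(sum_agreements _ sv); apply: count_le_sum => [w|w].
    by rewrite !exprn_ge0 // ltW // exprn_gt0.
  rewrite mem_words => /eqP sw h; apply: pow => //.
  by have := agreements_le w v; rewrite sw.
have c2 : (count P2 (words d))%:R * (x * t) ^+ d <= (x ^+ 2 + 1) ^+ d.
  rewrite -(sum_disagreements _ sv); apply: count_le_sum => [w|w].
    by rewrite !exprn_ge0 // ltW // exprn_gt0.
  rewrite mem_words => /eqP sw h; have le := agreements_le w v; rewrite sw in le.
  by apply: pow; [rewrite subKn|lia].
have c0 : (count (fun w => ~~ nearly_orthogonal H w v) (words d) <=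
           count P1 (words d) + count P2 (words d))%N.
  rewrite -count_predUI; apply: leq_trans (leq_addr _ _).
  rewrite -[X in (X <= _)%N](eq_in_count (a1 := fun w => P1 w || P2 w)); first exact: leqnn.
  move=> w; rewrite mem_words => /eqP sw.
  by rewrite /nearly_orthogonal /P1 /P2 sw negb_and -!ltnNge.
have xt : 0 <= (x * t) ^+ d by rewrite exprn_ge0 // mulr_ge0 // ltW // exprn_gt0.
apply: le_trans (ler_wpM2r xt (_ : _ <= (count P1 (words d) + count P2 (words d))%:R)) _.
  by rewrite ler_nat.
by rewrite natrD mulrDl; lra.
Qed.

Lemma nearly_orthogonal_irrefl w : (0 < size w)%N -> nearly_orthogonal H w w = false.
Proof. by move=> w0; rewrite /nearly_orthogonal agreements_refl subnn muln0 addn0; nia. Qed.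

Lemma greedy_subset ws : {subset greedy_code H ws <= ws}.
Proof.
rewrite /greedy_code -[X in {subset _ <= X}]cats0; move: [::] => K.
elim: ws K => [|w ws IH] K v //= /IH.
rewrite mem_cat !(inE, mem_cat); case: ifP => _; rewrite ?inE;
  by case: (v == w); case: (v \in ws); case: (v \in K).
Qed.

Lemma greedy_pairwise ws : pairwise (nearly_orthogonal H) (greedy_code H ws).
Proof.
rewrite /greedy_code; have : pairwise (nearly_orthogonal H) [::] by [].
by move: [::] => K; elim: ws K => //= w ws IH K hK; apply: IH; case: ifP => //= ->.
Qed.

(** Maximality of the greedy choice: a rejected word conflicts with an earlier choice, and an
    accepted one, being nonempty, with itself. *)
Lemma greedy_covers ws w : all (fun w => 0 < size w)%N ws -> w \in ws ->
  has (fun v => ~~ nearly_orthogonal H w v) (greedy_code H ws).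
Proof.
have mono us (K : seq bits) v : v \in K ->
    v \in foldl (fun K w => if all (nearly_orthogonal H w) K then w :: K else K) K us.
  by elim: us K => //= u us IH K vK; apply: IH; case: ifP => //; rewrite inE vK orbT.
rewrite /greedy_code; move: [::] => K; elim: ws K => //= u ws IH K /andP[u0 h].
rewrite inE => /orP[/eqP ->|]; last exact: IH.
case: ifP => [_|/negbT]; first by apply/hasP; exists u; [apply: mono; rewrite mem_head|rewrite nearly_orthogonal_irrefl].
by rewrite -has_predC => /hasP[v vK hv]; apply/hasP; exists v => //; exact: mono.
Qed.

Lemma size_cover (T U : eqType) (P : T -> U -> bool) (s : seq T) (K : seq U) :
  (forall w, w \in s -> has (P w) K) -> (size s <= \sum_(v <- K) count (P^~ v) s)%N.
Proof.
elim: s => [|w s IH] h; first by [].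
under eq_bigr do rewrite /=.
rewrite big_split /= -addn1 addnC; apply: leq_add.
  have : has (P w) K by apply: h; rewrite mem_head.
  by elim: K {IH h} => //= v K IH /orP[hv|/IH h]; rewrite big_cons ?hv //; lia.
by apply: IH => v vs; apply: h; rewrite inE vs orbT.
Qed.

(** The conflict sets of the chosen words cover all [2 ^ d] words, and each of them is small by
    [chernoff_count]. *)
Lemma greedy_size d : (0 < d)%N ->
  (2 * (x * t)) ^+ d <= (size (greedy_code H (words d)))%:R * (2 * (x ^+ 2 + 1) ^+ d).
Proof.
move=> d0; set K := greedy_code H (words d).
have xt : 0 <= (x * t) ^+ d.
  have : 1 < t by rewrite /t ltrDl invr_gt0 ltr0n; lia.
  by move=> t1; rewrite exprn_ge0 // mulr_ge0 // ?exprn_ge0 //; lra.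
have h : (size (words d) <= \sum_(v <- K) count (fun w => ~~ nearly_orthogonal H w v) (words d))%N.
  apply: (@size_cover _ _ (fun w v => ~~ nearly_orthogonal H w v)) => w hw; apply: greedy_covers => //.
  by apply/allP => v; rewrite mem_words => /eqP ->.
rewrite exprMn -natrX; rewrite size_words in h.
apply: le_trans (ler_wpM2r xt (_ : _ <= (\sum_(v <- K) count (fun w => ~~ nearly_orthogonal H w v) (words d))%:R)) _.
  by rewrite ler_nat.
rewrite natr_sum mulr_suml.
have -> : (size K)%:R * (2 * (x ^+ 2 + 1) ^+ d) = \sum_(v <- K) (2 * (x ^+ 2 + 1) ^+ d).
  by rewrite big_const_seq count_predT iter_addr_0 mulr_natl.
rewrite big_seq [X in _ <= X]big_seq; apply: ler_sum => v vK; apply: chernoff_count.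
by apply/eqP; rewrite -mem_words; exact: greedy_subset vK.
Qed.
End Chernoff.

(** The ratio of [2 * x * t] to [x ^+ 2 + 1] is a constant [1 + s > 1], so the code grows
    exponentially with its length; Bernoulli's inequality tells for which [D] the power
    [(1 + s) ^+ D] reaches [M]. The factor 2 is that of the two tails. *)
Lemma greedy_code_large (H M : nat) : (2 <= H)%N -> exists D0, forall D e, (D0 <= D)%N -> (0 < e)%N -> (0 < D)%N ->
  (M ^ e <= 2 * size (greedy_code H (words (D * e))))%N.
Proof.
move=> H2; have := @chernoff_ratio rat H H2.
set t : rat := 1 + _; set x := t ^+ H => hx.
have g0 : 0 < x ^+ 2 + 1 by have := sqr_ge0 x; lra.
pose s := 2 * (x * t) / (x ^+ 2 + 1) - 1.
have s0 : 0 < s by rewrite /s subr_gt0 ltr_pdivlMr ?mul1r.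
have es : 2 * (x * t) = (1 + s) * (x ^+ 2 + 1) by rewrite /s; field; lra.
exists (Num.bound (M%:R / s)) => D e hD e0 D0.
have hM : M%:R <= (1 + s) ^+ D.
  apply: le_trans (bernoulli_ineq _ _); last by lra.
  have p : 0 <= M%:R / s by rewrite divr_ge0 ?ler0n ?ltW.
  have := archi_boundP p; rewrite ltr_pdivrMr // => h.
  have : (Num.bound (M%:R / s))%:R * s <= D%:R * s by rewrite ler_pM2r // ler_nat.
  by lra.
have := @greedy_size rat H H2 (D * e); rewrite muln_gt0 D0 e0 => /(_ isT).
rewrite -/t -/x es exprMn mulrA ler_pM2r ?exprn_gt0 // => h.
rewrite -(ler_nat rat) natrX natrM mulrC; apply: le_trans h.
by rewrite exprM lerXn2r // ?nnegrE ?ler0n // exprn_ge0 //; lra.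
Qed.

(** * Distances to a center *)

Section Dot.
Variables (R : realType) (d : nat).
Implicit Types u v c : 'rV[R]_d.

Definition dot u v : R := \sum_(j < d) u 0 j * v 0 j.

Lemma dotC u v : dot u v = dot v u.
Proof. by apply: eq_bigr => j _; rewrite mulrC. Qed.

Lemma dotDl u u' v : dot (u + u') v = dot u v + dot u' v.
Proof. by rewrite /dot -big_split; apply: eq_bigr => j _; rewrite mxE mulrDl. Qed.

Lemma dotZl a u v : dot (a *: u) v = a * dot u v.
Proof. by rewrite /dot mulr_sumr; apply: eq_bigr => j _; rewrite mxE mulrA. Qed.

Lemma dotNl u v : dot (- u) v = - dot u v.
Proof. by rewrite -scaleN1r dotZl mulN1r. Qed.

Lemma dot0l v : dot 0 v = 0.
Proof. by rewrite /dot big1 // => j _; rewrite mxE mul0r. Qed.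

Lemma dot_suml (I : finType) (P : pred I) (f : I -> 'rV[R]_d) v :
  dot (\sum_(i | P i) f i) v = \sum_(i | P i) dot (f i) v.
Proof. exact: (big_morph (fun u => dot u v) (fun u u' => dotDl u u' v) (dot0l v)). Qed.

Lemma dot_ge0 u : 0 <= dot u u.
Proof. by apply: sumr_ge0 => j _; rewrite -expr2 sqr_ge0. Qed.

Lemma dotBB u v : dot (u - v) (u - v) = dot u u - 2 * dot u v + dot v v.
Proof.
rewrite dotDl dotNl ![dot _ (u - v)]dotC !dotDl !dotNl [dot v u]dotC.
by ring.
Qed.

Lemma l2norm_dot u : l2norm u = Num.sqrt (dot u u).
Proof. by rewrite /l2norm /dot; under eq_bigr do rewrite expr2. Qed.
End Dot.

Section NearlyOrthonormal.
Variables (R : realType) (d n : nat) (w : 'I_n -> 'rV[R]_d) (U : {set 'I_n}) (eta : R).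
Hypothesis eta0 : 0 <= eta.
Hypothesis w_unit : forall i, i \in U -> dot (w i) (w i) = 1.
Hypothesis w_orth : forall i j, i \in U -> j \in U -> i != j -> `|dot (w i) (w j)| <= eta.

(** The diagonal of the Gram matrix is exact and its other entries are at most [eta]; for
    nonnegative coefficients the errors add up to at most [eta] times the square of their sum. *)
Lemma gram_bound (A : {set 'I_n}) (a : 'I_n -> R) : A \subset U ->
  (forall i, i \in A -> 0 <= a i) ->
  `|dot (\sum_(i in A) a i *: w i) (\sum_(i in A) a i *: w i) - \sum_(i in A) a i ^+ 2|
    <= eta * (\sum_(i in A) a i) ^+ 2.
Proof.
move=> sAU a0.
have -> : \sum_(i in A) a i ^+ 2 = \sum_(i in A) \sum_(j in A) a i * (a j * (i == j)%:R).
  apply: eq_bigr => i iA; rewrite (bigD1 i) //= eqxx mulr1 -expr2 big1 ?addr0 // => j /andP[_ ne].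
  by rewrite eq_sym (negbTE ne) !mulr0.
rewrite dot_suml -sumrB expr2 mulr_suml mulr_sumr.
apply: le_trans (ler_norm_sum _ _ _) _; apply: ler_sum => i iA.
rewrite dotZl dotC dot_suml mulr_sumr -sumrB mulr_sumr mulr_sumr.
apply: le_trans (ler_norm_sum _ _ _) _; apply: ler_sum => j jA.
rewrite dotZl -mulrBr -mulrBr !normrM (ger0_norm (a0 i iA)) (ger0_norm (a0 j jA)).
rewrite [leRHS]mulrC -mulrA; apply: ler_wpM2l; first exact: a0.
apply: ler_wpM2l; first exact: a0.
have iU := fintype.subsetP sAU _ iA; have jU := fintype.subsetP sAU _ jA.
case: (eqVneq i j) => [<-|ne]; first by rewrite w_unit // subrr normr0.
by rewrite subr0; apply: w_orth => //; rewrite eq_sym.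
Qed.

Definition psum (T : {set 'I_n}) : 'rV[R]_d := \sum_(i in T) w i.

Lemma psum_norm (T : {set 'I_n}) : T \subset U ->
  `|dot (psum T) (psum T) - #|T|%:R| <= eta * #|T|%:R ^+ 2.
Proof.
move=> sTU; have := @gram_bound T (fun=> 1) sTU (fun _ _ => ler01).
rewrite (_ : \sum_(i in T) 1 *: w i = psum T); last by apply: eq_bigr => i _; rewrite scale1r.
by rewrite expr1n !sumr_const.
Qed.

Section Center.
Variable c : 'rV[R]_d.
Let cf i := dot (w i) c.

(** Approximate Bessel inequality, from the squared norm of [c - \sum cf i *: w i]; the term in
    [eta] pays for the lack of exact orthogonality. *)
Lemma center_lower (B : {set 'I_n}) : B \subset U -> (forall i, i \in B -> 0 <= cf i) ->
  \sum_(i in B) cf i ^+ 2 - eta * (\sum_(i in B) cf i) ^+ 2 <= dot c c.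
Proof.
move=> sBU c0; set v := \sum_(i in B) cf i *: w i.
have h1 : dot v c = \sum_(i in B) cf i ^+ 2.
  by rewrite dot_suml; apply: eq_bigr => i _; rewrite dotZl expr2.
have := gram_bound sBU c0; rewrite -/v ler_norml => /andP[_ h2].
by have := dot_ge0 (c - v); rewrite dotBB (dotC c v) h1; lra.
Qed.

Lemma coef_le i : i \in U -> cf i ^+ 2 <= dot c c.
Proof.
move=> iU; have := dot_ge0 (c - cf i *: w i); rewrite dotBB.
have -> : dot c (cf i *: w i) = cf i ^+ 2 by rewrite dotC dotZl expr2.
have -> : dot (cf i *: w i) (cf i *: w i) = cf i ^+ 2.
  by rewrite dotZl dotC dotZl w_unit // mulr1 expr2.
by lra.
Qed.

Lemma dist_expand (T : {set 'I_n}) :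
  dot (psum T - c) (psum T - c) = dot (psum T) (psum T) - 2 * \sum_(i in T) cf i + dot c c.
Proof. by rewrite dotBB [dot (psum T) c]dot_suml. Qed.
End Center.
End NearlyOrthonormal.

(** * Squared distances from one center to all points *)

Section Dichotomy.
Variables (R : realType) (z y : nat) (delta : R).
Hypotheses (z1 : (1 <= z)%N) (y1 : (1 <= y)%N) (d0 : 0 < delta) (d1 : delta <= 1).

(** Threshold for a large coefficient: the at most [z] smaller ones of a set change a squared
    distance by at most [2 * z * tau = delta / 3]. *)
Definition tau : R := delta / (6 * z%:R).
(** With more large coefficients, the Bessel bound would push [dot c c] beyond [6 * z]; centers that
    far out are treated separately. *)
Definition big_coef_bound : nat := Num.bound ((6 * z%:R + 1) / tau ^+ 2).

Lemma exists_subset_card (T : finType) (B : {set T}) b : (b <= #|B|)%N ->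
  exists2 A : {set T}, A \subset B & #|A| = b.
Proof.
move=> le; have : (0 < #|[set A : {set T} | (A \subset B) && (#|A| == b)]|)%N.
  by rewrite cards_draws bin_gt0.
by rewrite card_gt0 => /set0Pn[A]; rewrite inE => /andP[s /eqP e]; exists A.
Qed.

(* A center [c] has few large coefficients [dot (w i) c]. A set with more than
   [y] of them is exceptional; the others are at squared distance at least
   about [z - y] from [c], and at least about [z - y + 1/2] unless they contain
   one particular [y]-set: two different [y]-sets cannot both be close to [c],
   since (s-1)^2 + s^2 >= 1/2. *)
Lemma center_dichotomy (eta : R) d n (w : 'I_n -> 'rV[R]_d) (U : {set 'I_n}) (c : 'rV[R]_d) :
  0 <= eta -> eta * z%:R ^+ 2 <= delta / 3 ->
  eta * (36 * z%:R ^+ 2 * big_coef_bound%:R ^+ 2) <= delta / 3 ->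
  (forall i, i \in U -> dot (w i) (w i) = 1) ->
  (forall i j, i \in U -> j \in U -> i != j -> `|dot (w i) (w j)| <= eta) ->
  (y <= n)%N ->
  exists S X : {set 'I_n}, [/\ #|S| = y, (#|X| <= big_coef_bound)%N &
    forall T : {set 'I_n}, T \subset U -> #|T| = z -> (#|T :&: X| <= y)%N ->
      (z%:R - y%:R - delta <= dot (psum w T - c) (psum w T - c)) /\
      (~~ (S \subset T) -> z%:R - y%:R + 2^-1 - delta <= dot (psum w T - c) (psum w T - c))].
Proof.
move=> eta0 he1 he2 wu wo yn.
have zR : 1 <= z%:R :> R by rewrite (ler_nat R 1 z).
have [S0 _ cS0] : exists2 S0 : {set 'I_n}, S0 \subset [set: 'I_n] & #|S0| = y.
  by apply: exists_subset_card; rewrite cardsT card_ord.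
have normT (T : {set 'I_n}) : T \subset U -> #|T| = z ->
    `|dot (psum w T) (psum w T) - z%:R| <= eta * z%:R ^+ 2.
  by move=> sTU cT; rewrite -cT; apply: psum_norm sTU.
(* A center this far out is at squared distance at least [z] from every point, so any [y]-set and an
   empty [X] will do. The inner product is bounded by expanding the square of
   [2 *: psum w T - c]. *)
have [cbig|csmall] := ltrP (6 * z%:R) (dot c c).
  exists S0, finset.set0; split=> //; first by rewrite cards0.
  move=> T sTU cT _; have := normT T sTU cT; rewrite ler_norml => /andP[h1 h2].
  have := dot_ge0 (psum w T - c - psum w T); rewrite dotBB.
  set q := dot (psum w T - c) (psum w T - c) => h3.
  have y0 : 1 <= y%:R :> R by rewrite (ler_nat R 1 y).
  suff : z%:R <= q by move=> ?; split=> [|_]; lra.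
  have h4 := dot_ge0 (2 *: psum w T - c).
  have e1 : dot (2 *: psum w T - c) (2 *: psum w T - c) =
     4 * dot (psum w T) (psum w T) - 4 * dot (psum w T) c + dot c c.
    by rewrite dotBB !dotZl [dot (psum w T) (2 *: _)]dotC !dotZl; ring.
  have e2 : q = dot (psum w T) (psum w T) - 2 * dot (psum w T) c + dot c c by rewrite /q dotBB.
  rewrite e1 in h4; rewrite e2; move: h4 h2 he1 cbig zR d1.
  move: (dot (psum w T) (psum w T)) (dot (psum w T) c) (dot c c) (eta * z%:R ^+ 2) => A B C X.
  by lra.
have tau0 : 0 < tau by rewrite /tau divr_gt0 //; lra.
have etau : tau * z%:R = delta / 6 by rewrite /tau; field; lra.
set cf := fun i => dot (w i) c.
pose B := [set i in U | tau <= cf i].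
have sBU : B \subset U by apply/fintype.subsetP => i; rewrite inE => /andP[].
have cB i : i \in B -> tau <= cf i by rewrite inE => /andP[].
have cup i : i \in U -> cf i <= 6 * z%:R.
  move=> iU; have h := coef_le wu c iU; rewrite leNgt; apply/negP => lt.
  have : (6 * z%:R) * 1 < cf i ^+ 2 by rewrite expr2; apply: ltr_pM => //; lra.
  by rewrite -/(cf i) in h; lra.
have sumB (B' : {set 'I_n}) : B' \subset B -> (#|B'| <= big_coef_bound)%N ->
    eta * (\sum_(i in B') cf i) ^+ 2 <= delta / 3.
  move=> sB cB'; apply: le_trans he2; apply: ler_wpM2l => //.
  have s0 : 0 <= \sum_(i in B') cf i.
    by apply: sumr_ge0 => i iB; have := cB i (fintype.subsetP sB _ iB); lra.
  have s1 : \sum_(i in B') cf i <= 6 * z%:R * big_coef_bound%:R.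
    apply: le_trans (_ : \sum_(i in B') 6 * z%:R <= _).
      by apply: ler_sum => i iB; apply: cup; apply: (fintype.subsetP sBU); exact: (fintype.subsetP sB).
    rewrite sumr_const -[X in X <= _]mulr_natr; apply: ler_wpM2l; first by lra.
    by rewrite ler_nat.
  have -> : 36 * z%:R ^+ 2 * big_coef_bound%:R ^+ 2 = (6 * z%:R * big_coef_bound%:R) ^+ 2 :> R by ring.
  by rewrite lerXn2r ?nnegrE //; lra.
(* The Bessel error is controlled for sets of bounded size only, so the contradiction comes from a
   subset [B'] of exactly [big_coef_bound] elements. *)
have cardB : (#|B| <= big_coef_bound)%N.
  rewrite leqNgt; apply/negP => lt.
  have [B' sB cB'] := exists_subset_card (ltnW lt).
  have sB'U := fintype.subset_trans sB sBU.
  have h : \sum_(i in B') cf i ^+ 2 - eta * (\sum_(i in B') cf i) ^+ 2 <= dot c c.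
    apply: (center_lower eta0 wu wo sB'U) => i iB.
    by have := cB i (fintype.subsetP sB _ iB); rewrite /cf; lra.
  have := sumB B' sB; rewrite cB' leqnn => /(_ isT) h2.
  have h3 : big_coef_bound%:R * tau ^+ 2 <= \sum_(i in B') cf i ^+ 2.
    rewrite -cB' mulr_natl -sumr_const; apply: ler_sum => i iB.
    by have := cB i (fintype.subsetP sB _ iB) => ci; rewrite lerXn2r ?nnegrE //; lra.
  have p : 0 <= (6 * z%:R + 1) / tau ^+ 2 by rewrite divr_ge0 ?sqr_ge0 //; lra.
  have := archi_boundP p; rewrite -/big_coef_bound ltr_pdivrMr ?exprn_gt0 // => h4.
  move: h h2 h3 h4 csmall d1.
  move: (\sum_(i in B') cf i ^+ 2) (eta * _) (_ * tau ^+ 2) (dot c c) => ? ? ? ?.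
  by lra.
(* Completing squares: an element of [B] contributes [(cf i - 1) ^+ 2] if it belongs to the set and
   [cf i ^+ 2] otherwise. *)
pose E (A : {set 'I_n}) i : R := if i \in A then (cf i - 1) ^+ 2 else cf i ^+ 2.
have E0 A i : 0 <= E A i by rewrite /E; case: ifP => _; exact: sqr_ge0.
(* The loss [delta] has three equal shares: the norm of [psum w T], the Bessel bound, and the
   coefficients below [tau]. *)
have main (T : {set 'I_n}) : T \subset U -> #|T| = z ->
    z%:R - #|T :&: B|%:R - delta + \sum_(i in B) E (T :&: B) i
      <= dot (psum w T - c) (psum w T - c).
  move=> sTU cT; rewrite dist_expand.
  have := normT T sTU cT; rewrite ler_norml => /andP[h1 _].
  have h2 : \sum_(i in B) cf i ^+ 2 - eta * (\sum_(i in B) cf i) ^+ 2 <= dot c c.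
    by apply: (center_lower eta0 wu wo sBU) => i iB; have := cB i iB; rewrite /cf; lra.
  have h3 := sumB B (fintype.subxx _) cardB.
  have h4 : \sum_(i in T) cf i <= \sum_(i in T :&: B) cf i + z%:R * tau.
    rewrite (big_setID B) /= lerD2l; apply: le_trans (_ : \sum_(i in T :\: B) tau <= _).
      apply: ler_sum => i; rewrite !inE => /andP[nB iT]; rewrite ltW // ltNge.
      by apply: contra nB => ->; rewrite (fintype.subsetP sTU).
    rewrite sumr_const -[X in X <= _]mulr_natl; apply: ler_wpM2r; first exact: ltW.
    by rewrite ler_nat -cT subset_leq_card // subsetDl.
  have h5 : \sum_(i in B) E (T :&: B) i =
      \sum_(i in B) cf i ^+ 2 - 2 * \sum_(i in T :&: B) cf i + #|T :&: B|%:R.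
    rewrite (big_setID (T :&: B)) [\sum_(i in B) cf i ^+ 2](big_setID (T :&: B)) /=.
    have eB : B :&: (T :&: B) = T :&: B by apply/finset.setIidPr; exact: subsetIr.
    rewrite eB; have -> : \sum_(i in B :\: (T :&: B)) E (T :&: B) i = \sum_(i in B :\: (T :&: B)) cf i ^+ 2.
      by apply: eq_bigr => i; rewrite finset.inE => /andP[nA _]; rewrite /E (negbTE nA).
    have -> : \sum_(i in T :&: B) E (T :&: B) i =
        \sum_(i in T :&: B) cf i ^+ 2 - 2 * \sum_(i in T :&: B) cf i + #|T :&: B|%:R.
      rewrite -[#|_|%:R]sumr_const mulr_sumr -sumrB -big_split /=.
      by apply: eq_bigr => i iA; rewrite /E iA; ring.
    by lra.
  by rewrite -/cf; lra.
pose close (T : {set 'I_n}) := [&& T \subset U, #|T| == z, #|T :&: B| == y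
  & dot (psum w T - c) (psum w T - c) < z%:R - y%:R + 2^-1 - delta].
have [S [cS hS]] : exists S : {set 'I_n}, #|S| = y /\
    forall T, close T -> S = T :&: B.
  case: (pselect (exists T, close T)) => [[T0 cl0]|no]; last first.
    by exists S0; split=> // T clT; case: no; exists T.
  exists (T0 :&: B); split; first by case/and4P: cl0 => _ _ /eqP.
  move=> T clT; apply/eqP; apply/negPn/negP => ne.
  case/and4P: cl0 => s0 /eqP c0 /eqP b0 q0; case/and4P: clT => s1 /eqP c1 /eqP b1 q1.
  have := main T0 s0 c0; have := main T s1 c1; rewrite b0 b1 => m1 m0.
  have nsub (A A' : {set 'I_n}) : #|A| = #|A'| -> A != A' -> exists2 i, i \in A & i \notin A'.
    move=> ec neA; apply/fintype.subsetPn; apply: contra neA => sub.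
    by rewrite eqEcard sub ec leqnn.
  have [i i0 i1] := nsub _ _ (etrans b0 (esym b1)) ne.
  rewrite eq_sym in ne; have [j j1 j0] := nsub _ _ (etrans b1 (esym b0)) ne.
  have iB : i \in B by case/setIP: i0. have jB : j \in B by case/setIP: j1.
  have nij : j != i by apply: contraNneq i1 => <-.
  (* For each of [i] and [j] the two sets together contribute [(s - 1) ^+ 2 + s ^+ 2 >= 1 / 2], so
     the two sums of [E] add up to at least 1; closeness would make both less than [1 / 2]. *)
  have two A : E A i + E A j <= \sum_(l in B) E A l.
    rewrite (bigD1 i) //= (bigD1 j) /=; last by rewrite jB.
    by rewrite addrA lerDl sumr_ge0.
  have := two (T0 :&: B); have := two (T :&: B).
  rewrite /E i0 (negbTE i1) j1 (negbTE j0) => t1 t0.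
  have si := sqr_ge0 (cf i - 2^-1); have sj := sqr_ge0 (cf j - 2^-1).
  by rewrite !expr2 in t1 t0 si sj; lra.
exists S, B; split=> // T sTU cT cTB; have m := main T sTU cT.
have E0s : 0 <= \sum_(i in B) E (T :&: B) i by apply: sumr_ge0.
have : #|T :&: B|%:R <= y%:R :> R by rewrite ler_nat.
move=> le; split; first by lra.
(* With fewer than [y] large coordinates the bound improves by 1, more than the required [1 / 2].
   With exactly [y], closeness would make [S] equal to [T :&: B], a subset of [T]. *)
move=> nS; case: (ltngtP #|T :&: B| y) cTB => // lt _.
  have : #|T :&: B|%:R + 1 <= y%:R :> R by rewrite natr1 ler_nat.
  by lra.
rewrite leNgt; apply/negP => q; move/negP: nS; apply; rewrite (hS T); first exact: subsetIl.
by rewrite /close sTU cT lt !eqxx q.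
Qed.

End Dichotomy.

(** An exceptional set is determined by a [y.+1]-subset of [X] that it contains and by its other
    [z - y - 1] elements; [first] chooses such a subset. *)
Lemma exceptional_count z y n (X : {set 'I_n}) : (y < z)%N ->
  (#|[set T : {set 'I_n} | (#|T| == z) && (y < #|T :&: X|)%N]| <= 2 ^ #|X| * n ^ (z - y - 1))%N.
Proof.
move=> yz; set Q := [set T | _].
pose first T : {set 'I_n} := odflt finset.set0 [pick A : {set 'I_n} | (A \subset T :&: X) && (#|A| == y.+1)].
have firstP T : T \in Q -> (first T \subset T :&: X) /\ #|first T| = y.+1.
  rewrite inE => /andP[_ lt]; rewrite /first; case: pickP => [A /andP[s /eqP e]|no] //=.
  by have [A s e] := exists_subset_card lt; have := no A; rewrite s e eqxx.
pose f T := (first T, T :\: first T).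
have inj : {in Q &, injective f}.
  move=> T1 T2 q1 q2 [e1 e2].
  have [s1 _] := firstP _ q1; have [s2 _] := firstP _ q2.
  rewrite -(setID T1 (first T1)) -(setID T2 (first T2)) e2.
  have -> : T1 :&: first T1 = first T1.
    by apply/finset.setIidPr; apply: fintype.subset_trans s1 (subsetIl _ _).
  have -> : T2 :&: first T2 = first T2.
    by apply/finset.setIidPr; apply: fintype.subset_trans s2 (subsetIl _ _).
  by rewrite e1.
rewrite -(card_in_imset inj).
apply: leq_trans (_ : #|finset.setX (powerset X) [set A : {set 'I_n} | #|A| == (z - y - 1)%N]| <= _)%N.
  apply: subset_leq_card; apply/fintype.subsetP => _ /imsetP[T q ->].
  have [s e] := firstP _ q; rewrite inE /= !inE.
  rewrite (fintype.subset_trans s (subsetIr _ _)) /=.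
  rewrite cardsD (finset.setIidPr (fintype.subset_trans s (subsetIl _ _))) e.
  by move: q; rewrite inE => /andP[/eqP -> _]; apply/eqP; lia.
rewrite cardsX card_powerset leq_mul2l; apply/orP; right.
rewrite card_draws card_ord; apply: leq_trans (_ : n ^_ (z - y - 1) <= _)%N.
  by rewrite -bin_ffact leq_pmulr // fact_gt0.
by elim: (_ - _)%N => [|k IH]; rewrite ?ffactn0 // ffactnSr expnSr leq_mul // leq_subr.
Qed.

(** An exceptional [t] falls short by at most [hi], since [f t] is nonnegative; and as [lo <= hi],
    the worst case is that as many sets as allowed are covered. *)
Lemma covered_sum_lower (R : realType) (T : eqType) (E : seq T) (cov exc : pred T)
    (f : T -> R) (alpha lo hi : R) :
  0 <= lo -> lo <= hi -> (forall t, 0 <= f t) ->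
  (count cov E)%:R <= alpha * (size E)%:R ->
  (forall t, t \in E -> ~~ exc t -> (if cov t then lo else hi) <= f t) ->
  alpha * (size E)%:R * lo + (1 - alpha) * (size E)%:R * hi - (count exc E)%:R * hi
    <= \sum_(t <- E) f t.
Proof.
move=> lo0 lohi f0 hcov hf.
have h1 : \sum_(t <- E) ((if cov t then lo else hi) - (exc t)%:R * hi) <= \sum_(t <- E) f t.
  rewrite big_seq [X in _ <= X]big_seq; apply: ler_sum => t tE.
  have := hf t tE; case: (exc t) => [_|/(_ isT)]; last by rewrite mul0r subr0.
  by have := f0 t; rewrite mul1r; case: ifP => _; lra.
apply: le_trans h1.
have -> : \sum_(t <- E) ((if cov t then lo else hi) - (exc t)%:R * hi) =
    (size E)%:R * hi - (count cov E)%:R * (hi - lo) - (count exc E)%:R * hi.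
  elim: E {hcov hf} => [|t E IH]; first by rewrite big_nil !mul0r !subr0.
  rewrite big_cons IH /= -addn1 !natrD; case: (cov t) => /=; ring.
have := ler_wpM2r (_ : 0 <= hi - lo) hcov; rewrite subr_ge0 lohi => /(_ isT).
by lra.
Qed.

Lemma count_exceptional (z y b n k : nat) (E : seq {set 'I_n}) (X : 'I_k -> {set 'I_n})
    (sigma : {set 'I_n} -> 'I_k) :
  (y < z)%N -> uniq E -> all (fun T : {set 'I_n} => #|T| == z) E ->
  (forall i, #|X i| <= b)%N ->
  (count (fun T : {set 'I_n} => (y < #|T :&: X (sigma T)|)%N) E <= k * (2 ^ b * n ^ (z - y - 1)))%N.
Proof.
move=> yz uE zE hX.
pose Q i := [set T : {set 'I_n} | (#|T| == z) && (y < #|T :&: X i|)%N].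
rewrite -size_filter -(card_uniqP (filter_uniq _ uE)).
apply: leq_trans (_ : #|\bigcup_i Q i| <= _)%N.
  apply: subset_leq_card; apply/fintype.subsetP => T; rewrite mem_filter => /andP[h TE].
  by apply/bigcupP; exists (sigma T) => //; rewrite inE (allP zE _ TE).
apply: leq_trans (_ : \sum_i #|Q i| <= _)%N.
  apply: (big_ind2 (fun (A : {set {set 'I_n}}) m => #|A| <= m)%N); first by rewrite cards0.
    by move=> A m B m' hA hB; rewrite (leq_trans (leq_card_setU A B)) // leq_add.
  by [].
apply: leq_trans (_ : \sum_(i < k) (2 ^ b * n ^ (z - y - 1)) <= _)%N; last by rewrite sum_nat_const card_ord.
apply: leq_sum => i _; apply: leq_trans (exceptional_count _ yz) _.
by rewrite leq_mul2r leq_exp2l // hX orbT.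
Qed.

(** Let [s] and [h] be the roots of [a] and [a + 1 / 2], both at least 1. Lowering a radicand by
    [delta] then costs at most [delta]; [kappa * s] lies between [1 - e] and 1; and [h / s <= 3 / 2]
    because [1 <= a]. The losses are [delta] for the radicands, [3 / 2 * e <= delta / 2] for the
    scaling, and [3 / 2 * theta] for the exceptional sets. *)
Lemma ratio_bound (R : realType) (a e delta theta kappa alpha m x : R) :
  1 <= a -> 0 <= e -> e <= delta / 3 -> 0 < delta -> delta <= 1 -> 0 <= theta ->
  0 <= kappa -> kappa ^+ 2 * (a + e) = 1 -> 0 <= alpha -> alpha <= 1 -> 0 <= m ->
  0 <= x -> x <= theta * m ->
  (alpha + Num.sqrt ((a + 2^-1) / a) * (1 - alpha) - (3 / 2 * delta + 3 / 2 * theta)) * m <=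
  kappa * (alpha * m * Num.sqrt (a - delta) + (1 - alpha) * m * Num.sqrt (a + 2^-1 - delta)
           - x * Num.sqrt (a + 2^-1 - delta)).
Proof.
move=> a1 e0 ed d0 d1 th0 k0 hk al0 al1 m0 x0 xm.
set s := Num.sqrt a; set h := Num.sqrt (a + 2^-1).
have s0 : 0 <= s by exact: sqrtr_ge0.
have h0 : 0 <= h by exact: sqrtr_ge0.
have ss : s ^+ 2 = a by rewrite sqr_sqrtr //; lra.
have hh : h ^+ 2 = a + 2^-1 by rewrite sqr_sqrtr //; lra.
have s1 : 1 <= s by rewrite -sqrtr1 ler_wsqrtr.
have sh : s <= h by rewrite ler_wsqrtr //; lra.
have hs : h <= 3 / 2 * s.
  rewrite -(@ler_pXn2r R 2) // ?nnegrE //; last by lra.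
  by rewrite hh exprMn ss; lra.
have -> : Num.sqrt ((a + 2^-1) / a) = h / s by rewrite sqrtrM ?sqrtrV //; lra.
have low b r : 1 <= r -> r ^+ 2 = b -> r - delta <= Num.sqrt (b - delta).
  move=> r1 hr; have r0 : 0 <= r - delta by lra.
  rewrite -(ger0_norm r0) -sqrtr_sqr ler_wsqrtr // -hr.
  have : 0 <= delta * (2 * r - 1 - delta) by apply: mulr_ge0; lra.
  by rewrite !expr2; lra.
have lo := low a s s1 ss; have hi := low (a + 2^-1) h (le_trans s1 sh) hh.
have hi' : Num.sqrt (a + 2^-1 - delta) <= h by rewrite ler_wsqrtr //; lra.
move: lo hi hi'; move: (Num.sqrt (a - delta)) (Num.sqrt (a + 2^-1 - delta)) => l1 l2 lo hi hi'.
have k1 : kappa * s <= 1.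
  rewrite -(@ler_pXn2r R 2) // ?nnegrE ?mulr_ge0 //.
  by rewrite expr1n exprMn ss -hk mulrDr lerDl mulr_ge0 ?sqr_ge0.
have k2 : 1 - e <= kappa * s.
  rewrite -(@ler_pXn2r R 2) // ?nnegrE ?mulr_ge0 //; last by lra.
  rewrite exprMn ss.
  have -> : (1 - e) ^+ 2 = kappa ^+ 2 * ((a + e) * (1 - e) ^+ 2) by rewrite mulrA hk mul1r.
  apply: ler_wpM2l; first exact: sqr_ge0.
  have : 0 <= (a - 1) * (e * (2 - e)) by apply: mulr_ge0; [lra|apply: mulr_ge0; lra].
  have : 0 <= e * (1 - e) by apply: mulr_ge0; lra.
  have : 0 <= e * e * (1 - e) by apply: mulr_ge0; [exact: mulr_ge0|lra].
  by rewrite expr2; lra.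
have ks : kappa <= kappa * s by rewrite ler_peMr.
set q := h / s; have sq : s * q = h by rewrite /q mulrC divfK //; lra.
have q1 : q <= 3 / 2 by rewrite ler_pdivrMr //; lra.
have q0 : 0 <= q by rewrite divr_ge0.
pose X := alpha + q * (1 - alpha).
have X0 : 0 <= X by rewrite addr_ge0 // mulr_ge0 //; lra.
have X1 : X <= 3 / 2.
  have : q * (1 - alpha) <= 3 / 2 * (1 - alpha) by apply: ler_wpM2r; lra.
  by rewrite /X; lra.
have c1 : m * (alpha * (s - delta) + (1 - alpha) * (h - delta) - theta * h) <=
    alpha * m * l1 + (1 - alpha) * m * l2 - x * l2.
  have t1 : alpha * m * (s - delta) <= alpha * m * l1 by apply: ler_wpM2l => //; exact: mulr_ge0.
  have t2 : (1 - alpha) * m * (h - delta) <= (1 - alpha) * m * l2.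
    by apply: ler_wpM2l => //; apply: mulr_ge0 => //; lra.
  have t3 : x * l2 <= theta * m * h.
    apply: le_trans (ler_wpM2l x0 hi') _; exact: ler_wpM2r.
  by lra.
apply: le_trans _ (ler_wpM2l k0 c1); rewrite mulrCA mulrC; apply: ler_wpM2l => //.
have -> : kappa * (alpha * (s - delta) + (1 - alpha) * (h - delta) - theta * h) =
    kappa * s * X - kappa * delta - theta * (kappa * s * q).
  by rewrite /X -sq; ring.
have u1 : (1 - e) * X <= kappa * s * X by apply: ler_wpM2r.
have u2 : e * X <= delta / 3 * (3 / 2) by apply: ler_pM.
have u3 : kappa * delta <= 1 * delta by apply: ler_wpM2r; lra.
have u4 : theta * (kappa * s * q) <= theta * (3 / 2).
  by apply: ler_wpM2l => //; rewrite -[leRHS]mul1r; apply: ler_pM => //; apply: mulr_ge0.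
by rewrite -/X; lra.
Qed.

(** * Correctness of the reduction on codes *)

Lemma consume_zip A B (d : B) (s : seq A) (t : seq B) :
  consume predT d s t = zip s (mkseq (nth d t) (size s)).
Proof.
elim: s t => // a s IH t.
have e : mkseq (nth d t) (size s).+1 = head d t :: mkseq (nth d (behead t)) (size s).
  rewrite /mkseq /= (iotaDl 1 0) -map_comp.
  by case: t => [|b t] /=; congr (_ :: _); apply: eq_map => i /=; rewrite ?nth_nil.
by rewrite [size _]/= e /= IH.
Qed.

Lemma consume_map (I A B : Type) (d : B) (f : I -> A) (g : I -> B) (s : seq I) :
  consume predT d (map f s) (map g s) = [seq (f i, g i) | i <- s].
Proof. by elim: s => //= i s ->. Qed.

Lemma enum_filter (T : finType) (A : {pred T}) : enum A = [seq x <- enum T | x \in A].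
Proof. by rewrite enumT. Qed.

Lemma true_counts_spec d (vs : seq bits) :
  true_counts d vs = [seq count (fun v => nth false v j) vs | j <- iota 0 d].
Proof.
rewrite /true_counts; have -> : nseq d 0%N = [seq 0%N | _ <- iota 0 d].
  suff h m : nseq d 0%N = [seq 0%N | _ <- iota m d] by exact: h.
  by elim: d m => //= d IH m; rewrite -IH.
suff h f : foldl (fun x v => [seq (p.1 + p.2)%N | p : nat * bool <- consume predT false x v])
      [seq f j | j <- iota 0 d] vs = [seq (f j + count (fun v => nth false v j) vs)%N | j <- iota 0 d].
  by rewrite (h (fun=> 0%N)).
elim: vs f => [|v vs IH] f /=.
  by apply: eq_map => j; rewrite addn0.
rewrite consume_zip size_map size_iota zip_map -map_comp.
rewrite (_ : map _ _ = [seq (f j + nth false v j)%N | j <- iota 0 d]); last by apply: eq_map.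
by rewrite IH; apply: eq_map => j; rewrite addnA.
Qed.

(** The marked positions receive successive entries of [K], never the default since there are enough
    of them; so a pairwise relation on [K] passes to marked positions in increasing order. *)
Lemma assign_spec (rr : rel bits) (s : bits) (K : seq bits) :
  (count id s <= size K)%N -> pairwise rr K ->
  let a := [seq p.2 | p <- consume id [::] s K] in
  (forall i, nth false s i -> nth [::] a i \in K) /\
  (forall i j, (i < j)%N -> nth false s i -> nth false s j -> rr (nth [::] a i) (nth [::] a j)).
Proof.
elim: s K => [|b s IH] K /=; first by move=> _ _; split=> [i|i j _]; rewrite nth_nil.
case: b => /= hc hp.
  case: K hc hp => // k K; rewrite add1n /= ltnS => hc /andP[ha hp].
  have [h1 h2] := IH K hc hp; split=> [[|i] /=|[|i] [|j] //= lt].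
  - by rewrite mem_head.
  - by move=> hi; rewrite inE h1 // orbT.
  - by move=> _ hj; apply: (allP ha); exact: h1.
  - exact: h2.
have [h1 h2] := IH K hc hp; split=> [[|i] //= hi|[|i] [|j] //= lt]; [exact: h1|exact: h2].
Qed.

Lemma dvdn_fact_pos t z : (0 < t)%N -> (t <= z)%N -> (t %| z`!)%N.
Proof. by move=> t0 tz; apply: dvdn_fact; rewrite t0. Qed.

(** The distance between [2 m] and [z] is at most [z]; if nonzero, it divides [z!] and hence [r].
    The fraction is thus plus or minus [1 / N], in lowest terms as [rat_code] demands. *)
Lemma coordinate_code_spec z r m J : (0 < r)%N -> (z`! %| r)%N -> (m <= z)%N ->
  coordinate_code z r m J = rat_code ((m.*2%:R - z%:R) / (r * 2 ^ J)%:R).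
Proof.
move=> r0 zr mz; rewrite /coordinate_code; case: eqP => [->|ne].
  by rewrite subrr mul0r /rat_code (_ : numq 0 = 0) // (_ : denq 0 = 1) // ltxx /= nat_bits0 nat_bits_half //= nat_bits0.
set t := ((m.*2 - z) + (z - m.*2))%N.
have t0 : (0 < t)%N by rewrite /t; lia.
have tz : (t <= z)%N by rewrite /t; lia.
have tr : (t %| r)%N by apply: dvdn_trans zr; exact: dvdn_fact_pos.
set N := (r %/ t * 2 ^ J)%N.
have N0 : (0 < N)%N by rewrite muln_gt0 expn_gt0 divn_gt0 // dvdn_leq.
pose sg : int := if (m.*2 < z)%N then -1 else 1.
have e : (m.*2%:R - z%:R) / (r * 2 ^ J)%:R = sg%:~R / (N%:Z)%:~R :> rat.
  have -> : (r * 2 ^ J)%N = (t * N)%N by rewrite /N mulnA [(t * _)%N]mulnC divnK.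
  have -> : m.*2%:R - z%:R = sg%:~R * t%:R :> rat.
    rewrite /sg /t; case: ltnP => h.
      have -> : (m.*2 - z = 0)%N by lia.
      by rewrite add0n natrB ?(ltnW h) // rmorphN1 mulN1r opprB.
    have -> : (z - m.*2 = 0)%N by lia.
    by rewrite addn0 natrB // mul1r.
  rewrite natrM; have tn : t%:R != 0 :> rat by rewrite pnatr_eq0 -lt0n.
  have Nn : N%:R != 0 :> rat by rewrite pnatr_eq0 -lt0n.
  rewrite -[(N%:Z)%:~R]/(N%:R); move: tn Nn; move: (t%:R : rat) (N%:R : rat) (sg%:~R : rat) => x y s xn yn.
  by field; rewrite xn yn.
have cop : coprime `|sg| `|N%:Z| by rewrite /sg; case: ifP => _; rewrite /= coprime1n.
rewrite e /rat_code coprimeq_num // coprimeq_den //.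
have -> : (N%:Z == 0) = false by lia.
rewrite gtr0_sg ?ltz_nat // mul1r; congr encode; congr [:: _; _; _].
- by rewrite /sg; case: ifP.
- by rewrite /sg; case: ifP => _; rewrite /= nat_bits_half //= nat_bits0.
- rewrite /= /N -nat_bits_shift //; first by rewrite divn_gt0 // dvdn_leq.
Qed.

Section Spec.
Variables (z H D r n k : nat) (E : seq {set 'I_n}).
Hypotheses (r0 : (0 < r)%N) (zr : (z`! %| r)%N) (H2 : (2 <= H)%N) (D0 : (0 < D)%N).
Hypothesis Ez : all (fun T : {set 'I_n} => #|T| == z) E.
Hypothesis large : forall e, (0 < e)%N ->
  ((4 * z) ^ e <= 2 * size (greedy_code H (words (D * e))))%N.

Definition jc_list : seq bits :=
  [:: nat_bits k, nseq n true & [seq [seq i \in T | i <- enum 'I_n] | T : {set 'I_n} <- E]].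

Definition universe : {set 'I_n} := [set i | has (fun T : {set 'I_n} => i \in T) E].

Let J := log_size (size E).
Let d := (D * 4 ^ J)%N.

Lemma rows_jc : rows jc_list = [seq [seq i \in T | i <- enum 'I_n] | T : {set 'I_n} <- E].
Proof. by []. Qed.

Lemma exponent_jc : exponent jc_list = J.
Proof. by rewrite /exponent rows_jc size_map. Qed.

Lemma dimension_jc : dimension D jc_list = d.
Proof. by rewrite /dimension exponent_jc. Qed.

Lemma used_jc : used jc_list = [seq i \in universe | i <- enum 'I_n].
Proof.
rewrite /used rows_jc [head _ _]/=.
have -> : [seq false | _ <- nseq n true] = [seq false | i <- enum 'I_n].
  by rewrite -[LHS]/(map (fun=> false) _) -{1}(size_enum_ord n); elim: (enum 'I_n) => //= i s ->.
suff h (f : 'I_n -> bool) s : foldl (fun x row => [seq p.1 || p.2 | p <- consume predT false x row])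
      [seq f i | i <- enum 'I_n] [seq [seq i \in T | i <- enum 'I_n] | T : {set 'I_n} <- s] =
    [seq f i || has (fun T : {set 'I_n} => i \in T) s | i <- enum 'I_n].
  by rewrite (h (fun=> false)); apply: eq_map => i; rewrite inE.
elim: s f => [|T s IH] f /=.
  by apply: eq_map => i; rewrite orbF.
rewrite consume_map -map_comp.
rewrite (_ : map _ _ = [seq f i || (i \in T) | i <- enum 'I_n]) ?IH //.
by apply: eq_map => i; rewrite orbA.
Qed.

Lemma card_universe : (#|universe| <= z * size E)%N.
Proof.
rewrite /universe; elim: E Ez => [|T s IH] /= => [_|/andP[/eqP cT /IH le]].
  by rewrite (_ : [set i | _] = finset.set0) ?cards0 //; apply/setP => i; rewrite !inE.
rewrite mulnS; apply: leq_trans (leq_add (leqnn _) le); rewrite -cT.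
apply: leq_trans (leq_card_setU _ _).1.
by apply: subset_leq_card; apply/fintype.subsetP => i; rewrite !inE.
Qed.

Definition codeword (i : 'I_n) : bits := nth [::] (assigned H D jc_list) i.

(** For [L] the bit length of the number of sets, [L < 4 ^ J]; so for positive [z] the power
    [(4 * z) ^ (4 ^ J)] is at least [4 * z * 2 ^ L], more than [4 * z * size E]. This is where the
    base [4 * z] comes from. *)
Lemma codewords_large : (z * size E <= size (codewords H D jc_list))%N.
Proof.
rewrite /codewords dimension_jc; have := large (_ : 0 < 4 ^ J)%N; rewrite expn_gt0 => /(_ isT).
rewrite -/d => h; case: (posnP z) => [->|z0]; first by rewrite mul0n.
have := size_nat_bits_gt (size E); set L := size (nat_bits _) => hL.
have hJ : (L < 4 ^ J)%N by exact: log_size_ge.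
have : ((4 * z) ^ L.+1 <= (4 * z) ^ (4 ^ J))%N by rewrite leq_exp2l //; lia.
have : (2 ^ L <= (4 * z) ^ L)%N by case: (L) => // L'; rewrite leq_exp2r //; lia.
by rewrite expnS; nia.
Qed.

(** The greedy list relates each pair in one direction only, hence the disjunction. *)
Lemma codeword_spec :
  (forall i, i \in universe -> size (codeword i) = d) /\
  (forall i j, i \in universe -> j \in universe -> i != j ->
     nearly_orthogonal H (codeword i) (codeword j) ||
     nearly_orthogonal H (codeword j) (codeword i)).
Proof.
have nthU (i : 'I_n) : nth false (used jc_list) i = (i \in universe).
  by rewrite used_jc (nth_map i) ?size_enum_ord // nth_ord_enum.
have cnt : (count id (used jc_list) <= size (codewords H D jc_list))%N.
  apply: leq_trans codewords_large; apply: leq_trans card_universe.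
  by rewrite used_jc count_map -size_filter cardE [enum universe]enum_filter.
have [h1 h2] := assign_spec cnt (greedy_pairwise H _).
split=> [i iU|i j iU jU ne].
  have := h1 i; rewrite nthU iU => /(_ isT) /greedy_subset.
  by rewrite mem_words dimension_jc => /eqP.
case: (ltngtP i j) => [lt|lt|/val_inj e]; last by rewrite e eqxx in ne.
  by apply/orP; left; apply: h2 => //; rewrite nthU.
by apply/orP; right; apply: h2 => //; rewrite nthU.
Qed.

Definition point (T : {set 'I_n}) : 'rV[rat]_d :=
  \row_j ((#|[set i in T | nth false (codeword i) j]|.*2%:R - z%:R) / (r * 2 ^ J)%:R).

Lemma assigned_jc : assigned H D jc_list = [seq codeword i | i <- enum 'I_n].
Proof.
have sa : size (assigned H D jc_list) = n.
  by rewrite /assigned size_map size_consume used_jc size_map size_enum_ord.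
apply: (@eq_from_nth _ [::]); first by rewrite sa size_map size_enum_ord.
move=> i; rewrite sa => lt; rewrite (nth_map (Ordinal lt)) ?size_enum_ord //.
by rewrite -[i in LHS]/(val (Ordinal lt)) -[i in RHS]/(val (Ordinal lt)) nth_ord_enum.
Qed.

Lemma point_code_jc T : T \in E ->
  point_code z H D r jc_list [seq i \in T | i <- enum 'I_n] =
  encode [seq rat_code (point T 0 j) | j <- enum 'I_d].
Proof.
move=> TE; rewrite /point_code; congr encode.
have -> : selected H D jc_list [seq i \in T | i <- enum 'I_n] = [seq codeword i | i <- enum T].
  by rewrite /selected assigned_jc consume_map filter_map -!map_comp enum_filter.
rewrite true_counts_spec dimension_jc exponent_jc -map_comp -val_enum_ord -map_comp.
apply: eq_map => j /=; rewrite mxE.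
have -> : count (fun v => nth false v j) [seq codeword i | i <- enum T] =
          #|[set i in T | nth false (codeword i) j]|.
  rewrite count_map -size_filter cardE [X in _ = size X]enum_filter [enum T]enum_filter -filter_predI; congr size.
  by apply: eq_filter => i; rewrite /= inE andbC.
have le : (#|[set i in T | nth false (codeword i) j]| <= z)%N.
  rewrite -(eqP (allP Ez _ TE)); apply: subset_leq_card; apply/fintype.subsetP => i.
  by rewrite inE => /andP[].
by rewrite (minn_idPl le) coordinate_code_spec.
Qed.

Lemma reduction_jc : reduction z H D r jc_list = km_code k [seq point T | T <- E].
Proof.
rewrite /reduction /km_code dimension_jc rows_jc; congr encode; congr [:: _, _ & _].
by rewrite -!map_comp; apply/eq_in_map => T TE /=; exact: point_code_jc.
Qed.
End Spec.

(** * The point set of an instance *)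

Definition sgn (R : realType) (b : bool) : R := if b then 1 else -1.

Lemma sum_sgn (R : realType) d (u v : bits) : size u = d -> size v = d ->
  \sum_(j < d) sgn R (nth false u j) * sgn R (nth false v j) = 2 * (agreements u v)%:R - d%:R.
Proof.
elim: d u v => [|d IH] [|a u] [|b v] //=; first by rewrite big_ord0 mulr0 subr0.
move=> [su] [sv]; rewrite big_ord_recl /= IH // agreements_cons natrD -[d.+1%:R]natr1.
by rewrite /sgn; case: a; case: b => /=; ring.
Qed.

Lemma sum_sgn_card (R : realType) (n : nat) (T : {set 'I_n}) (b : 'I_n -> bool) :
  \sum_(i in T) sgn R (b i) = #|[set i in T | b i]|.*2%:R - #|T|%:R.
Proof.
have -> : #|[set i in T | b i]|.*2%:R = \sum_(i in T) (2 * (b i)%:R) :> R.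
  rewrite -mulr_sumr -mul2n natrM; congr (_ * _).
  rewrite -sum1_card natr_sum [RHS]big_mkcond [LHS]big_mkcond; apply: eq_bigr => i _.
  by rewrite !inE; case: (i \in T); case: (b i).
rewrite -sumr_const -sumrB; apply: eq_bigr => i _.
by rewrite /sgn; case: (b i) => /=; ring.
Qed.

Lemma pow_size_nat_bits m : (0 < m)%N -> (2 ^ size (nat_bits m) <= 2 * m)%N.
Proof.
move=> m0; have := size_nat_bits_pow m; rewrite nat_bits_half //= expnS; lia.
Qed.

Section Instance.
Variables (R : realType) (z y : nat) (alpha delta theta : R) (H D r : nat).
Hypotheses (y1 : (1 <= y)%N) (yz : (y < z)%N) (al0 : 0 <= alpha) (al1 : alpha <= 1).
Hypotheses (d0 : 0 < delta) (d1 : delta <= 1) (th0 : 0 <= theta).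
Hypotheses (H2 : (2 <= H)%N) (D0 : (0 < D)%N) (r0 : (0 < r)%N) (zr : (z`! %| r)%N).
Hypothesis he1 : H%:R^-1 * z%:R ^+ 2 <= delta / 3.
Hypothesis he2 : H%:R^-1 * (36 * z%:R ^+ 2 * (big_coef_bound z delta)%:R ^+ 2) <= delta / 3.
Hypothesis large : forall e, (0 < e)%N ->
  ((4 * z) ^ e <= 2 * size (greedy_code H (words (D * e))))%N.
Hypothesis scale : (D * (H * (z - y) + z ^ 2) = H * r ^ 2)%N.

Variables (n k : nat) (E : seq {set 'I_n}).
Hypothesis vE : jc_valid z k E.

Let J := log_size (size E).
Let d := (D * 4 ^ J)%N.
Let cw := codeword H D k E.
Let U := universe E.
Let eta : R := H%:R^-1.
(** [Num.sqrt d] cancels the normalization in [code_vector], which makes the points rational; the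
    square of [kappa] is [D / r ^ 2], the same for all instances. *)
Let kappa : R := Num.sqrt d%:R / (r * 2 ^ J)%:R.
Let pt := point z H D r k E.

Let Ez : all (fun T : {set 'I_n} => #|T| == z) E. Proof. by case: vE. Qed.
Let d_gt0 : (0 < d)%N. Proof. by rewrite muln_gt0 D0 expn_gt0. Qed.
Let H0 : 0 < H%:R :> R. Proof. by rewrite ltr0n; apply: leq_trans H2. Qed.
Let eta0 : 0 <= eta. Proof. by rewrite invr_ge0 ltW. Qed.
Let sqd : 0 < Num.sqrt d%:R :> R. Proof. by rewrite sqrtr_gt0 ltr0n. Qed.
Let r2 : 0 < (r * 2 ^ J)%:R :> R. Proof. by rewrite ltr0n muln_gt0 r0 expn_gt0. Qed.
Let kappa0 : 0 < kappa. Proof. exact: divr_gt0. Qed.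

Definition code_vector (i : 'I_n) : 'rV[R]_d :=
  \row_j (sgn R (nth false (cw i) j) / Num.sqrt d%:R).
Let w := code_vector.

Lemma code_vector_dot i j : i \in U -> j \in U ->
  dot (w i) (w j) = (2 * (agreements (cw i) (cw j))%:R - d%:R) / d%:R.
Proof.
move=> iU jU; have [hs _] := codeword_spec k r0 zr H2 D0 Ez large.
rewrite -(@sum_sgn R d (cw i) (cw j)) ?hs // mulr_suml; apply: eq_bigr => l _.
rewrite !mxE mulrACA; congr (_ * _).
by rewrite -invfM -expr2 sqr_sqrtr.
Qed.

Let wu i : i \in U -> dot (w i) (w i) = 1.
Proof.
move=> iU; rewrite code_vector_dot // agreements_refl.
have [hs _] := codeword_spec k r0 zr H2 D0 Ez large; rewrite hs // -/d.
have : d%:R != 0 :> R by rewrite pnatr_eq0 -lt0n.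
by move: (d%:R : R) => x x0; field.
Qed.

Let wo i j : i \in U -> j \in U -> i != j -> `|dot (w i) (w j)| <= eta.
Proof.
move=> iU jU ne; have [hs ho] := codeword_spec k r0 zr H2 D0 Ez large.
rewrite code_vector_dot //; set a := agreements _ _.
have si : size (cw i) = d by exact: hs. have sj : size (cw j) = d by exact: hs.
have [h1 h2] : (H * a <= d + H * (d - a))%N /\ (H * (d - a) <= d + H * a)%N.
  case/orP: (ho i j iU jU ne); rewrite /nearly_orthogonal -/cw ?si ?sj.
    by case/andP.
  by rewrite (agreementsC (u := cw j)) ?si ?sj //; case/andP.
have le : (a <= d)%N by rewrite -si; exact: agreements_le.
have dp : 0 < d%:R :> R by rewrite ltr0n.
rewrite normrM normfV (ger0_norm (ltW dp)) ler_pdivrMr // /eta.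
have g1 : H%:R * a%:R <= d%:R + H%:R * (d%:R - a%:R) :> R by rewrite -natrB // -!natrM -natrD ler_nat.
have g2 : H%:R * (d%:R - a%:R) <= d%:R + H%:R * a%:R :> R by rewrite -natrB // -!natrM -natrD ler_nat.
rewrite [leRHS]mulrC ler_pdivlMr // -[X in _ * X <= _](ger0_norm (ltW H0)) -normrM ler_norml.
move: g1 g2; move: (H%:R : R) (a%:R : R) (d%:R : R) => x1 x2 x3 g1 g2.
by apply/andP; split; lra.
Qed.

Let sub_universe T : T \in E -> T \subset U.
Proof.
by move=> TE; apply/fintype.subsetP => i iT; rewrite inE; apply/hasP; exists T.
Qed.

(** At this scale a sum of [z - y] of the vectors has norm at most 1, as completeness needs. The
    powers of 2 cancel, and [scale] is what remains. *)
Lemma kappa_sq : kappa ^+ 2 * ((z - y)%:R + eta * z%:R ^+ 2) = 1.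
Proof.
rewrite /kappa expr_div_n sqr_sqrtr // /d /eta.
have sc : D%:R * (H%:R * (z - y)%:R + z%:R ^+ 2) = H%:R * r%:R ^+ 2 :> R.
  by rewrite -!natrX -!natrM -natrD -natrM scale.
have p4 : (4 ^ J)%:R = (2 ^ J)%:R ^+ 2 :> R by rewrite -natrX -expnM mulnC expnM.
rewrite !natrM p4.
have n1 : r%:R != 0 :> R by rewrite pnatr_eq0 -lt0n.
have n2 : (2 ^ J)%:R != 0 :> R by rewrite pnatr_eq0 -lt0n expn_gt0.
have n3 : H%:R != 0 :> R by rewrite gt_eqF.
move: sc n1 n2 n3; move: (D%:R : R) (H%:R : R) ((z - y)%:R : R) (z%:R ^+ 2 : R) (r%:R : R) ((2 ^ J)%:R : R).
move=> x1 x2 x3 x4 x5 x6 sc n1 n2 n3.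
have -> : x1 * x6 ^+ 2 / (x5 * x6) ^+ 2 * (x3 + x2^-1 * x4) = x1 * (x2 * x3 + x4) / (x2 * x5 ^+ 2).
  by field; rewrite n1 n2 n3.
by rewrite sc divff // mulf_neq0 // expf_neq0.
Qed.

Lemma point_map T : T \in E -> map_mx ratr (pt T) = kappa *: psum w T.
Proof.
move=> TE; apply/rowP => j; rewrite !mxE rmorphM /= fmorphV rmorphB /= !ratr_nat.
rewrite /psum summxE.
have -> : \sum_(i in T) w i 0 j = (\sum_(i in T) sgn R (nth false (cw i) j)) / Num.sqrt d%:R.
  by rewrite mulr_suml; apply: eq_bigr => i _; rewrite mxE.
rewrite sum_sgn_card (eqP (allP Ez _ TE)) /kappa -/J -/cw.
move: sqd r2; move: (Num.sqrt d%:R : R) ((r * 2 ^ J)%:R : R) (_ - _ : R) => x1 x2 x3 p1 p2.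
by field; rewrite !gt_eqF.
Qed.

Lemma dot_psum_in T i : T \in E -> i \in T -> 1 - eta * z%:R <= dot (w i) (psum w T).
Proof.
move=> TE iT; have sT := sub_universe TE.
have iU := fintype.subsetP sT _ iT.
rewrite dotC /psum dot_suml (bigD1 i) //= wu // lerD2l lerNl.
apply: le_trans (_ : \sum_(j in T | j != i) eta <= _).
  rewrite -sumrN; apply: ler_sum => j /andP[jT ne]; have jU := fintype.subsetP sT _ jT.
  by have := wo jU iU ne; rewrite ler_norml => /andP[h _]; rewrite lerNl.
rewrite sumr_const -[X in X <= _]mulr_natr; apply: ler_wpM2l => //; rewrite ler_nat.
rewrite -(eqP (allP Ez _ TE)); apply: subset_leq_card; apply/fintype.subsetP => j.
by rewrite unfold_in => /andP[].
Qed.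

Lemma dot_psum_out T i : T \in E -> i \in U -> i \notin T -> dot (w i) (psum w T) <= eta * z%:R.
Proof.
move=> TE iU iT; have sT := sub_universe TE.
rewrite dotC /psum dot_suml; apply: le_trans (_ : \sum_(j in T) eta <= _).
  apply: ler_sum => j jT; have jU := fintype.subsetP sT _ jT.
  have ne : j != i by apply: contraNneq iT => <-.
  by have := wo jU iU ne; rewrite ler_norml => /andP[].
by rewrite sumr_const -[X in X <= _]mulr_natr (eqP (allP Ez _ TE)).
Qed.

(** The inner product with [w i] is near 1 or near 0 according to whether [i] is in the set.
    Injectivity is needed because the points must be listed without repetition. *)
Lemma point_inj : {in E &, injective pt}.
Proof.
move=> T1 T2 E1 E2 e.
have ps : psum w T1 = psum w T2.
  have := congr1 (map_mx (ratr : rat -> R)) e; rewrite !point_map //.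
  by move/(congr1 (fun v => kappa^-1 *: v)); rewrite !scalerA mulVf ?gt_eqF // !scale1r.
have c1 := eqP (allP Ez _ E1); have c2 := eqP (allP Ez _ E2).
apply/eqP; rewrite eqEcard c1 c2 leqnn andbT; apply/fintype.subsetP => i i1.
apply/negPn/negP => i2.
have h1 := dot_psum_in E1 i1.
have h2 := dot_psum_out E2 (fintype.subsetP (sub_universe E1) _ i1) i2.
rewrite ps in h1.
have z1 : 1 <= z%:R :> R by rewrite (ler_nat R 1 z) (leq_trans y1 (ltnW yz)).
have : eta * z%:R <= eta * z%:R ^+ 2.
  by apply: ler_wpM2l => //; rewrite expr2 ler_peMl //; lra.
have he1' : eta * z%:R ^+ 2 <= delta / 3 := he1.
move: he1' h1 h2 (d1).
move: (eta * z%:R) (eta * z%:R ^+ 2) (dot _ _) => x1 x2 x3.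
by lra.
Qed.

Lemma dist_scale T (c : 'rV[R]_d) : T \in E ->
  l2norm (map_mx ratr (pt T) - kappa *: c) = kappa * Num.sqrt (dot (psum w T - c) (psum w T - c)).
Proof.
move=> TE; rewrite point_map // -scalerBr l2norm_dot dotZl dotC dotZl mulrA -expr2.
by rewrite sqrtrM ?sqr_ge0 // sqrtr_sqr ger0_norm // ltW.
Qed.

(** The dimension is at most [D * (4 * L + 2)], where [L * ln 2 <= 2 * ln m] and [ln 2 <= ln m];
    this gives the factor [10 = 4 * 2 + 2]. A single point would not do, as [ln 1 = 0]. *)
Lemma points_valid (C : R) : (2 <= size E)%N -> (10 * D + 1)%:R / ln 2 <= C -> km_valid C k (map pt E).
Proof.
move=> m2 hC; case: vE => uE _ _ k0; split=> //.
- by rewrite map_inj_in_uniq //; exact: point_inj.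
- by rewrite size_map; exact: ltnW.
rewrite size_map; set m := size E in m2 *.
have l2 : 0 < ln 2 :> R by rewrite ln_gt0 //; lra.
have lm : ln 2 <= ln m%:R :> R by rewrite ler_ln ?posrE ?ltr0n ?ler_nat //; exact: ltnW.
apply: le_trans (ler_wpM2r _ hC); last by lra.
set L := size (nat_bits m).
have hL : L%:R * ln 2 <= ln 2 + ln m%:R :> R.
  rewrite mulr_natl -lnXn // -lnM ?posrE ?ltr0n //; last exact: ltnW.
  rewrite -natrX -natrM ler_ln ?posrE ?ltr0n ?expn_gt0 ?muln_gt0 ?(ltnW m2) // ler_nat.
  by apply: pow_size_nat_bits; exact: ltnW.
have hJ : (4 ^ J)%:R <= 4 * L%:R + 2 :> R by rewrite -natrM -natrD ler_nat log_size_le.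
have D0' : 0 <= D%:R :> R by [].
rewrite mulrAC ler_pdivlMr // /d natrM -mulrA.
apply: le_trans (_ : D%:R * (10 * ln m%:R) <= _); last first.
  by rewrite natrD natrM; move: (ln m%:R : R) lm l2 D0' (D%:R : R) => x ? ? ? ?; lra.
apply: ler_wpM2l => //; apply: le_trans (_ : (4 * L%:R + 2) * ln 2 <= _).
  by apply: ler_wpM2r => //; lra.
by move: hL lm; move: (ln m%:R : R) (ln 2 : R) (L%:R : R) => ? ? ? ? ?; lra.
Qed.

Lemma points_complete : jc_completeness y k E ->
  exists (c : 'I_k -> 'rV[R]_d) (sigma : 'rV[rat]_d -> 'I_k),
    km_cost (map pt E) c sigma <= (size (map pt E))%:R.
Proof.
case=> S [cS cov]; have k0 : (0 < k)%N by case: vE.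
pose c i := kappa *: psum w (S i).
(* [sigma] depends on the point, not on the set; it looks for a center within distance 1, so the
   default is not reached on points of the instance. *)
pose sigma (a : 'rV[rat]_d) := odflt (Ordinal k0) [pick i | l2norm (map_mx ratr a - c i) <= 1].
exists c, sigma; rewrite /km_cost big_map size_map.
apply: le_trans (_ : \sum_(T <- E) 1 <= _); last by rewrite big_const_seq count_predT iter_addr_0.
rewrite big_seq [X in _ <= X]big_seq; apply: ler_sum => T TE.
rewrite /sigma; case: pickP => [i h|] //=; have [i sT] := cov T TE => /(_ i) /negbT /negP [].
rewrite dist_scale //.
have -> : psum w T - psum w (S i) = psum w (T :\: S i).
  rewrite /psum (big_setID (S i)) /= (finset.setIidPr sT).
  by rewrite addrAC subrr add0r.
have sDU : T :\: S i \subset U.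
  by apply: fintype.subset_trans (sub_universe TE); exact: subsetDl.
have := psum_norm eta0 wu wo sDU; rewrite cardsD (finset.setIidPr sT) cS (eqP (allP Ez _ TE)).
rewrite ler_norml => /andP[_ hN].
rewrite -[X in _ <= X](@sqrtr1 R) -kappa_sq -[X in X * Num.sqrt _](ger0_norm (ltW kappa0)).
rewrite -sqrtr_sqr -sqrtrM ?sqr_ge0 //; apply: ler_wsqrtr; apply: ler_wpM2l; first exact: sqr_ge0.
have : eta * (z - y)%:R ^+ 2 <= eta * z%:R ^+ 2.
  by apply: ler_wpM2l => //; rewrite lerXn2r ?nnegrE ?ler0n // ler_nat leq_subr.
move: hN; move: (eta * (z - y)%:R ^+ 2) (eta * z%:R ^+ 2) (dot _ _) => ? ? ?.
by lra.
Qed.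

Lemma points_sound (eps : R) : 3 / 2 * delta + 3 / 2 * theta <= eps ->
  jc_soundness alpha y k E ->
  (k * (2 ^ big_coef_bound z delta * n ^ (z - y - 1)))%:R <= theta * (size E)%:R ->
  forall (c : 'I_k -> 'rV[R]_d) (sigma : 'rV[rat]_d -> 'I_k),
  (alpha + Num.sqrt (((z - y)%:R + 2^-1) / (z - y)%:R) * (1 - alpha) - eps) * (size (map pt E))%:R
    <= km_cost (map pt E) c sigma.
Proof.
move=> heps sound few c sigma; rewrite size_map.
have yn : (y <= n)%N.
  case: vE => _ _ + _; move: Ez; case: E => // T s /= /andP[/eqP cT _] _.
  by have := max_card (mem T); rewrite card_ord cT; apply: leq_trans; exact: ltnW.
have z1 : (1 <= z)%N by exact: leq_trans y1 (ltnW yz).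
(* Dividing the centers by [kappa] brings them to the scale of [psum]. *)
have dich i := @center_dichotomy R z y delta z1 y1 d0 d1 eta d n w U (kappa^-1 *: c i)
  eta0 he1 he2 wu wo yn.
have [S hS] := boolp.choice dich; have [X hX] := boolp.choice hS.
pose sg (T : {set 'I_n}) := sigma (pt T).
pose f (T : {set 'I_n}) := Num.sqrt (dot (psum w T - kappa^-1 *: c (sg T)) (psum w T - kappa^-1 *: c (sg T))).
have cost : km_cost (map pt E) c sigma = kappa * \sum_(T <- E) f T.
  rewrite /km_cost big_map mulr_sumr; apply: eq_big_seq => T TE.
  by rewrite -dist_scale // scalerA divff ?gt_eqF // scale1r.
have a1 : 1 <= (z - y)%:R :> R by rewrite (ler_nat R 1) subn_gt0.
have nzy : z%:R - y%:R = (z - y)%:R :> R by rewrite natrB // ltnW.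
set a := (z - y)%:R in a1 nzy *.
pose lo := Num.sqrt (a - delta); pose hi := Num.sqrt (a + 2^-1 - delta).
pose cov (T : {set 'I_n}) := [exists i, S i \subset T].
pose exc (T : {set 'I_n}) := (y < #|T :&: X (sg T)|)%N.
have low : alpha * (size E)%:R * lo + (1 - alpha) * (size E)%:R * hi - (count exc E)%:R * hi
    <= \sum_(T <- E) f T.
  apply: (@covered_sum_lower _ _ _ cov exc).
  - exact: sqrtr_ge0.
  - by apply: ler_wsqrtr; lra.
  - by move=> T; exact: sqrtr_ge0.
  - by apply: sound => i; have [] := hX i.
  - move=> T TE; rewrite /exc -leqNgt => hT.
    have [_ _ /(_ T (sub_universe TE) (eqP (allP Ez _ TE)) hT) [h1 h2]] := hX (sg T).
    rewrite nzy in h1 h2.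
    rewrite /cov; case: ifPn => [_|/existsPn nS]; apply: ler_wsqrtr; first exact: h1.
    by apply: h2; exact: nS.
have hexc : (count exc E)%:R <= theta * (size E)%:R.
  apply: le_trans few; rewrite ler_nat; apply: count_exceptional => //; first by case: vE.
  by move=> i; have [] := hX i.
have m0 : 0 <= (size E)%:R :> R by [].
have e0 : 0 <= eta * z%:R ^+ 2 by rewrite mulr_ge0 // exprn_ge0.
have := ratio_bound a1 e0 he1 d0 d1 th0 (ltW kappa0) kappa_sq al0 al1 m0 (ler0n _ _) hexc.
rewrite -/lo -/hi => rb; rewrite cost.
apply: le_trans (ler_wpM2l (ltW kappa0) low); apply: le_trans rb.
by apply: ler_wpM2r => //; lra.
Qed.
End Instance.

(** * Small and trivial instances *)

Lemma encw_cat_inj x x' s s' : encw x ++ s = encw x' ++ s' -> x = x' /\ s = s'.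
Proof.
elim: x x' => [|b x IH] [|b' x']; rewrite ?encw_cons //=; first by case.
by move=> [-> /IH [-> ->]].
Qed.

Lemma encode_inj : injective encode.
Proof.
elim=> [|x xs IH] [|x' xs'] //.
- by rewrite encode_cons; case: x'.
- by rewrite encode_cons; case: x.
- by rewrite !encode_cons => /encw_cat_inj[-> /IH ->].
Qed.

Lemma nat_bits_inj : injective nat_bits.
Proof.
pose value := foldr (fun (b : bool) m => (b + m.*2)%N) 0%N.
suff valueK : cancel nat_bits value by exact: can_inj valueK.
move=> n; have [m] := ubnP n; elim: m n => // m IH [|n] le; first by rewrite nat_bits0.
have e : value (odd n.+1 :: nat_bits n.+1./2) = (odd n.+1 + (value (nat_bits n.+1./2)).*2)%N by [].
rewrite nat_bits_half // e IH ?odd_double_half //.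
by have := odd_double_half n.+1; lia.
Qed.

Lemma size_nat_bits_le k : (size (nat_bits k) <= k)%N.
Proof.
have := ltn_expl (size (nat_bits k)) (isT : (1 < 2)%N); case: (posnP k) => [->|k0]; first by rewrite nat_bits0.
case e: (size (nat_bits k)) => [|s] // _.
have := pow_size_nat_bits k0; rewrite e expnS leq_pmul2l // => h.
by apply: leq_trans h; exact: ltn_expl.
Qed.

Lemma size_encode_le b xs : all (fun x : bits => size x <= b)%N xs ->
  (size (encode xs) <= size xs * (2 * b + 1))%N.
Proof.
elim: xs => // x xs IH /= /andP[hx /IH h].
by rewrite encode_cons size_cat size_encw mulSn; lia.
Qed.

(** Equal codes yield [n = n'] only as a proposition, so the families are compared through
    [cast_ord]. *)
Lemma jc_list_inj n n' k k' (E : seq {set 'I_n}) (E' : seq {set 'I_n'}) :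
  jc_list k E = jc_list k' E' -> k = k' /\ exists e : n = n', E' = map (fun T : {set 'I_n} => [set i | cast_ord (esym e) i \in T]) E.
Proof.
case=> /nat_bits_inj -> eN eE; split=> //.
have e : n = n' by rewrite -(size_nseq n true) eN size_nseq.
exists e; case: n' / e E' eE {eN} => E' eE.
have inj : injective (fun T : {set 'I_n} => [seq i \in T | i <- enum 'I_n]).
  move=> T T' /eq_in_map h; apply/setP => i; apply: h; exact: mem_enum.
rewrite -(inj_map inj eE) -[LHS]map_id; apply: eq_map => T.
by apply/setP => i; rewrite inE; congr (_ \in T); exact: val_inj.
Qed.

Lemma card_sets n : #|{: {set 'I_n}}| = (2 ^ n)%N.
Proof. by rewrite -cardsT -powersetT card_powerset cardsT card_ord. Qed.

Section SmallInstances.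
Variables (R : realType) (z y : nat) (alpha : R).
Hypothesis al1 : alpha < 1.

Lemma yes_not_no n k (E : seq {set 'I_n}) : (0 < size E)%N ->
  jc_completeness y k E -> ~ jc_soundness alpha y k E.
Proof.
move=> E0 [S [cS cov]] /(_ S cS).
rewrite (_ : count _ E = size E); last first.
  by apply/eqP; rewrite -all_count; apply/allP => T /cov h; apply/existsP.
have : 0 < (size E)%:R :> R by rewrite ltr0n.
move=> p; rewrite leNgt => /negP; apply.
by rewrite gtr_pMl.
Qed.

(** With [2 ^ n] choices all [y]-subsets can be taken, and they cover everything. So no-instances
    over a given universe are finitely many, while yes-instances exist for all large [k]. *)
Lemma no_instance_k n k (E : seq {set 'I_n}) : (y <= z)%N -> jc_valid z k E ->
  jc_soundness alpha y k E -> (k < 2 ^ n)%N.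
Proof.
move=> yz [uE zE E0 k0] sound; rewrite ltnNge; apply/negP => le.
apply: (yes_not_no E0 _ sound).
pose A := [set S : {set 'I_n} | #|S| == y].
have cA : (#|A| <= k)%N.
  apply: leq_trans le; apply: leq_trans (max_card _) _.
  by rewrite card_sets.
have sub T : T \in E -> exists2 S, S \in A & S \subset T.
  move=> TE; have yT : (y <= #|T|)%N by rewrite (eqP (allP zE _ TE)).
  by have [S sS cS] := exists_subset_card yT; exists S => //; rewrite inE cS.
have [S0 S0A] : exists S0, S0 \in A.
  by case: E E0 sub {uE zE sound} => // T s _ /(_ T (mem_head _ _)) [S SA _]; exists S.
exists (fun i => nth S0 (enum A) i); split=> [i|T TE].
  have [lt|ge] := ltnP i (size (enum A)); last by rewrite nth_default //; move: S0A; rewrite inE => /eqP.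
  by have := mem_nth S0 lt; rewrite mem_enum inE => /eqP.
have [S SA sT] := sub T TE.
have lt : (index S (enum A) < k)%N.
  by apply: leq_trans cA; rewrite cardE index_mem mem_enum.
by exists (Ordinal lt); rewrite /= nth_index // mem_enum.
Qed.

Definition small_size (n0 : nat) : nat := ((2 ^ n0 + 2) * (2 * (2 ^ n0 + n0) + 1))%N.

Lemma small_no_size n0 n k (E : seq {set 'I_n}) : (y <= z)%N -> (n < n0)%N -> jc_valid z k E ->
  jc_soundness alpha y k E -> (size (jc_code k E) <= small_size n0)%N.
Proof.
move=> yz lt vE sound; have hk := no_instance_k yz vE sound; case: vE => uE _ _ _.
have p : (2 ^ n <= 2 ^ n0)%N by rewrite leq_exp2l // ltnW.
apply: leq_trans (@size_encode_le (2 ^ n0 + n0) _ _) _.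
  rewrite /= size_nseq; apply/and3P; split.
  - by apply: leq_trans (size_nat_bits_le k) _; lia.
  - by lia.
  - by apply/allP => x /mapP[T _ ->]; rewrite size_map size_enum_ord; lia.
rewrite /small_size leq_mul2r; apply/orP; right; rewrite /= size_map.
have : (size E <= 2 ^ n)%N.
  by rewrite -(card_uniqP uE); apply: leq_trans (max_card _) _; rewrite card_sets.
by lia.
Qed.
End SmallInstances.

Section Constants.
Variables (R : realType) (C beta : R).

(** For a single point [ln 1 = 0], which is why the dimension is 0 here. *)
Lemma trivial_yes : yes_instance (gap_kmedian C beta) (km_code 1 [:: 0 : 'rV[rat]_0]).
Proof.
exists 0%N, 1%N, [:: 0]; split=> //; first by split=> //=; rewrite ln1 mulr0.
exists (fun _ => 0), (fun _ => ord0); rewrite /km_cost big_seq1 /l2norm big_ord0 sqrtr0.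
by rewrite ler01.
Qed.

Definition far_points (M : nat) : seq 'rV[rat]_1 := [:: 0; const_mx M%:R].

(** By the triangle inequality, one center cannot serve two points at distance [M] for less than
    [M]. *)
Lemma trivial_no M : 1 <= C * ln 2 -> 0 < beta -> beta * 2 <= M%:R ->
  no_instance (gap_kmedian C beta) (km_code 1 (far_points M)).
Proof.
move=> hC b0 hM; have M0 : 0 < M%:R :> R by lra.
exists 1%N, 1%N, (far_points M); split=> //.
  split=> //=; rewrite inE andbT; apply/eqP => /rowP /(_ ord0); rewrite !mxE => /eqP.
  by rewrite eq_sym pnatr_eq0; move: M0; rewrite ltr0n; case: M {hM}.
move=> c sigma; rewrite /km_cost /far_points !big_cons big_nil addr0.
rewrite (ord1 (sigma 0)) (ord1 (sigma (const_mx _))) /l2norm !big_ord1 !sqrtr_sqr !mxE.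
rewrite rmorph0 sub0r normrN ratr_nat; set x := c _ _ _.
apply: le_trans hM _; have := ler_norm x; have := ler_norm (M%:R - x).
by lra.
Qed.
End Constants.

(** * The hardness theorem *)

(* Density says nothing about small universes: their finitely many no-instances
   are looked up in a table. *)
Definition tabulated_reduction (z H D r n0 m0 : nat) (table : bits -> bits) (l : seq bits) : bits :=
  if (size (head [::] (behead l)) < n0)%N then table (take m0 (encode l)) else reduction z H D r l.

Lemma pf_tabulated_reduction z H D r n0 m0 table :
  pf (clist craw) craw (tabulated_reduction z H D r n0 m0 table).
Proof.
apply: pf_if; last exact: pf_reduction.
  apply: pf_leq; last exact: pf_const.
  apply: pf_succ; apply: (@pf_size_list _ _ _ cbool); apply: (pf_app pf_unpack).
  by apply: pf_head'; exact: pf_behead.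
apply: (pf_app (pf_table craw table m0)); apply: (pf_app pf_unpack).
by apply: pf_encode; exact: pf_id.
Qed.

(** A reduction to [P] always lands in the promise, so each of its outputs is the code of some list;
    classical choice picks that list. *)
Lemma NP_hard_reduce (P Q : promise_problem) (h : seq bits -> bits) :
  pf (clist craw) craw h ->
  (forall x, yes_instance P x \/ no_instance P x -> exists l, x = encode l) ->
  (forall l, yes_instance P (encode l) -> yes_instance Q (h l)) ->
  (forall l, no_instance P (encode l) -> no_instance Q (h l)) ->
  NP_hard P -> NP_hard Q.
Proof.
move=> hp code hyes hno hard L /hard [f [pf_f hf]].
have dec x : exists l, f x = encode l.
  by apply: code; have [hy hn] := hf x; case: (pselect (L x)) => [/hy|/hn]; [left|right].
have [arg harg] := boolp.choice dec.
exists (fun x => h (arg x)); split.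
  apply: (@polytime_comp f _ (clist craw) h arg) => // x.
  by rewrite harg /clist /craw map_id.
by move=> x; have [hy hn] := hf x; rewrite harg in hy hn; split=> [/hy|/hn]; [exact: hyes|exact: hno].
Qed.

(** With [base = H * (z - y) + z ^ 2], [D = H * base * c ^ 2] and [r = base * c], the identity
    [D * base = H * r ^ 2] holds for every [c]. So [H] is taken large first, and then [c] as a
    multiple of [z!] large enough for the greedy code. *)
Lemma reduction_parameters (z y M b : nat) (R : realType) (delta : R) :
  0 < delta -> (y < z)%N -> exists H D r : nat,
  [/\ (2 <= H)%N /\ (0 < D)%N, (0 < r)%N /\ (z`! %| r)%N,
      H%:R^-1 * z%:R ^+ 2 <= delta / 3 /\ H%:R^-1 * (36 * z%:R ^+ 2 * b%:R ^+ 2) <= delta / 3,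
      forall e, (0 < e)%N -> (M ^ e <= 2 * size (greedy_code H (words (D * e))))%N
    & (D * (H * (z - y) + z ^ 2) = H * r ^ 2)%N].
Proof.
move=> dp yz; pose Y : R := 3 * (z%:R ^+ 2 + 36 * z%:R ^+ 2 * b%:R ^+ 2) / delta.
pose H := (Num.bound Y).+2; have H2 : (2 <= H)%N by [].
have [D1 hD1] := @greedy_code_large H M H2.
pose base := (H * (z - y) + z ^ 2)%N; pose c := (z`! * D1.+1)%N.
have base0 : (0 < base)%N by rewrite addn_gt0 muln_gt0 /= subn_gt0 yz.
have c0 : (0 < c)%N by rewrite muln_gt0 fact_gt0.
have z2 : 0 <= z%:R ^+ 2 :> R by exact: sqr_ge0.
have b2 : 0 <= 36 * z%:R ^+ 2 * b%:R ^+ 2 :> R by rewrite !mulr_ge0 ?sqr_ge0.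
have H0 : 0 < H%:R :> R by rewrite ltr0n.
have hY : Y <= H%:R.
  have p : 0 <= Y by apply: divr_ge0; lra.
  apply: le_trans (ltW (archi_boundP p)) _; rewrite ler_nat /H; lia.
have small x : 0 <= x -> x <= z%:R ^+ 2 + 36 * z%:R ^+ 2 * b%:R ^+ 2 -> H%:R^-1 * x <= delta / 3.
  move=> x0 hx; rewrite mulrC ler_pdivrMr // mulrAC ler_pdivlMr //.
  move: hY; rewrite /Y ler_pdivrMr // mulrC [H%:R * _]mulrC.
  by move: hx; move: (_ + _) => S; lra.
have D0 : (0 < H * base * c ^ 2)%N by rewrite muln_gt0 muln_gt0 base0 expn_gt0 c0.
exists H, (H * base * c ^ 2)%N, (base * c)%N; split.
- by [].
- by rewrite muln_gt0 base0 c0 /c mulnCA dvdn_mulr.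
- by split; apply: small => //; lra.
- move=> e e0; apply: hD1 => //.
  have f0 := fact_gt0 z; rewrite -/base in base0.
  apply: leq_trans (_ : c <= _)%N; first by rewrite /c; nia.
  by rewrite -mulnn mulnA leq_pmull // muln_gt0 muln_gt0 base0 c0.
- by rewrite -/base; ring.
Qed.

Lemma cvg_pinfty_eventually (R : realType) (g : nat -> R) (A : R) :
  (g n @[n --> \oo] --> +oo%R)%classic -> exists n0, forall n, (n0 <= n)%N -> A <= g n.
Proof. by move=> /cvgryPge /(_ A) [n0 _ hn0]; exists n0 => n le; exact: hn0. Qed.

Unset Implicit Arguments.

Theorem theorem3p24 (R : realType) (z y : nat) (alpha : R) :
  (1 <= y)%N -> (y < z)%N -> 0 <= alpha -> alpha < 1 ->
  johnson_coverage_star_NP_hard alpha z y ->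
  forall eps : R, 0 < eps ->
  exists C : R,
    NP_hard (gap_kmedian C
      (alpha + Num.sqrt (((z - y)%:R + 2^-1) / (z - y)%:R) * (1 - alpha)
       - eps)).
Proof.
move=> y1 yz al0 al1 [g [hg hard]] eps eps0.
pose beta := alpha + Num.sqrt (((z - y)%:R + 2^-1) / (z - y)%:R) * (1 - alpha) - eps.
(* Soundness loses [3 / 2 * delta + 3 / 2 * theta], and [theta] will be [delta] too. *)
pose delta := Num.min 1 (eps / 3).
have delta0 : 0 < delta by rewrite lt_min ltr01 divr_gt0.
have delta1 : delta <= 1 by rewrite ge_min lexx.
have delta_eps : 3 / 2 * delta + 3 / 2 * delta <= eps.
  have : delta <= eps / 3 by rewrite ge_min lexx orbT.
  by lra.
pose b := big_coef_bound z delta.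
have [H [D [r [[H2 D0] [r0 zr] [he1 he2] large scale]]]] :=
  @reduction_parameters z y (4 * z) b R delta delta0 yz.
(* The first summand makes the exceptional sets at most a fraction [delta] of the family; the second
   ensures at least two points. *)
have [n0 hn0] := @cvg_pinfty_eventually R g ((2 ^ b)%:R / delta + 2) hg.
pose C : R := (10 * D + 1)%:R / ln 2.
exists C; rewrite -/beta.
have l2 : 0 < ln 2 :> R by rewrite ln_gt0 //; lra.
have C2 : 1 <= C * ln 2 by rewrite /C divfK ?gt_eqF // ler1n addn1.
pose far := Num.bound (Num.max 0 (beta * 2)).
have hfar : beta * 2 <= far%:R.
  have p : 0 <= Num.max 0 (beta * 2) by rewrite le_max lexx.
  by apply: le_trans (ltW (archi_boundP p)); rewrite le_max lexx orbT.
pose bad (x : bits) := exists n k (E : seq {set 'I_n}),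
  [/\ (n < n0)%N, x = jc_code k E, jc_valid z k E & jc_soundness alpha y k E].
(* For large [eps] the factor [beta] may be nonpositive, and then even the single point is a
   no-instance. *)
pose no_code := if `[< 0 < beta >] then km_code 1 (far_points far) else km_code 1 [:: 0 : 'rV[rat]_0].
(* Whatever is not recognized as a no-instance with a small universe is answered yes. *)
pose table x := if `[< bad x >] then no_code else km_code 1 [:: 0 : 'rV[rat]_0].
have no_no : no_instance (gap_kmedian C beta) no_code.
  rewrite /no_code; case: asboolP => [hb|hb]; first exact: trivial_no.
  exists 0%N, 1%N, [:: 0]; split=> //; first by split=> //=; rewrite ln1 mulr0.
  move=> c sigma; apply: le_trans (_ : 0 <= _).
    by rewrite mulr1 leNgt; apply/negP.
  by rewrite /km_cost big_seq1 sqrtr_ge0.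
(* One bit more than any small no-instance has, so that a longer code cut off at [m0] bits is not
   mistaken for one. *)
pose m0 := (small_size n0).+1.
have dense_big n k (E : seq {set 'I_n}) : (n0 <= n)%N -> jc_valid z k E -> jc_dense g z y k E ->
    (2 <= size E)%N /\ (k * (2 ^ b * n ^ (z - y - 1)))%:R <= delta * (size E)%:R.
  move=> le vE; rewrite /jc_dense => dE.
  have k0 : (0 < k)%N by case: vE.
  have nn : (0 < n ^ (z - y - 1))%N.
    rewrite expn_gt0; apply/orP; left; case: vE; case: E {dE} => // T s _ /= /andP[/eqP cT _] _ _.
    have := max_card (mem T); rewrite card_ord cT; apply: leq_trans; exact: leq_ltn_trans yz.
  have pos : 1 <= (k * n ^ (z - y - 1))%:R :> R by rewrite ler1n muln_gt0 k0.
  have gn := hn0 n le.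
  have q : 0 <= (2 ^ b)%:R / delta by rewrite divr_ge0 // ltW.
  have h2 : ((2 ^ b)%:R / delta + 2) * (k * n ^ (z - y - 1))%:R <= (size E)%:R.
    by apply: le_trans dE; apply: ler_wpM2r => //; lra.
  have h3 : 0 <= (2 ^ b)%:R / delta * (k * n ^ (z - y - 1))%:R by rewrite mulr_ge0.
  split; first by rewrite -(ler_nat R); lra.
  have -> : (k * (2 ^ b * n ^ (z - y - 1)))%:R = (2 ^ b)%:R / delta * (k * n ^ (z - y - 1))%:R * delta :> R.
    by rewrite mulnCA natrM mulrAC divfK // gt_eqF.
  rewrite [leRHS]mulrC; apply: ler_wpM2r; first exact: ltW.
  by lra.
apply: (@NP_hard_reduce _ _ (tabulated_reduction z H D r n0 m0 table) _ _ _ _ hard).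
- exact: pf_tabulated_reduction.
- by move=> x [] [n [k [E [-> _ _ _]]]]; exists (jc_list k E).
- move=> l [n [k [E [e vE dE cE]]]].
  have {e} -> : l = jc_list k E by exact: encode_inj.
  rewrite /tabulated_reduction /= size_nseq; case: ltnP => [lt|le]; last first.
    have [m2 _] := dense_big n k E le vE dE.
    have Ez : all (fun T : {set 'I_n} => #|T| == z) E by case: vE.
    rewrite reduction_jc //; exists _, k, [seq point z H D r k E T | T <- E]; split=> //.
      exact: (@points_valid R z y delta H D r).
    exact: (@points_complete R z y H D r).
  rewrite /table; case: asboolP => [bd|_]; last exact: trivial_yes.
  (* A yes-instance recognized by the table would coincide with a no-instance, which [alpha < 1] and
     the nonempty family exclude. *)
  exfalso; case: bd => n' [k' [E' [lt' e' vE' sE']]].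
  have hs := small_no_size al1 (ltnW yz) lt' vE' sE'.
  move: e'; have : (size (take m0 (encode (jc_list k E))) <= small_size n0)%N -> take m0 (encode (jc_list k E)) = encode (jc_list k E).
    by rewrite size_take; case: ltnP => [_|h _]; [rewrite ltnn|rewrite take_oversize].
  move=> tk e'; have := tk; rewrite e' => /(_ hs) /esym /encode_inj /jc_list_inj [ek [en eE]].
  case: n' / en E' lt' e' vE' sE' hs tk eE => // E' lt' e' vE' sE' hs tk eE.
  have {}eE : E' = E.
    rewrite eE -[RHS]map_id; apply: eq_map => T; apply/setP => i; rewrite inE.
    by congr (_ \in T); exact: val_inj.
  by apply: (yes_not_no al1 _ cE); [case: vE|rewrite -eE ek].
- move=> l [n [k [E [e vE dE sE]]]].
  have {e} -> : l = jc_list k E by exact: encode_inj.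
  rewrite /tabulated_reduction /= size_nseq; case: ltnP => [lt|le]; last first.
    have [m2 few] := dense_big n k E le vE dE.
    have Ez : all (fun T : {set 'I_n} => #|T| == z) E by case: vE.
    rewrite reduction_jc //; exists _, k, [seq point z H D r k E T | T <- E]; split=> //.
      exact: (@points_valid R z y delta H D r).
    by apply: (@points_sound R z y alpha delta delta H D r) => //; exact: ltW.
  have hs := small_no_size al1 (ltnW yz) lt vE sE.
  have -> : take m0 (encode (jc_list k E)) = jc_code k E by rewrite take_oversize // ltnW.
  rewrite /table; case: asboolP => // nb; exfalso; apply: nb.
  by exists n, k, E.
Qed.
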